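(* Let $n,m,d\geq 1$ be integers, $1<p<\infty$, let $U,V$ be biparameter $d\times d$-matrix valued $A_p$ weights on $\mathbb{R}^n\times\mathbb{R}^m$, and let $B\in L^1_{\mathrm{loc}}(\mathbb{R}^{n+m};M_d(\mathbb{C}))$. Then $$\|B\|_{\mathrm{bmo}(U,V,p)}\sim\|B\|_{\widetilde{\mathrm{bmo}}(U,V,p)},$$ i.e. each of the two (possibly infinite) quantities is bounded by a finite positive constant times the other, where the constants depend only on $n,m,d,p,[U]_{A_p(\mathbb{R}^n\times\mathbb{R}^m)}$ and $[V]_{A_p(\mathbb{R}^n\times\mathbb{R}^m)}$.
   Context: $M_d(\mathbb{C})$ is the set of complex $d\times d$ matrices, $|A|$ is the operator norm (largest singular value) of $A\in M_d(\mathbb{C})$, $|e|$ the Euclidean norm of $e\in\mathbb{C}^d$, $\langle f\rangle_E=\frac{1}{|E|}\int_E f\,dx$, and averaged integrals are written $\frac{1}{|E|}\int_E$. $B\in L^1_{\mathrm{loc}}(\mathbb{R}^{n+m};M_d(\mathbb{C}))$ means that $|B(x)|$ is locally integrable. A rectangle in $\mathbb{R}^n\times\mathbb{R}^m$ is a set $R=R_1\times R_2$ with $R_1$ a cube in $\mathbb{R}^n$ and $R_2$ a cube in $\mathbb{R}^m$ (cubes have sides parallel to the coordinate axes). A $d\times d$-matrix valued weight $W$ is a locally integrable $M_d(\mathbb{C})$-valued function that is positive definite a.e. It is a biparameter $A_p$ weight on $\mathbb{R}^n\times\mathbb{R}^m$ if $$[W]_{A_p(\mathbb{R}^n\times\mathbb{R}^m)}:=\sup_R\frac1{|R|}\int_R\Big(\frac1{|R|}\int_R|W(x)^{1/p}W(y)^{-1/p}|^{p'}dy\Big)^{p/p'}dx<\infty,$$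 the supremum being over all rectangles $R$, with $1/p+1/p'=1$. Reducing operators: for a bounded measurable set $E$ of positive measure and a weight $W$ integrable over $E$, a reducing operator of $W$ over $E$ with respect to the exponent $p$ is a positive definite matrix $\mathcal{W}_E$ with $$\Big(\frac1{|E|}\int_E|W(x)^{1/p}e|^p dx\Big)^{1/p}\le|\mathcal{W}_Ee|\le\sqrt d\Big(\frac1{|E|}\int_E|W(x)^{1/p}e|^pdx\Big)^{1/p}\quad\text{for all }e\in\mathbb{C}^d.$$ Such a matrix exists; one is fixed for each $E$ (with $\mathcal{W}_E=\langle W\rangle_E^{1/p}$ if $d=1$ or $p=2$). $\mathcal{U}_R,\mathcal{V}_R$ are the reducing operators of $U,V$ over $R$ with respect to $p$. $$\|B\|_{\mathrm{bmo}(U,V,p)}:=\sup_R\Big(\frac1{|R|}\int_R|V(x)^{1/p}(B(x)-\langle B\rangle_R)\mathcal{U}_R^{-1}|^pdx\Big)^{1/p},$$ $$\|B\|_{\widetilde{\mathrm{bmo}}(U,V,p)}:=\sup_R\frac1{|R|}\int_R|\mathcal{V}_R(B(x)-\langle B\rangle_R)\mathcal{U}_R^{-1}|dx,$$ both suprema over all rectangles $R$ in $\mathbb{R}^n\times\mathbb{R}^m$. *)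

(* Defs.v *)
From HB Require Import structures.
From mathcomp Require Import all_boot all_order all_algebra.
From mathcomp Require Import all_classical all_reals all_analysis.
From mathcomp Require Import complex.

Set Implicit Arguments.
Unset Strict Implicit.
Unset Printing Implicit Defensive.

Import Order.TTheory GRing.Theory Num.Theory.
Import numFieldNormedType.Exports.

Local Open Scope classical_set_scope.
Local Open Scope ring_scope.
Local Open Scope complex_scope.
Local Open Scope sesquilinear_scope.

(* R^n with its Borel sigma-algebra (the product of the Borel sigma-algebras
   of the coordinates). *)
Notation Rn R n := (n.-tuple (measurableTypeR R)).

Section tuple_measure.
Context {d} {T : measurableType d} {R : realType}.
Variable mu : {sigma_finite_measure set T -> \bar R}.
Local Open Scope ereal_scope.

Definition tcons n (z : T * n.-tuple T) : n.+1.-tuple T :=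
  [the n.+1.-tuple _ of z.1 :: z.2].

Definition tuncons n (x : n.+1.-tuple T) : T * n.-tuple T :=
  (tnth x ord0, [tuple of behead x]).

Lemma measurable_tcons n : measurable_fun setT (@tcons n).
Proof. exact: measurable_cons. Qed.

Lemma measurable_tuncons n : measurable_fun setT (@tuncons n).
Proof.
apply: measurable_fun_pair; first exact: measurable_tnth.
exact: measurable_behead.
Qed.

Lemma tconsK n : cancel (@tcons n) (@tuncons n).
Proof. by move=> [a x]; congr pair; exact: val_inj. Qed.

(* The library has this fact, but not as a usable canonical instance. *)
Lemma sigma_finite_product d' (T' : measurableType d')
    (nu : {sigma_finite_measure set T' -> \bar R}) :
  sigma_finite setT (mu \x nu).
Proof.
have /sigma_finiteP[F [TF ndF Foo]] := sigma_finiteT mu.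
have /sigma_finiteP[G [TG ndG Goo]] := sigma_finiteT nu.
exists (fun k => F k `*` G k).
  rewrite -setXTT TF TG predeqE => -[x y]; split=> [[/= [i _ Fx] [j _ Gy]]|].
    exists (maxn i j) => //; split.
    - by move: x Fx; exact/subsetPset/ndF/leq_maxl.
    - by move: y Gy; exact/subsetPset/ndG/leq_maxr.
  by move=> [i _ []/= ? ?]; split; exists i.
move=> k; have [? ?] := Foo k; have [? ?] := Goo k.
split; first exact: measurableX.
by rewrite product_measure1E// lte_mul_pinfty// ge0_fin_numE.
Qed.

Section cons_measure.
Variables (n : nat) (nu : {sigma_finite_measure set (n.-tuple T) -> \bar R}).

Definition cons_measure : set (n.+1.-tuple T) -> \bar R :=
  pushforward (mu \x nu) (@tcons n).

Let measurable_tcons_preimage A : measurable A -> measurable (@tcons n @^-1` A).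
Proof.
by move=> mA; rewrite -[X in measurable X]setTI; exact: measurable_tcons.
Qed.

Let cons_measure0 : cons_measure set0 = 0.
Proof. by rewrite /cons_measure /pushforward preimage_set0 measure0. Qed.

Let cons_measure_ge0 A : 0 <= cons_measure A.
Proof. by rewrite /cons_measure /pushforward measure_ge0. Qed.

Let cons_measure_sigma_additive : semi_sigma_additive cons_measure.
Proof.
move=> F mF tF mUF; rewrite /cons_measure /pushforward preimage_bigcup.
apply: measure_semi_sigma_additive.
- by move=> k; exact: measurable_tcons_preimage.
- apply/trivIsetP => i j _ _ ij; rewrite -preimage_setI.
  by move/trivIsetP : tF => /(_ _ _ I I ij) ->; rewrite preimage_set0.
- by rewrite -preimage_bigcup; exact: measurable_tcons_preimage.
Qed.

HB.instance Definition _ := isMeasure.Build _ _ _ cons_measure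
  cons_measure0 cons_measure_ge0 cons_measure_sigma_additive.

Let cons_measure_sigma_finite : sigma_finite setT cons_measure.
Proof.
have [F FT mF] := sigma_finite_product nu.
exists (fun k => @tuncons n @^-1` F k).
  by rewrite -preimage_bigcup -FT preimage_setT.
move=> k; have [mFk Fkoo] := mF k; split.
  by rewrite -[X in measurable X]setTI; exact: measurable_tuncons.
rewrite /cons_measure /pushforward -comp_preimage.
by rewrite (_ : _ \o _ = id) ?preimage_id//; apply/funext => z /=; exact: tconsK.
Qed.

HB.instance Definition _ := Measure_isSigmaFinite.Build _ _ _
  cons_measure cons_measure_sigma_finite.

End cons_measure.

(* The product of n copies of mu, by the identification T^n.+1 = T * T^n. *)
Fixpoint tuple_measure n : {sigma_finite_measure set (n.-tuple T) -> \bar R} :=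
  match n with
  | 0 => \d_([tuple] : 0.-tuple T)
  | n.+1 => cons_measure (tuple_measure n)
  end.

Lemma tuple_measure_box n (A : 'I_n -> set T) :
  (forall i, measurable (A i)) ->
  tuple_measure n [set x | forall i, A i (tnth x i)] = \prod_(i < n) mu (A i).
Proof.
elim: n A => [|n ih] A mA.
  by rewrite big_ord0 /= diracE mem_set//; case.
rewrite big_ord_recl -ih// -product_measure1E//; last first.
  rewrite (_ : [set x | _] = \bigcap_(i in [set: 'I_n])
      ((fun x : n.-tuple T => tnth x i) @^-1` A (lift ord0 i))); last first.
    by apply/seteqP; split=> [x /= h i _|x /= h i]; apply: h.
  apply: fin_bigcap_measurable => // i _.
  by rewrite -[X in measurable X]setTI; exact: measurable_tnth.
rewrite /= /cons_measure /pushforward; congr (_ _).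
apply/seteqP; split => -[a x] /=.
  move=> h; split; first exact: (h ord0).
  by move=> i; have := h (lift ord0 i); rewrite /tcons tnthS.
move=> [h0 h] i; case: (unliftP ord0 i) => [j|] ->; last exact: h0.
by rewrite /tcons tnthS; exact: h.
Qed.

End tuple_measure.

Definition lebesgue_Rn (R : realType) (n : nat) :
    {sigma_finite_measure set (Rn R n) -> \bar R} :=
  tuple_measure (@lebesgue_measure R) n.

Section matrices.
Variables (R : realType) (d : nat).
Implicit Types (A M : 'M[R[i]]_d) (e : 'cV[R[i]]_d).

Definition vnorm e : R := Num.sqrt (\sum_i (complex.Re (e i 0) ^+ 2 + complex.Im (e i 0) ^+ 2)).

Definition opnorm A : R := sup [set vnorm (A *m e) | e in [set e | vnorm e <= 1]].

Definition posdefmx A : Prop :=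
  A \is hermsymmx /\ forall e, e != 0 -> 0 < (e ^t* *m A *m e) 0 0.

(* A^s by functional calculus, i.e. P^-1 diag(l_i^s) P if A = P^-1 diag(l_i) P
   with P unitary; meaningful when A is positive definite. *)
Definition mxpowR A (s : R) : 'M[R[i]]_d :=
  invmx (spectralmx A) *m
  diag_mx (map_mx (fun l : R[i] => (complex.Re l `^ s)%:C) (spectral_diag A)) *m
  spectralmx A.

End matrices.

Section biparameter.
Variables (R : realType) (n m d : nat).
Local Notation T := (Rn R n * Rn R m)%type.
Local Notation mu := (@lebesgue_Rn R n \x @lebesgue_Rn R m)%E.
Implicit Types (E : set T) (p : R) (B U V W : T -> 'M[R[i]]_d) (M : 'M[R[i]]_d).

(* The library's measurability is with respect to the Borel sigma-algebra;
   Lebesgue measurable means a.e. equal to a Borel function. Integrals of such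
   nonnegative functions are the right ones, being suprema of integrals of
   Borel simple minorants. *)
Definition lebesgue_measurable (f : T -> R) : Prop :=
  exists2 g : T -> R, measurable_fun setT g & {ae mu, forall x, f x = g x}.

(* The identification of R^n x R^m with R^(n+m), used for compactness. *)
Definition to_row (x : T) : 'rV[R]_(n + m) :=
  row_mx (\row_i (tnth x.1 i : R)) (\row_j (tnth x.2 j : R)).

Definition mx_locally_integrable B : Prop :=
  (forall i j, lebesgue_measurable (fun x => complex.Re (B x i j)) /\
               lebesgue_measurable (fun x => complex.Im (B x i j))) /\
  (forall K : set T, compact (to_row @` K) ->
    (\int[mu]_(x in K) (opnorm (B x))%:E < +oo)%E).

Definition mean E (f : T -> \bar R) : \bar R :=
  ((fine (mu E))^-1%:E * \int[mu]_(x in E) f x)%E.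

Definition mx_mean E B : 'M[R[i]]_d :=
  \matrix_(i, j) (((fine (mu E))^-1 * \int[mu]_(x in E) complex.Re (B x i j)) +i*
                  ((fine (mu E))^-1 * \int[mu]_(x in E) complex.Im (B x i j))).

Definition cube k : set (set (Rn R k)) :=
  [set Q | exists (a : 'I_k -> R) (l : R), 0 < l /\
    Q = [set x | forall i, a i <= (tnth x i : R) <= a i + l]].

Definition rectangle : set (set T) :=
  [set E | exists Q1 Q2, [/\ cube Q1, cube Q2 & E = Q1 `*` Q2]].

Definition weight W : Prop :=
  mx_locally_integrable W /\ {ae mu, forall x, posdefmx (W x)}.

Definition conj_exp p : R := p / (p - 1).

Definition Ap_char p W : \bar R := ereal_sup
  [set mean E (fun x =>
     poweR (mean E (fun y =>
              (opnorm (mxpowR (W x) p^-1 *m mxpowR (W y) (- p^-1))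
                 `^ conj_exp p)%:E))
           (p / conj_exp p))
  | E in rectangle].

Definition Ap_weight p W : Prop := weight W /\ (Ap_char p W < +oo)%E.

Definition reducing_operator p W E M : Prop :=
  [/\ posdefmx M,
      (forall e : 'cV[R[i]]_d,
        let N := poweR (mean E (fun x =>
                          (vnorm (mxpowR (W x) p^-1 *m e) `^ p)%:E)) p^-1 in
        (N <= (vnorm (M *m e))%:E <= (Num.sqrt d%:R)%:E * N)%E)
    & (d = 1%N \/ p = 2) -> M = mxpowR (mx_mean E W) p^-1].

(* In the two norms below redU E and redV E are the reducing operators of U
   and V over E. *)
Definition bmo_norm p V (redU : set T -> 'M[R[i]]_d) B : \bar R := ereal_sup
  [set poweR (mean E (fun x =>
     (opnorm (mxpowR (V x) p^-1 *m (B x - mx_mean E B) *m invmx (redU E))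
        `^ p)%:E)) p^-1
  | E in rectangle].

Definition bmo_tilde_norm (redU redV : set T -> 'M[R[i]]_d) B : \bar R :=
  ereal_sup
  [set mean E (fun x =>
     (opnorm (redV E *m (B x - mx_mean E B) *m invmx (redU E)))%:E)
  | E in rectangle].

End biparameter.

(* Main.v *)
(**
Write |.| for the Frobenius norm, equivalent to the operator norm. The weights and
B may be replaced by Borel versions, since the integrals involved are unchanged.

For the bound of the tilde norm by the norm, Hoelder's inequality reduces to a bound
of the average over y in R of |V(y)^(-1/p) V_R e|^(p'). With f(y) = V(y)^(-1/p) V_R e,
test the reducing operator on phi = the average of |f|^(p'-2) V^(-1/p) f: then
<V_R phi, e> is that average N, and the A_p condition bounds the average of
|V(x)^(1/p) phi|^p by a constant times N, so N <= C N^(1/p).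

For the converse, let t exceed the tilde norm, and bisect the sides of R repeatedly
to get dyadic subrectangles J. Stop at the maximal J on which
|V_R (B - <B>_R) U_R^(-1)| has average > 2t. They cover at most half of R; outside
of them the integrand is at most 2t a.e., and on J one has
|V^(1/p)(B - <B>_R)e| <= C t |V^(1/p) V_R^(-1)| |U_R e| + |V^(1/p)(B - <B>_J)e|.
If the p-th power of the last term is bounded in average over every J by c times that
of w = |U^(1/p) e|^p, then summing over J, with w(union of the J) <= (1 - c0) w(R)
from the A_p condition of U and (a+b)^p <= K a^p + (1 + c0) b^p, improves c to
C K t^p + (1 - c0^2) c. Iterating gives c <= C' t^p, and e = U_R^(-1) e_j
yields the theorem.
*)
Require Import Defs.
From mathcomp Require Import all_boot all_order all_algebra.
From mathcomp Require Import all_classical all_reals all_analysis.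
From mathcomp Require Import complex measurable_realfun.
From mathcomp Require Import ring lra.

Set Implicit Arguments.
Unset Strict Implicit.
Unset Printing Implicit Defensive.

Import Order.TTheory GRing.Theory Num.Theory.
Import numFieldNormedType.Exports.
Import ComplexField.Normc.

Local Open Scope classical_set_scope.
Local Open Scope ring_scope.
Local Open Scope complex_scope.
Local Open Scope sesquilinear_scope.

(** * The Frobenius norm and its comparison with the operator norm *)

Section frobenius_norm.
Context {R : realType}.
Local Notation C := R[i].

(** All sides of a rectangle are halved at once, so its descendants are rectangles too and the
    stopping argument inside one rectangle is the one-parameter one; the A_p condition over all
    rectangles makes it uniform. Exchanging the reducing operators of R for those of a stopping
    rectangle J costs a factor each time, which no iteration survives. Hence the inductive bound is
    made for a fixed vector e and relative to w(J) instead of |J|: w is one scalar measure for all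
    rectangles, and the w(J) add up to w of the stopping set without loss. The only gain is that
    this is at most (1 - c0) w(R), with c0 possibly tiny. So the oscillation on J has to be carried
    over with a coefficient close to 1, and (a + b)^p is split with the coefficients K and 1 + c0
    rather than with 2^(p-1); then (1 + c0)(1 - c0) < 1. The A_p condition treats x and y
    differently. Both quantitative uses of it go through [Ap_mean_le], for functions of x that
    Hoelder's inequality in y has bounded by the inner integral. *)

Lemma sum_mul_le_sqrt (I : finType) (a b : I -> R) :
  \sum_i a i * b i <= Num.sqrt (\sum_i a i ^+ 2) * Num.sqrt (\sum_i b i ^+ 2).
Proof.
set A := \sum_i a i ^+ 2; set B := \sum_i b i ^+ 2.
have A0 : 0 <= A by apply: sumr_ge0 => i _; exact: sqr_ge0.
have B0 : 0 <= B by apply: sumr_ge0 => i _; exact: sqr_ge0.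
rewrite -sqrtrM//; set S := \sum_i _.
have [S0|S0] := leP S 0; first exact: (le_trans S0 (sqrtr_ge0 _)).
rewrite -(gtr0_norm S0) -sqrtr_sqr ler_sqrt ?mulr_ge0//.
(* Lagrange's identity: this sum of squares equals 2 (A B - S^2). *)
have : 0 <= \sum_i \sum_j (a i * b j - a j * b i) ^+ 2.
  by apply: sumr_ge0 => i _; apply: sumr_ge0 => j _; exact: sqr_ge0.
have -> : \sum_i \sum_j (a i * b j - a j * b i) ^+ 2 = (A * B - S ^+ 2) *+ 2.
  have -> : (A * B - S ^+ 2) *+ 2 = A * B + B * A - 2 * (S * S) by ring.
  rewrite /A /B /S !big_distrlr/= mulr_sumr -big_split/= -sumrB.
  apply: eq_bigr => i _; rewrite mulr_sumr -big_split/= -sumrB.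
  by apply: eq_bigr => j _; ring.
by rewrite pmulrn_lge0// subr_ge0.
Qed.

Lemma normc_ge0 (z : C) : 0 <= normc z.
Proof. by case: z => a b /=; exact: sqrtr_ge0. Qed.

Lemma normc_sqr (z : C) : normc z ^+ 2 = complex.Re z ^+ 2 + complex.Im z ^+ 2.
Proof. by case: z => a b /=; rewrite sqr_sqrtr// addr_ge0 ?sqr_ge0. Qed.

Lemma normc_conj (z : C) : normc (Num.conj z) = normc z.
Proof. by case: z => a b /=; rewrite sqrrN. Qed.

Lemma normc_real (a : R) : normc a%:C = `|a|.
Proof. by rewrite /= expr0n/= addr0 sqrtr_sqr. Qed.

Lemma Re_le_normc (z : C) : `|complex.Re z| <= normc z.
Proof.
case: z => a b /=; rewrite -sqrtr_sqr ler_sqrt ?addr_ge0 ?sqr_ge0//.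
by rewrite lerDl sqr_ge0.
Qed.

Lemma Im_le_normc (z : C) : `|complex.Im z| <= normc z.
Proof.
case: z => a b /=; rewrite -sqrtr_sqr ler_sqrt ?addr_ge0 ?sqr_ge0//.
by rewrite lerDr sqr_ge0.
Qed.

Lemma normc_sum (I : Type) (r : seq I) (P : pred I) (F : I -> C) :
  normc (\sum_(i <- r | P i) F i) <= \sum_(i <- r | P i) normc (F i).
Proof.
elim/big_ind2 : _ => //; first by rewrite normc0.
by move=> x1 x2 y1 y2 h1 h2; apply: (le_trans (le_normcD _ _)); exact: lerD.
Qed.

Definition fnorm (m n : nat) (A : 'M[C]_(m, n)) : R :=
  Num.sqrt (\sum_i \sum_j normc (A i j) ^+ 2).

Lemma fnorm_ge0 m n (A : 'M[C]_(m, n)) : 0 <= fnorm A.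
Proof. exact: sqrtr_ge0. Qed.
Local Hint Resolve fnorm_ge0 normc_ge0 : core.

Lemma fnorm_pair m n (A : 'M[C]_(m, n)) :
  fnorm A = Num.sqrt (\sum_(k : 'I_m * 'I_n) normc (A k.1 k.2) ^+ 2).
Proof. by rewrite /fnorm pair_bigA. Qed.

Lemma sqr_fnorm m n (A : 'M[C]_(m, n)) :
  fnorm A ^+ 2 = \sum_i \sum_j normc (A i j) ^+ 2.
Proof.
rewrite sqr_sqrtr//.
by apply: sumr_ge0 => i _; apply: sumr_ge0 => j _; exact: sqr_ge0.
Qed.

Lemma vnorm_fnorm d (e : 'cV[C]_d) : vnorm e = fnorm e.
Proof.
rewrite /vnorm /fnorm; congr Num.sqrt; apply: eq_bigr => i _.
by rewrite big_ord1 normc_sqr.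
Qed.

Lemma vnorm_ge0 d (e : 'cV[C]_d) : 0 <= vnorm e.
Proof. exact: sqrtr_ge0. Qed.

Lemma fnorm0 m n : fnorm (0 : 'M[C]_(m, n)) = 0.
Proof.
rewrite /fnorm big1 ?sqrtr0// => i _; rewrite big1// => j _.
by rewrite mxE normc0 expr0n.
Qed.

Lemma normc_le_fnorm m n (A : 'M[C]_(m, n)) i j : normc (A i j) <= fnorm A.
Proof.
rewrite -[leLHS]ger0_norm// -sqrtr_sqr ler_sqrt; last first.
  by apply: sumr_ge0 => k _; apply: sumr_ge0 => l _; exact: sqr_ge0.
rewrite (bigD1 i)//= (bigD1 j)//= -addrA lerDl addr_ge0//.
  by apply: sumr_ge0 => l _; exact: sqr_ge0.
by apply: sumr_ge0 => k _; apply: sumr_ge0 => l _; exact: sqr_ge0.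
Qed.

Lemma fnorm_eq0 m n (A : 'M[C]_(m, n)) : fnorm A = 0 -> A = 0.
Proof.
move=> A0; apply/matrixP => i j; rewrite mxE; apply: eq0_normc.
by apply/eqP; rewrite eq_le normc_ge0 andbT -A0 normc_le_fnorm.
Qed.

Lemma fnorm_gt0 m n (A : 'M[C]_(m, n)) : A != 0 -> 0 < fnorm A.
Proof. by rewrite lt0r fnorm_ge0 andbT; apply: contra => /eqP/fnorm_eq0->. Qed.

Lemma fnormD m n (A B : 'M[C]_(m, n)) : fnorm (A + B) <= fnorm A + fnorm B.
Proof.
rewrite -(@ler_pXn2r _ 2)// ?nnegrE ?addr_ge0//; rewrite [leRHS]sqrrD.
have := sum_mul_le_sqrt (fun k : 'I_m * 'I_n => normc (A k.1 k.2))
  (fun k : 'I_m * 'I_n => normc (B k.1 k.2)).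
rewrite -!fnorm_pair !sqr_fnorm !pair_bigA/= => AB.
apply: (@le_trans _ _ (\sum_(k : 'I_m * 'I_n)
  (normc (A k.1 k.2) + normc (B k.1 k.2)) ^+ 2)).
  apply: ler_sum => k _; rewrite mxE ler_pXn2r ?nnegrE ?addr_ge0//.
  exact: le_normcD.
rewrite (eq_bigr (fun k => normc (A k.1 k.2) ^+ 2
    + normc (A k.1 k.2) * normc (B k.1 k.2) *+ 2 + normc (B k.1 k.2) ^+ 2)).
  by rewrite !big_split/= lerD2r lerD2l mulr2n lerD.
by move=> k _; ring.
Qed.

Lemma fnormN m n (A : 'M[C]_(m, n)) : fnorm (- A) = fnorm A.
Proof.
rewrite /fnorm; congr Num.sqrt; apply: eq_bigr => i _; apply: eq_bigr => j _.
by rewrite mxE normcN.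
Qed.

Lemma fnormZ m n (a : C) (A : 'M[C]_(m, n)) :
  fnorm (a *: A) = normc a * fnorm A.
Proof.
rewrite -[normc a]ger0_norm// -sqrtr_sqr -sqrtrM ?sqr_ge0//; congr Num.sqrt.
rewrite mulr_sumr; apply: eq_bigr => i _; rewrite mulr_sumr.
by apply: eq_bigr => j _; rewrite mxE normcM exprMn.
Qed.

Lemma fnormC m n (A : 'M[C]_(m, n)) : fnorm (A ^t*) = fnorm A.
Proof.
rewrite /fnorm exchange_big/=; congr Num.sqrt.
by apply: eq_bigr => i _; apply: eq_bigr => j _; rewrite !mxE normc_conj.
Qed.

Lemma fnormM m n p (A : 'M[C]_(m, n)) (B : 'M[C]_(n, p)) :
  fnorm (A *m B) <= fnorm A * fnorm B.
Proof.
rewrite -(@ler_pXn2r _ 2) ?nnegrE ?mulr_ge0// exprMn.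
rewrite !sqr_fnorm [X in _ * X]exchange_big/= mulr_suml.
apply: ler_sum => i _; rewrite mulr_sumr; apply: ler_sum => j _.
have Ai : 0 <= \sum_k normc (A i k) ^+ 2 by apply: sumr_ge0 => k _; exact: sqr_ge0.
have Bj : 0 <= \sum_k normc (B k j) ^+ 2 by apply: sumr_ge0 => k _; exact: sqr_ge0.
rewrite -[leRHS]sqr_sqrtr ?mulr_ge0// sqrtrM//.
rewrite ler_pXn2r ?nnegrE ?mulr_ge0 ?sqrtr_ge0// mxE.
apply: le_trans (sum_mul_le_sqrt _ _).
apply: (le_trans (normc_sum _ _ _)).
by under eq_bigr do rewrite normcM.
Qed.

Lemma sqr_fnorm_col m n (A : 'M[C]_(m, n)) :
  fnorm A ^+ 2 = \sum_j fnorm (col j A) ^+ 2.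
Proof.
rewrite sqr_fnorm exchange_big/=; apply: eq_bigr => j _.
by rewrite sqr_fnorm; apply: eq_bigr => i _; rewrite big_ord1 mxE.
Qed.

(** The l^2 norm of the column norms is at most their l^1 norm. This reduces bounds for matrices to
    bounds for single vectors. *)
Lemma fnorm_le_sum_col m n (A : 'M[C]_(m, n)) :
  fnorm A <= \sum_j fnorm (col j A).
Proof.
have S0 : 0 <= \sum_j fnorm (col j A) by apply: sumr_ge0.
rewrite -(@ler_pXn2r _ 2) ?nnegrE// sqr_fnorm_col.
rewrite expr2 mulr_suml; apply: ler_sum => j _.
by rewrite expr2 ler_wpM2l// (bigD1 j)//= lerDl sumr_ge0.
Qed.

Definition cvec d (j : 'I_d) : 'cV[C]_d := delta_mx j 0.

Lemma colM d m n (A : 'M[C]_(m, n)) (B : 'M[C]_(n, d)) j :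
  col j (A *m B) = A *m (B *m cvec j).
Proof. by rewrite colE mulmxA. Qed.

Lemma fnorm_cvec d (j : 'I_d) : fnorm (cvec j) = 1.
Proof.
have n1 : normc (1 : C) = 1 by rewrite /= expr1n expr0n addr0 sqrtr1.
apply/eqP; rewrite -(@eqrXn2 _ 2)// sqr_fnorm expr1n (bigD1 j)//= big_ord1.
have -> : cvec j j 0 = 1 by rewrite mxE !eqxx.
rewrite n1 big1 ?addr0 ?expr1n//.
move=> i ij; rewrite big_ord1 (_ : cvec j i 0 = 0) ?normc0 ?expr0n//.
by rewrite mxE (negbTE ij).
Qed.

Section opnorm.
Variable d : nat.
Implicit Types (A B : 'M[C]_d) (e : 'cV[C]_d).

Let opset A := [set vnorm (A *m e) | e in [set e | vnorm e <= 1]].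

Let opset_ub A : ubound (opset A) (fnorm A).
Proof.
move=> _ [e /= e1 <-]; rewrite !vnorm_fnorm in e1 *.
by apply: (le_trans (fnormM _ _)); rewrite ler_piMr.
Qed.

Let opset0 A : opset A 0.
Proof.
exists 0; rewrite /= !vnorm_fnorm ?fnorm0//.
by rewrite mulmx0 fnorm0.
Qed.

Lemma opnorm_le_fnorm A : opnorm A <= fnorm A.
Proof. by apply: ge_sup; [exists 0; exact: opset0|exact: opset_ub]. Qed.

Lemma opnorm_ge0 A : 0 <= opnorm A.
Proof.
apply: sup_upper_bound (opset0 A); split; first by exists 0; exact: opset0.
by exists (fnorm A); exact: opset_ub.
Qed.

(** Each of the d columns is the image of a unit vector. The factor d is harmless, since all
    constants may depend on d. *)
Lemma fnorm_le_opnorm A : fnorm A <= d%:R * opnorm A.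
Proof.
apply: (le_trans (fnorm_le_sum_col _)).
rewrite (_ : d%:R * _ = \sum_(j < d) opnorm A); last first.
  by rewrite sumr_const card_ord mulr_natl.
apply: ler_sum => j _; rewrite -vnorm_fnorm colE; apply: sup_upper_bound.
  split; first by exists 0; exact: opset0.
  by exists (fnorm A); exact: opset_ub.
by exists (cvec j) => //=; rewrite vnorm_fnorm fnorm_cvec.
Qed.

End opnorm.

End frobenius_norm.
#[global] Hint Extern 0 (is_true (0 <= fnorm _)) => solve [apply: fnorm_ge0] : core.
#[global] Hint Extern 0 (is_true (0 <= vnorm _)) => solve [apply: vnorm_ge0] : core.
#[global] Hint Extern 0 (is_true (0 <= normc _)) => solve [apply: normc_ge0] : core.
#[global] Hint Extern 0 (is_true (0 <= opnorm _)) => solve [apply: opnorm_ge0] : core.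

(** * Functional calculus by unitary diagonalization *)

Lemma addmxE (V : nmodType) m n (A B : 'M[V]_(m, n)) i j :
  (A + B) i j = A i j + B i j.
Proof. by rewrite mxE. Qed.

Lemma conj_diagM (F : fieldType) n (P : 'M[F]_n) (u v : 'rV[F]_n) :
  P \in unitmx ->
  (invmx P *m diag_mx u *m P) *m (invmx P *m diag_mx v *m P) =
  invmx P *m diag_mx (\row_i (u 0 i * v 0 i)) *m P.
Proof.
move=> uP; rewrite -mulmx_diag -!mulmxA; congr (_ *m (_ *m _)).
by rewrite !mulmxA mulmxV// mul1mx.
Qed.

Lemma conj_diag_cst (F : fieldType) n (P : 'M[F]_n) (a : F) :
  P \in unitmx -> invmx P *m diag_mx (const_mx a) *m P = a%:M.
Proof.
by move=> uP; rewrite diag_const_mx mul_mx_scalar -scalemxAl mulVmx// scalemx1.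
Qed.

Section functional_calculus.
Context {R : realType} {d : nat}.
Local Notation C := R[i].
Implicit Types (A : 'M[C]_d) (f g : R -> R).

Definition frow f A : 'rV[C]_d :=
  map_mx (fun l : C => (f (complex.Re l))%:C) (spectral_diag A).

Definition fcalc_raw f A : 'M[C]_d :=
  invmx (spectralmx A) *m diag_mx (frow f A) *m spectralmx A.

(* Sealed, since failing conversion tests would unfold the matrix operations. *)
Fact fcalc_seal : {F : (R -> R) -> 'M[C]_d -> 'M[C]_d | F = fcalc_raw}.
Proof. by exists fcalc_raw. Qed.

Definition fcalc := sval fcalc_seal.

Lemma fcalc_unfold f A : fcalc f A =
  invmx (spectralmx A) *m diag_mx (frow f A) *m spectralmx A.
Proof. by rewrite /fcalc (svalP fcalc_seal); reflexivity. Qed.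

Definition eigen A (i : 'I_d) : R := complex.Re (spectral_diag A 0 i).

Lemma eq_fcalc f g A : (forall i, f (eigen A i) = g (eigen A i)) ->
  fcalc f A = fcalc g A.
Proof.
move=> fg; rewrite !fcalc_unfold; have E : frow f A = frow g A.
  by apply/rowP => i; rewrite !mxE; apply: (congr1 (real_complex R)); exact: fg.
by rewrite E; reflexivity.
Qed.

(** The entries are linear in the values of f at the eigenvalues, with coefficients that do not
    depend on f. This is what lets limits of f pass to [fcalc f A]. *)
Lemma fcalcE f A i j : fcalc f A i j =
  \sum_k (f (eigen A k))%:C * (invmx (spectralmx A) i k * spectralmx A k j).
Proof.
rewrite fcalc_unfold mxE; apply: eq_bigr => k _; rewrite mxE (bigD1 k)//= big1.
  by rewrite addr0 !mxE eqxx mulr1n mulrCA mulrA.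
by move=> l lk; rewrite !mxE (negbTE lk) mulr0n mulr0.
Qed.

Lemma fcalcM f g A : fcalc f A *m fcalc g A = fcalc (fun t => f t * g t) A.
Proof.
have E : \row_i (frow f A 0 i * frow g A 0 i) = frow (fun t => f t * g t) A.
  by apply/rowP => i; rewrite !mxE -rmorphM.
rewrite !fcalc_unfold.
by apply: (etrans (conj_diagM _ _ (spectral_unit A))); rewrite E; reflexivity.
Qed.

Lemma fcalc_cst a A : fcalc (fun=> a) A = a%:C%:M.
Proof.
have E : frow (fun=> a) A = const_mx a%:C by apply/rowP => i; rewrite !mxE.
by rewrite fcalc_unfold E; exact: (conj_diag_cst _ (spectral_unit A)).
Qed.

(** [spectralmx A] is unitary, and the diagonal matrix in the middle is real. *)
Lemma fcalc_herm f A : (fcalc f A) ^t* = fcalc f A.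
Proof.
rewrite fcalc_unfold (invmx_unitary (spectral_unitarymx A)).
have E : (diag_mx (frow f A))^t* = diag_mx (frow f A).
  rewrite tr_diag_mx map_diag_mx.
  have -> // : map_mx Num.conj (frow f A) = frow f A.
  by apply/rowP => i; rewrite !mxE; exact: conjc_real.
by rewrite !trmx_mul !map_mxM/= trmxCK E -mulmxA; reflexivity.
Qed.

Definition mpow A (s : R) := fcalc (fun t => t `^ s) A.

Lemma mxpowR_mpow A s : mxpowR A s = mpow A s.
Proof. by rewrite /mpow fcalc_unfold; reflexivity. Qed.

Lemma mpow_herm A s : (mpow A s)^t* = mpow A s.
Proof. exact: fcalc_herm. Qed.

Section posdef.
Variables (A : 'M[C]_d) (pA : posdefmx A).

Lemma posdef_spectral : A = invmx (spectralmx A) *m diag_mx (spectral_diag A) *m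
  spectralmx A.
Proof. exact/orthomx_spectralP/hermitian_normalmx/pA.1. Qed.

Lemma posdef_spectral_gt0 i : 0 < spectral_diag A 0 i.
Proof.
have P1 := unitarymxP (spectral_unitarymx A).
(* The i-th eigenvector, at which the quadratic form of A takes the i-th eigenvalue as its value. *)
pose e := (spectralmx A)^t* *m cvec i : 'cV[C]_d.
have Pe : spectralmx A *m e = cvec i by rewrite mulmxA P1 mul1mx.
have e0 : e != 0.
  apply/eqP => e0; have := @fnorm_cvec R d i; rewrite -Pe e0 mulmx0 fnorm0 => /eqP.
  by rewrite eq_sym oner_eq0.
have := pA.2 e e0.
rewrite {1}posdef_spectral (invmx_unitary (spectral_unitarymx A)).
rewrite -!mulmxA Pe [e ^t*](_ : _ = (cvec i)^t* *m spectralmx A); last first.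
  by rewrite /e trmx_mul map_mxM/= trmxCK.
rewrite -!mulmxA (mulmxA (spectralmx A)) P1 mul1mx mul_diag_mx.
rewrite mxE (bigD1 i)//= big1 ?addr0.
  by rewrite !mxE !eqxx mulr1 rmorph1 mul1r.
by move=> j ji; rewrite !mxE (negbTE ji) rmorph0 mul0r.
Qed.

Lemma eigen_gt0 i : 0 < eigen A i.
Proof. by have := posdef_spectral_gt0 i; rewrite ltcE => /andP[_]. Qed.

Lemma eigenE i : spectral_diag A 0 i = (eigen A i)%:C.
Proof.
have := posdef_spectral_gt0 i; rewrite ltcE => /andP[/eqP Im0 _].
by rewrite /eigen; case: (spectral_diag A 0 i) Im0 => a b /= ->.
Qed.

Lemma fcalc_id : fcalc (fun t => t) A = A.
Proof.
have E : frow (fun t => t) A = spectral_diag A.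
  by apply/rowP => i; rewrite mxE [RHS]eigenE.
apply: etrans (esym posdef_spectral); apply: (etrans (fcalc_unfold _ _)).
by rewrite E; reflexivity.
Qed.

(** The trace is invariant under conjugation. It serves as an upper bound of the eigenvalues that is
    visibly measurable in the matrix. *)
Lemma sum_eigen : \sum_i eigen A i = \sum_i complex.Re (A i i).
Proof.
have : \tr A = \sum_i (eigen A i)%:C.
  rewrite [in LHS]posdef_spectral mxtrace_mulC mulmxA mulmxV ?spectral_unit//.
  by rewrite mul1mx mxtrace_diag; apply: eq_bigr => i _; rewrite eigenE.
move=> /(congr1 (@complex.Re R)).
by rewrite /mxtrace -rmorph_sum/= => <-; rewrite (raddf_sum (@complex.Re R)).
Qed.

Lemma posdef_unit : A \in unitmx.
Proof.
have /mulmx1_unit[//] : A *m fcalc (fun t => t^-1) A = 1%:M.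
rewrite -[X in X *m _]fcalc_id fcalcM -[1%:M]/((1 : R)%:C%:M) -(fcalc_cst 1 A).
by apply: eq_fcalc => i; rewrite mulfV// gt_eqF ?eigen_gt0.
Qed.

Lemma mpowN s : mpow A s *m mpow A (- s) = 1%:M.
Proof.
rewrite /mpow fcalcM -[1%:M]/((1 : R)%:C%:M) -(fcalc_cst 1 A).
apply: eq_fcalc => i; rewrite -powRD ?subrr ?powRr0//.
by rewrite (gt_eqF (eigen_gt0 i)) implybT.
Qed.

End posdef.

Lemma fcalcD f g A : fcalc f A + fcalc g A = fcalc (fun t => f t + g t) A.
Proof.
apply/matrixP => i j.
transitivity (fcalc f A i j + fcalc g A i j); first exact: addmxE.
rewrite (fcalcE f A i j).
rewrite (fcalcE g A i j).
rewrite (fcalcE (fun t => f t + g t) A i j).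
rewrite -big_split. apply: eq_bigr => k _.
rewrite [LHS]/=.
rewrite -mulrDl.
rewrite -rmorphD. reflexivity.
Qed.


Lemma mpow_unit A s : posdefmx A -> mpow A s \in unitmx.
Proof. by move=> pA; have [h _] := mulmx1_unit (mpowN pA s); exact: h. Qed.

Lemma ctr_mul_self (e : 'cV[C]_d) : (e^t* *m e) 0 0 = (fnorm e ^+ 2)%:C.
Proof.
rewrite mxE sqr_fnorm rmorph_sum; apply: eq_bigr => i _; rewrite big_ord1 normc_sqr.
rewrite !mxE; case: (e i 0) => a b; simpc.
by rewrite mulrC [a * b]mulrC addrN -!expr2.
Qed.

Lemma posdef1 : posdefmx (1%:M : 'M[C]_d).
Proof.
split.
  by apply/is_hermitianmxP; rewrite expr0 scale1r trmx1 map_mx1.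
by move=> e e0; rewrite mulmx1 ctr_mul_self ltcR exprn_gt0// fnorm_gt0.
Qed.

Lemma posdef_herm A : posdefmx A -> A^t* = A.
Proof. by move=> [/is_hermitianmxP + _]; rewrite expr0 scale1r => <-. Qed.

End functional_calculus.

(** * Measurability of matrix valued functions *)

Section measurable_matrices.
Context d (T : measurableType d) (R : realType).
Local Notation C := R[i].

Definition mxmeas (m n : nat) (F : T -> 'M[C]_(m, n)) :=
  forall i j, measurable_fun setT (fun x => complex.Re (F x i j)) /\
              measurable_fun setT (fun x => complex.Im (F x i j)).

Lemma mxmeas_cst m n (A : 'M[C]_(m, n)) : mxmeas (fun=> A).
Proof. by move=> i j; split; exact: measurable_cst. Qed.

Lemma Re_sumc (I : Type) (r : seq I) (F : I -> C) :
  complex.Re (\sum_(i <- r) F i) = \sum_(i <- r) complex.Re (F i).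
Proof. exact: (raddf_sum (@complex.Re R)). Qed.

Lemma Im_sumc (I : Type) (r : seq I) (F : I -> C) :
  complex.Im (\sum_(i <- r) F i) = \sum_(i <- r) complex.Im (F i).
Proof. exact: (raddf_sum (@complex.Im R)). Qed.

Lemma Re_mulc (z w : C) : complex.Re (z * w) =
  complex.Re z * complex.Re w - complex.Im z * complex.Im w.
Proof. by case: z w => a b [c e]. Qed.

Lemma Im_mulc (z w : C) : complex.Im (z * w) =
  complex.Re z * complex.Im w + complex.Im z * complex.Re w.
Proof. by case: z w => a b [c e]. Qed.

Lemma mxmeasM m n p (F : T -> 'M[C]_(m, n)) (G : T -> 'M[C]_(n, p)) :
  mxmeas F -> mxmeas G -> mxmeas (fun x => F x *m G x).
Proof.
move=> mF mG i j; split.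
  under eq_fun do rewrite mxE Re_sumc.
  apply: measurable_sum => k; under eq_fun do rewrite Re_mulc.
  by apply: measurable_funB; apply: measurable_funM;
    [have [] := mF i k|have [] := mG k j|have [] := mF i k|have [] := mG k j].
under eq_fun do rewrite mxE Im_sumc.
apply: measurable_sum => k; under eq_fun do rewrite Im_mulc.
by apply: measurable_funD; apply: measurable_funM;
  [have [] := mF i k|have [] := mG k j|have [] := mF i k|have [] := mG k j].
Qed.

Lemma mxmeasD m n (F G : T -> 'M[C]_(m, n)) :
  mxmeas F -> mxmeas G -> mxmeas (fun x => F x + G x).
Proof.
move=> mF mG i j; have [? ?] := mF i j; have [? ?] := mG i j.
split; under eq_fun do rewrite mxE.
  rewrite (_ : (fun _ => _) = (fun x => complex.Re (F x i j) + complex.Re (G x i j))).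
    exact: measurable_funD.
  by apply/funext => x; rewrite raddfD.
rewrite (_ : (fun _ => _) = (fun x => complex.Im (F x i j) + complex.Im (G x i j))).
  exact: measurable_funD.
by apply/funext => x; rewrite raddfD.
Qed.

Lemma mxmeasZ m n (a : T -> R) (F : T -> 'M[C]_(m, n)) :
  measurable_fun setT a -> mxmeas F -> mxmeas (fun x => (a x)%:C *: F x).
Proof.
move=> ma mF i j; have [? ?] := mF i j.
split; under eq_fun do rewrite mxE.
  under eq_fun do rewrite Re_mulc /= mul0r subr0.
  exact: measurable_funM.
under eq_fun do rewrite Im_mulc /= mul0r addr0.
exact: measurable_funM.
Qed.

Lemma measurable_sqrt (f : T -> R) :
  measurable_fun setT f -> measurable_fun setT (fun x => Num.sqrt (f x)).
Proof.
move=> mf; apply: measurableT_comp => //.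
by apply: continuous_measurable_fun; exact: sqrt_continuous.
Qed.

Lemma measurable_fnorm m n (F : T -> 'M[C]_(m, n)) :
  mxmeas F -> measurable_fun setT (fun x => fnorm (F x)).
Proof.
move=> mF; apply: measurable_sqrt; apply: measurable_sum => i.
apply: measurable_sum => j; under eq_fun do rewrite normc_sqr.
by have [? ?] := mF i j; apply: measurable_funD; exact: measurable_funX.
Qed.

End measurable_matrices.

(** * Measurability of the powers of a measurable positive definite function *)

Section measurable_power.
Context dT (T : measurableType dT) (R : realType) (d : nat).
Local Notation C := R[i].
Variable W : T -> 'M[C]_d.
Hypotheses (mW : mxmeas W) (pW : forall x, posdefmx (W x)).

(** The diagonalization of W(x) is chosen for each x separately, with no control of its
    measurability. The functions f with a measurable functional calculus are therefore studied as a
    class, closed under algebraic operations and limits, that contains the identity. Letting f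
    depend on x allows a normalization by the trace of W(x). *)
Definition fcmeas (f : T -> R -> R) := mxmeas (fun x => fcalc (f x) (W x)).

Lemma eq_fcmeas (f g : T -> R -> R) :
  (forall x i, f x (eigen (W x) i) = g x (eigen (W x) i)) ->
  fcmeas f -> fcmeas g.
Proof.
move=> fg; rewrite /fcmeas.
rewrite [X in mxmeas X -> _](_ : _ = fun x => fcalc (g x) (W x))//.
by apply/funext => x; apply: eq_fcalc => i; exact: fg.
Qed.

Lemma fcmeas_cst (c : T -> R) : measurable_fun setT c ->
  fcmeas (fun x _ => c x).
Proof.
move=> mc; rewrite /fcmeas; under [X in mxmeas X]eq_fun do rewrite fcalc_cst -scalemx1.
exact/mxmeasZ/mxmeas_cst.
Qed.

Lemma fcmeas_id : fcmeas (fun _ t => t).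
Proof.
rewrite /fcmeas (_ : (fun _ => _) = W)//.
by apply/funext => x; exact: fcalc_id.
Qed.

Lemma fcmeasM f g : fcmeas f -> fcmeas g -> fcmeas (fun x t => f x t * g x t).
Proof.
by move=> mf mg; rewrite /fcmeas; under [X in mxmeas X]eq_fun do rewrite -fcalcM;
  exact: mxmeasM.
Qed.

Lemma fcmeasD f g : fcmeas f -> fcmeas g -> fcmeas (fun x t => f x t + g x t).
Proof.
by move=> mf mg; rewrite /fcmeas; under [X in mxmeas X]eq_fun do rewrite -fcalcD;
  exact: mxmeasD.
Qed.

Lemma fcmeasB f g : fcmeas f -> fcmeas g -> fcmeas (fun x t => f x t - g x t).
Proof.
move=> mf mg; apply: fcmeasD => //.
apply: (@eq_fcmeas (fun x t => (-1) * g x t)).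
  by move=> x i; rewrite mulN1r.
by apply: fcmeasM => //; exact: fcmeas_cst.
Qed.

Lemma fcmeasX f n : fcmeas f -> fcmeas (fun x t => f x t ^+ n).
Proof.
move=> mf; elim: n => [|n ih].
  by apply: (@eq_fcmeas (fun _ _ => 1)) => //; exact: fcmeas_cst.
apply: (@eq_fcmeas (fun x t => f x t * f x t ^+ n)).
  by move=> x i; rewrite exprS.
exact: fcmeasM.
Qed.

(** By [fcalcE] every entry is a finite sum of values of f at eigenvalues with fixed coefficients,
    so convergence at the eigenvalues is enough. *)
Lemma fcmeas_cvg (f_ : nat -> T -> R -> R) f :
  (forall k, fcmeas (f_ k)) ->
  (forall x i, f_ k x (eigen (W x) i) @[k --> \oo] --> f x (eigen (W x) i)) ->
  fcmeas f.
Proof.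
move=> mf_ f_f i j; split.
  apply: (measurable_fun_cvg (h := fun k x => complex.Re (fcalc (f_ k x) (W x) i j))).
    by move=> k; have [] := mf_ k i j.
  move=> x _.
  rewrite fcalcE Re_sumc.
  under eq_fun do rewrite fcalcE Re_sumc.
  apply: cvg_big => //; first exact: add_continuous.
  move=> k _; under eq_fun do rewrite Re_mulc /= mul0r subr0.
  by rewrite Re_mulc/= mul0r subr0; apply: cvgMl; exact: f_f.
apply: (measurable_fun_cvg (h := fun k x => complex.Im (fcalc (f_ k x) (W x) i j))).
  by move=> k; have [] := mf_ k i j.
move=> x _.
rewrite fcalcE Im_sumc.
under eq_fun do rewrite fcalcE Im_sumc.
apply: cvg_big => //; first exact: add_continuous.
move=> k _; under eq_fun do rewrite Im_mulc /= mul0r addr0.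
by rewrite Im_mulc/= mul0r addr0; apply: cvgMl; exact: f_f.
Qed.

(* The square root and the inverse are limits of the polynomial iterations
   [y <- y + (t - y^2) / 2] and [z <- z + (1 - t z)], for [t] in (0, 1]. *)
Lemma fcmeas_sqrt f : fcmeas f ->
  (forall x i, 0 < f x (eigen (W x) i) <= 1) ->
  fcmeas (fun x t => Num.sqrt (f x t)).
Proof.
move=> mf f01.
pose step t y : R := y + (t - y ^+ 2) / 2.
pose y_ k x t := iter k (step (f x t)) 0.
apply: (@fcmeas_cvg y_).
  elim=> [|k ih]; first exact: fcmeas_cst.
  rewrite /y_; apply: fcmeasD => //; apply: fcmeasM; last exact: fcmeas_cst.
  by apply: fcmeasB => //; exact: fcmeasX.
move=> x i; have /andP[] := f01 x i; rewrite /y_; move: (f x _) => t t0 t1.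
set s := Num.sqrt t.
have s0 : 0 < s by rewrite sqrtr_gt0.
have s1 : s <= 1 by rewrite -(@ler_pXn2r _ 2)// ?nnegrE ?(ltW s0)// expr1n sqr_sqrtr// ltW.
have ts : t = s ^+ 2 by rewrite sqr_sqrtr// ltW.
have yk k : 0 <= iter k (step t) 0 <= s /\ s - iter k (step t) 0 <= s * (1 - s / 2) ^+ k.
  elim: k => [|k [/andP[ih0 ihs] ih]].
    by rewrite /= lexx (ltW s0) subr0 expr0 mulr1.
  rewrite iterS; move: (iter k _ _) ih0 ihs ih => y y0 ys ih.
  (* One iteration multiplies the error s - y by 1 - (s + y) / 2, which lies between 0 and 1 - s /
     2. *)
  have E : s - step t y = (s - y) * (1 - (s + y) / 2).
    by rewrite /step ts; field.
  have sy : 0 <= s - y by rewrite subr_ge0.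
  have h1 : 0 <= 1 - (s + y) / 2 by lra.
  split; first (apply/andP; split).
  - by rewrite /step ts addr_ge0// divr_ge0// subr_ge0 ler_pXn2r ?nnegrE// ltW.
  - by rewrite -subr_ge0 E mulr_ge0.
  - rewrite E exprSr mulrA; apply: ler_pM => //; lra.
apply/cvgrPdist_le => e e0.
have q1 : `|1 - s / 2| < 1 by rewrite ger0_norm; lra.
have /cvgrPdist_le/(_ e e0) := cvg_geometric s q1.
apply: filterS => k; rewrite /geometric/= sub0r normrN.
have [/andP[_ ys] h] := yk k.
rewrite !ger0_norm ?subr_ge0//; first exact: le_trans.
by apply: mulr_ge0; [exact: ltW|apply: exprn_ge0; lra].
Qed.

Lemma fcmeas_inv f : fcmeas f ->
  (forall x i, 0 < f x (eigen (W x) i) <= 1) ->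
  fcmeas (fun x t => (f x t)^-1).
Proof.
move=> mf f01.
pose step t z : R := z + (1 - t * z).
pose z_ k x t := iter k (step (f x t)) 0.
apply: (@fcmeas_cvg z_).
  elim=> [|k ih]; first exact: fcmeas_cst.
  rewrite /z_; apply: fcmeasD => //; apply: fcmeasB; first exact: fcmeas_cst.
  exact: fcmeasM.
move=> x i; have /andP[] := f01 x i; rewrite /z_; move: (f x _) => t t0 t1.
have zk k : t^-1 - iter k (step t) 0 = t^-1 * (1 - t) ^+ k.
  elim: k => [|k ih]; first by rewrite /= subr0 expr0 mulr1.
  rewrite iterS exprSr mulrA -ih /step; field; exact: lt0r_neq0.
apply/cvgrPdist_le => e e0.
have q1 : `|1 - t| < 1 by rewrite ger0_norm; lra.
have /cvgrPdist_le/(_ e e0) := cvg_geometric t^-1 q1.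
by apply: filterS => k; rewrite /geometric/= sub0r normrN zk.
Qed.

(** t^s is the limit of integer powers of iterated square roots: the k-fold root t^(2^-k) is raised
    to the integer part of 2^k s, which changes the exponent s by at most 2^-k. *)
Lemma fcmeas_powR f s : fcmeas f -> 0 <= s ->
  (forall x i, 0 < f x (eigen (W x) i) <= 1) ->
  fcmeas (fun x t => f x t `^ s).
Proof.
move=> mf s0 f01.
have root k : fcmeas (fun x t => iter k Num.sqrt (f x t)) /\
    (forall x i, 0 < iter k Num.sqrt (f x (eigen (W x) i)) <= 1).
  elim: k => [//|k [ih1 ih2]]; split; first exact: fcmeas_sqrt.
  move=> x i; have /andP[h0 h1] := ih2 x i; rewrite iterS sqrtr_gt0 h0/=.
  by rewrite -sqrtr1 ler_sqrt.
apply: (@fcmeas_cvg (fun k x t =>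
    iter k Num.sqrt (f x t) ^+ Num.truncn (2 ^+ k * s))).
  by move=> k; apply: fcmeasX; exact: (root k).1.
move=> x i; have /andP[] := f01 x i; move: (f x _) => t t0 t1.
have iterE k : iter k Num.sqrt t = t `^ (2 ^- k).
  elim: k => [|k ih]; first by rewrite /= expr0 invr1 powRr1// ltW.
  by rewrite iterS ih -powR12_sqrt ?powR_ge0// -powRrM exprSr invfM.
under eq_fun do rewrite iterE -powR_mulrn ?powR_ge0// -powRrM.
under eq_fun do rewrite /powR gt_eqF//.
rewrite /powR gt_eqF//; apply: continuous_cvg; first exact: continuous_expR.
apply: cvgMl; apply/cvgrPdist_le => e e0.
have q1 : `|2^-1 : R| < 1 by rewrite ger0_norm; lra.
have /cvgrPdist_le/(_ e e0) := cvg_geometric 1 q1.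
apply: filterS => k; rewrite /geometric/= sub0r normrN mul1r exprVn.
have k0 : 0 < 2 ^+ k :> R by rewrite exprn_gt0.
rewrite (ger0_norm (_ : 0 <= _ ^-1)) ?invr_ge0 ?(ltW k0)//.
apply: le_trans.
have /andP[h1 h2] : (Num.truncn (2 ^+ k * s))%:R <= 2 ^+ k * s
    < (Num.truncn (2 ^+ k * s)).+1%:R.
  by apply: truncn_itv; rewrite mulr_ge0// ltW.
have -> : s - 2 ^- k * (Num.truncn (2 ^+ k * s))%:R =
  2 ^- k * (2 ^+ k * s - (Num.truncn (2 ^+ k * s))%:R).
  by rewrite mulrBr mulrA mulVf ?gt_eqF// mul1r.
rewrite ger0_norm; last by rewrite mulr_ge0 ?invr_ge0 ?(ltW k0)// subr_ge0.
rewrite ler_piMr ?invr_ge0 ?(ltW k0)//.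
by rewrite lerBlDl natr1 ltW.
Qed.

(** Dividing by the trace N puts the eigenvalues into (0, 1], where square roots and inverses have
    been treated; the factor N^s is scalar and measurable. Negative powers are inverses of positive
    ones. *)
Lemma mxmeas_mpow s : mxmeas (fun x => mpow (W x) s).
Proof.
pose N x := \sum_i complex.Re (W x i i).
have mN : measurable_fun setT N.
  by apply: measurable_sum => i; have [] := mW i i.
have eN x i : 0 < eigen (W x) i <= N x.
  rewrite eigen_gt0//= /N -sum_eigen// (bigD1 i)//= lerDl sumr_ge0// => j _.
  exact/ltW/eigen_gt0.
(* For d = 0 the trace is 0, so positivity is claimed only in the presence of an index. *)
have N0 x (i : 'I_d) : 0 < N x by have /andP[a b] := eN x i; exact: lt_le_trans a b.
have N_ge0 x : 0 <= N x.
  by rewrite /N -sum_eigen//; apply: sumr_ge0 => i _; exact/ltW/eigen_gt0.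
pose u x t := t * (N x)^-1.
have mu : fcmeas u.
  apply: fcmeasM; first exact: fcmeas_id.
  apply: fcmeas_cst; under eq_fun do rewrite -powR_inv1//.
  exact: measurableT_comp (measurable_powR _) mN.
have u01 x i : 0 < u x (eigen (W x) i) <= 1.
  have /andP[e0 e1] := eN x i; rewrite /u divr_gt0 ?(N0 x i)//=.
  by rewrite ler_pdivrMr ?(N0 x i)// mul1r.
have mNs r : measurable_fun setT (fun x => N x `^ r).
  exact: measurableT_comp (measurable_powR _) mN.
have uE x i r : eigen (W x) i `^ r = N x `^ r * u x (eigen (W x) i) `^ r.
  have /andP[u0 _] := u01 x i.
  rewrite -powRM ?N_ge0 ?(ltW u0)//.
  by rewrite /u mulrCA divff ?mulr1// gt_eqF// (N0 x i).
have [s0|s0] := leP 0 s.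
  apply: (@eq_fcmeas (fun x t => N x `^ s * u x t `^ s)).
    by move=> x i; rewrite -uE.
  by apply: fcmeasM; [exact: fcmeas_cst|exact: fcmeas_powR].
apply: (@eq_fcmeas (fun x t => N x `^ s * (u x t `^ (- s))^-1)).
  by move=> x i; rewrite -powRN opprK -uE.
apply: fcmeasM; first exact: fcmeas_cst.
apply: fcmeas_inv.
  by apply: fcmeas_powR => //; rewrite oppr_ge0 ltW.
move=> x i; have /andP[u0 u1] := u01 x i; rewrite powR_gt0//=.
have s0' : 0 <= - s by rewrite oppr_ge0 ltW.
have := @ge0_ler_powR R (- s) s0' (u x (eigen (W x) i)) 1.
by rewrite powR1 !nnegrE; apply => //; exact: ltW.
Qed.

End measurable_power.

(** * Integrals of nonnegative functions without measurability *)

Section lower_integral.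
Context d (T : measurableType d) (R : realType) (mu : {measure set T -> \bar R}).
Local Open Scope ereal_scope.
Import HBNNSimple.

(* The library's integral of a nonnegative function is the supremum of the
   integrals of its simple minorants: no measurability is needed here. *)
Lemma ae_le_integral_lower (f g : T -> \bar R) :
  (forall x, 0 <= f x) -> (forall x, 0 <= g x) ->
  {ae mu, forall x, f x <= g x} -> \int[mu]_x f x <= \int[mu]_x g x.
Proof.
move=> f0 g0 [N [mN N0 fgN]].
rewrite ge0_integralE// ge0_integralE//.
apply: ge_ereal_sup => _ [h /= hf <-].
have mNC : measurable (~` N) by exact: measurableC.
(* Cutting a simple minorant of f down to the complement of the null set keeps its integral and
   makes it a minorant of g. *)
pose h' := proj_nnsfun h mNC.
have hE x : h' x = (h x * \1_(~` N) x)%R by [].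
have -> : sintegral mu h = sintegral mu h'.
  rewrite -!integralT_nnsfun.
  apply: ae_eq_integral => //; try exact/measurable_EFinP.
  exists N; split => // x /= xh; apply: contrapT => xN; apply: xh => _.
  by apply: (congr1 EFin); rewrite [RHS]hE indicE mem_set// mulr1.
apply: ereal_sup_ubound; exists h' => //= x.
rewrite patchT ?inE// [X in X%:E]hE indicE.
have [xN|xN] := boolP (x \in ~` N); last by rewrite mulr0.
rewrite mulr1; apply: (le_trans (hf x)); rewrite patchT ?inE//.
by apply: contrapT => fg; move: xN; rewrite inE; apply; exact: fgN.
Qed.

Lemma ae_le_integral_lowerD (D D' : set T) (f g : T -> \bar R) :
  (forall x, 0 <= f x) -> (forall x, 0 <= g x) ->
  {ae mu, forall x, D x -> D' x /\ f x <= g x} ->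
  \int[mu]_(x in D) f x <= \int[mu]_(x in D') g x.
Proof.
move=> f0 g0 fg; rewrite integral_mkcond [leRHS]integral_mkcond.
apply: ae_le_integral_lower.
- by move=> x; exact: erestrict_ge0.
- by move=> x; exact: erestrict_ge0.
apply: filterS fg => x fg; rewrite /patch; case: ifPn => [|_].
  by rewrite inE => /fg[D'x fgx]; rewrite mem_set.
by case: ifPn.
Qed.

Lemma le_integral_lower (D : set T) (f g : T -> \bar R) :
  (forall x, 0 <= f x) -> (forall x, D x -> f x <= g x) ->
  \int[mu]_(x in D) f x <= \int[mu]_(x in D) g x.
Proof.
move=> f0 fg; rewrite integral_mkcond [leRHS]integral_mkcond.
have fg' x : (f \_ D) x <= (g \_ D) x.
  by rewrite /patch; case: ifPn => //; rewrite inE => /fg.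
apply: ae_le_integral_lower.
- by move=> x; exact: erestrict_ge0.
- by move=> x; apply: le_trans (fg' x); exact: erestrict_ge0.
- exact: aeW.
Qed.

(** Domain and integrand may both change on a null set. This covers the passage from closed to
    half-open rectangles together with that to Borel versions. *)
Lemma ae_eq_integral_lower (D D' : set T) (f g : T -> \bar R) :
  (forall x, 0 <= f x) -> (forall x, 0 <= g x) ->
  {ae mu, forall x, (D x <-> D' x) /\ f x = g x} ->
  \int[mu]_(x in D) f x = \int[mu]_(x in D') g x.
Proof.
move=> f0 g0 fg; apply/eqP; rewrite eq_le; apply/andP; split.
  by apply: ae_le_integral_lowerD => //; apply: filterS fg => x [DD ->] /DD.
by apply: ae_le_integral_lowerD => //; apply: filterS fg => x [DD ->] /DD.
Qed.

Lemma ae_eq_Rintegral_lower (D D' : set T) (f g : T -> R) :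
  {ae mu, forall x, (D x <-> D' x) /\ f x = g x} ->
  (\int[mu]_(x in D) f x = \int[mu]_(x in D') g x)%R.
Proof.
move=> fg; rewrite /Rintegral; congr fine.
rewrite integralE [RHS]integralE; congr (_ - _).
  by apply: ae_eq_integral_lower => //; apply: filterS fg => x [DD fgx];
    rewrite !funeposE /= fgx.
by apply: ae_eq_integral_lower => //; apply: filterS fg => x [DD fgx];
  rewrite !funenegE /= fgx.
Qed.

End lower_integral.

(** * Linearity of the integral and Hoelder's inequality for real functions *)

Section real_hoelder.
Context d (T : measurableType d) (R : realType) (mu : {measure set T -> \bar R}).

Lemma ge0_integralZ_EFin (D : set T) (f : T -> R) (k : R) :
  measurable D -> measurable_fun setT f -> (forall x, 0 <= f x) -> 0 <= k ->
  (\int[mu]_(x in D) (k * f x)%:E = k%:E * \int[mu]_(x in D) (f x)%:E)%E.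
Proof.
move=> mD mf f0 k0; under eq_integral do rewrite EFinM.
rewrite ge0_integralZl_EFin//.
- by move=> x _; rewrite lee_fin.
- by apply/measurable_EFinP; exact: measurable_funTS.
Qed.

Lemma ge0_integralD_EFin (D : set T) (f g : T -> R) :
  measurable D -> measurable_fun setT f -> measurable_fun setT g ->
  (forall x, 0 <= f x) -> (forall x, 0 <= g x) ->
  (\int[mu]_(x in D) (f x + g x)%:E =
   \int[mu]_(x in D) (f x)%:E + \int[mu]_(x in D) (g x)%:E)%E.
Proof.
move=> mD mf mg f0 g0; under eq_integral do rewrite EFinD.
rewrite ge0_integralD//.
- by move=> x _; rewrite lee_fin.
- by apply/measurable_EFinP; exact: measurable_funTS.
- by move=> x _; rewrite lee_fin.
- by apply/measurable_EFinP; exact: measurable_funTS.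
Qed.

(** The real bounds A and B stand for the two integrals, so that the result can be raised to powers
    as a real number. [Lnorm] integrates over the whole space, hence the indicators of D in the
    proof. *)
Lemma hoelder_le (D : set T) (f g : T -> R) (p q A B : R) :
  measurable D -> measurable_fun setT f -> measurable_fun setT g ->
  (forall x, 0 <= f x) -> (forall x, 0 <= g x) ->
  0 < p -> 0 < q -> p^-1 + q^-1 = 1 -> 0 <= A -> 0 <= B ->
  (\int[mu]_(x in D) (f x `^ p)%:E <= A%:E)%E ->
  (\int[mu]_(x in D) (g x `^ q)%:E <= B%:E)%E ->
  (\int[mu]_(x in D) (f x * g x)%:E <= (A `^ p^-1 * B `^ q^-1)%:E)%E.
Proof.
move=> mD mf mg f0 g0 p0 q0 pq A0 B0 fA gB.
have restr (h : T -> R) r : 0 < r -> (forall x, 0 <= h x) ->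
    (\int[mu]_(x in D) (h x `^ r)%:E =
     \int[mu]_x (`|(h x * \1_D x)%:E| `^ r))%E.
  move=> r0 h0; rewrite integral_mkcond; apply: eq_integral => x _.
  rewrite /patch indicE; case: ifPn => xD.
    by rewrite mulr1 abse_EFin ger0_norm// poweR_EFin.
  by rewrite mulr0 abse_EFin normr0 poweR_EFin powR0// gt_eqF.
have NE (h : T -> R) r A' : 0 < r -> (forall x, 0 <= h x) -> 0 <= A' ->
    (\int[mu]_(x in D) (h x `^ r)%:E <= A'%:E)%E ->
    ('N[mu]_r%:E[EFin \o (fun x => h x * \1_D x)%R] <= (A' `^ r^-1)%:E)%E.
  move=> r0 h0 A'0; rewrite restr// => hA.
  rewrite -[leLHS]poweRe1 ?Lnorm_ge0// -(mulfV (lt0r_neq0 r0)) poweRrM.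
  rewrite poweR_Lnorm ?gt_eqF// -poweR_EFin.
  apply: gt0_ler_poweR => //; rewrite ?invr_ge0 ?(ltW r0)//.
    rewrite in_itv/= leey andbT; apply: integral_ge0 => x _.
    by rewrite ?lee_fin ?poweR_ge0 ?powR_ge0.
  by rewrite in_itv/= leey andbT lee_fin.
have m1 : measurable_fun setT (\1_D : T -> R) by exact: measurable_indic.
have := @hoelder _ _ _ mu (fun x => f x * \1_D x) (fun x => g x * \1_D x) p q
  (measurable_funM mf m1) (measurable_funM mg m1) p0 q0 pq.
rewrite Lnorm1 [leLHS](_ : _ = \int[mu]_(x in D) (f x * g x)%:E)%E; last first.
  rewrite [RHS]integral_mkcond; apply: eq_integral => x _.
  rewrite /patch /= indicE; case: ifPn => xD.
    by rewrite !mulr1 ger0_norm// mulr_ge0.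
  by rewrite !mulr0 normr0.
move=> /le_trans; apply; rewrite EFinM.
by apply: lee_pmul; rewrite ?Lnorm_ge0//; exact: NE.
Qed.

End real_hoelder.

(** * Cubes and their halves *)

Section cubes.
Context {R : realType} {k : nat}.
Implicit Types (Q : ('I_k -> R) * R) (x : Rn R k).

(* Half-open, so that the 2^k halves of a cube partition it; the cubes of the
   theorem are closed and differ from these by null sets. *)
Definition hcube Q : set (Rn R k) :=
  [set x | forall i, Q.1 i <= (tnth x i : R) < Q.1 i + Q.2].

Definition ccube Q : set (Rn R k) :=
  [set x | forall i, Q.1 i <= (tnth x i : R) <= Q.1 i + Q.2].

Definition halfcube Q (b : {ffun 'I_k -> bool}) : ('I_k -> R) * R :=
  (fun i => Q.1 i + (b i)%:R * (Q.2 / 2), Q.2 / 2).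

Lemma hcube_ccube Q : hcube Q `<=` ccube Q.
Proof. by move=> x Qx i; have /andP[-> /ltW ->] := Qx i. Qed.

Lemma halfcube_sub Q b : 0 < Q.2 -> hcube (halfcube Q b) `<=` hcube Q.
Proof.
move=> Q0 x Qx i; have := Qx i; rewrite /halfcube /=.
by case: (b i) => /=; lra.
Qed.

Lemma halfcube_ex Q x : hcube Q x -> exists b, hcube (halfcube Q b) x.
Proof.
move=> Qx; exists [ffun i => Q.1 i + Q.2 / 2 <= (tnth x i : R)] => i.
rewrite /halfcube /= ffunE; have /andP[? ?] := Qx i.
by case: (leP (Q.1 i + Q.2 / 2) (tnth x i : R)) => ? /=; lra.
Qed.

Lemma halfcube_uniq Q b b' x :
  hcube (halfcube Q b) x -> hcube (halfcube Q b') x -> b = b'.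
Proof.
move=> bx b'x; apply/ffunP => i; have := bx i; have := b'x i.
by rewrite /halfcube /=; case: (b i); case: (b' i) => //= /andP[? ?] /andP[? ?];
  exfalso; lra.
Qed.

Lemma measurable_box (A : 'I_k -> set (measurableTypeR R)) :
  (forall i, measurable (A i)) ->
  measurable [set x : Rn R k | forall i, A i (tnth x i)].
Proof.
move=> mA; rewrite (_ : [set x | _] = \bigcap_(i in [set: 'I_k])
    ((fun x : Rn R k => tnth x i) @^-1` A i)); last first.
  by apply/seteqP; split=> [x /= h i _|x /= h i]; apply: h.
apply: fin_bigcap_measurable => // i _.
by rewrite -[X in measurable X]setTI; exact: measurable_tnth.
Qed.

Lemma hcubeE Q : hcube Q =
  [set x | forall i, [set` `[Q.1 i, Q.1 i + Q.2[] (tnth x i : R)].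
Proof. by apply/seteqP; split => x h i; have := h i; rewrite /= in_itv. Qed.

Lemma ccubeE Q : ccube Q =
  [set x | forall i, [set` `[Q.1 i, Q.1 i + Q.2]] (tnth x i : R)].
Proof. by apply/seteqP; split => x h i; have := h i; rewrite /= in_itv. Qed.

Lemma measurable_hcube Q : measurable (hcube Q).
Proof.
rewrite hcubeE; apply: (@measurable_box (fun i => [set` `[Q.1 i, Q.1 i + Q.2[])).
by move=> i; exact: measurable_itv.
Qed.

Lemma measurable_ccube Q : measurable (ccube Q).
Proof.
rewrite ccubeE; apply: (@measurable_box (fun i => [set` `[Q.1 i, Q.1 i + Q.2]])).
by move=> i; exact: measurable_itv.
Qed.

Lemma lebesgue_hcube Q : 0 < Q.2 -> lebesgue_Rn R k (hcube Q) = (Q.2 ^+ k)%:E.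
Proof.
move=> Q0; rewrite hcubeE (@tuple_measure_box _ _ _ lebesgue_measure _
  (fun i => [set` `[Q.1 i, Q.1 i + Q.2[])); last first.
  by move=> i; exact: measurable_itv.
rewrite (eq_bigr (fun=> Q.2%:E)).
  by rewrite prodEFin prodr_const card_ord.
move=> i _; apply: etrans (lebesgue_measure_itv _) _.
by rewrite /= lte_fin ltrDl Q0 -EFinD addrAC subrr add0r.
Qed.

Lemma lebesgue_ccube Q : 0 < Q.2 -> lebesgue_Rn R k (ccube Q) = (Q.2 ^+ k)%:E.
Proof.
move=> Q0; rewrite ccubeE (@tuple_measure_box _ _ _ lebesgue_measure _
  (fun i => [set` `[Q.1 i, Q.1 i + Q.2]])); last first.
  by move=> i; exact: measurable_itv.
rewrite (eq_bigr (fun=> Q.2%:E)).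
  by rewrite prodEFin prodr_const card_ord.
move=> i _; apply: etrans (lebesgue_measure_itv _) _.
by rewrite /= lte_fin ltrDl Q0 -EFinD addrAC subrr add0r.
Qed.

End cubes.

(* A named measure, so that its structure is not inferred anew each time. *)
Definition leb2 (R : realType) (n m : nat) :
    {measure set (Rn R n * Rn R m) -> \bar R} :=
  [the {measure set (Rn R n * Rn R m) -> \bar R} of
    (@lebesgue_Rn R n \x @lebesgue_Rn R m)%E].

(** * Dyadic rectangles and stopping sets *)

Section boxes.
Context {R : realType} {n m : nat}.
Local Notation T := (Rn R n * Rn R m)%type.
Local Notation mu := (@leb2 R n m).
Local Notation bits := ({ffun 'I_n -> bool} * {ffun 'I_m -> bool})%type.

(** Corner and side length of the two cubes. Coding rectangles by data instead of sets makes
    bisection a function and allows recursion on generations. *)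
Definition cell : Type := (('I_n -> R) * R) * (('I_m -> R) * R).
Implicit Types (Q : cell) (b : bits) (x : T) (A O : set T).

Definition hbox Q : set T := hcube Q.1 `*` hcube Q.2.
Definition cbox Q : set T := ccube Q.1 `*` ccube Q.2.
Definition child Q b : cell := (halfcube Q.1 b.1, halfcube Q.2 b.2).
Definition good Q : Prop := 0 < Q.1.2 /\ 0 < Q.2.2.
Definition vol Q : R := Q.1.2 ^+ n * Q.2.2 ^+ m.

Lemma good_child Q b : good Q -> good (child Q b).
Proof. by move=> [h1 h2]; split; rewrite divr_gt0. Qed.

Lemma vol_gt0 Q : good Q -> 0 < vol Q.
Proof. by move=> [h1 h2]; rewrite mulr_gt0// exprn_gt0. Qed.

Lemma vol_child Q b : vol Q = 2 ^+ (n + m) * vol (child Q b).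
Proof.
rewrite /vol /child/= !expr_div_n exprD mulrACA.
by congr (_ * _); rewrite mulrCA divff ?mulr1// expf_neq0.
Qed.

Lemma hbox_child_sub Q b : good Q -> hbox (child Q b) `<=` hbox Q.
Proof.
move=> [g1 g2] x [h1 h2].
by split; [exact: halfcube_sub g1 _ h1|exact: halfcube_sub g2 _ h2].
Qed.

Lemma hbox_child_ex Q x : hbox Q x -> exists b, hbox (child Q b) x.
Proof.
move=> [/halfcube_ex[b1 h1] /halfcube_ex[b2 h2]].
by exists (b1, b2).
Qed.

Lemma hbox_child_uniq Q b b' x :
  hbox (child Q b) x -> hbox (child Q b') x -> b = b'.
Proof.
by case: b b' => [b1 b2] [b1' b2'] [h1 h2] [h1' h2'];
  congr pair; [exact: halfcube_uniq h1 h1'|exact: halfcube_uniq h2 h2'].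
Qed.

Lemma measurable_hbox Q : measurable (hbox Q).
Proof. by apply: measurableX; [exact: measurable_hcube|exact: measurable_hcube]. Qed.

Lemma measurable_cbox Q : measurable (cbox Q).
Proof. by apply: measurableX; exact: measurable_ccube. Qed.

Lemma mu_hbox Q : good Q -> mu (hbox Q) = (vol Q)%:E.
Proof.
move=> [g1 g2].
have e1 := lebesgue_hcube g1; have e2 := lebesgue_hcube g2.
transitivity ((Q.1.2 ^+ n)%:E * (Q.2.2 ^+ m)%:E)%E => //; rewrite -e1 -e2.
by apply: product_measure1E; [exact: measurable_hcube|exact: measurable_hcube].
Qed.

Lemma mu_cbox Q : good Q -> mu (cbox Q) = (vol Q)%:E.
Proof.
move=> [g1 g2].
have e1 := lebesgue_ccube g1; have e2 := lebesgue_ccube g2.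
transitivity ((Q.1.2 ^+ n)%:E * (Q.2.2 ^+ m)%:E)%E => //; rewrite -e1 -e2.
by apply: product_measure1E; [exact: measurable_ccube|exact: measurable_ccube].
Qed.

Lemma hbox_cbox Q : hbox Q `<=` cbox Q.
Proof. by move=> x [h1 h2]; split; exact: hcube_ccube. Qed.

(** One set contains the other and both have the same finite measure. *)
Lemma ae_cbox_hbox Q : good Q -> {ae mu, forall x, cbox Q x <-> hbox Q x}.
Proof.
move=> gQ; have ec := mu_cbox gQ; have eh := mu_hbox gQ.
have mc := measurable_cbox Q; have mh := measurable_hbox Q.
exists (cbox Q `\` hbox Q); split; first exact: measurableD.
- apply: etrans (measureD mc mh _) _; first by change (mu (cbox Q) < +oo)%E; rewrite ec ltry.
  change (mu (cbox Q) - mu (cbox Q `&` hbox Q) = 0)%E.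
  rewrite setIidr; last exact: hbox_cbox.
  by rewrite ec eh -EFinB subrr.
- move=> x /= xh; split.
    by apply: contrapT => ncx; apply: xh; split => [//|/hbox_cbox].
  by move=> hx; apply: xh; split => // _; exact: hbox_cbox.
Qed.

Lemma rectangleP E : rectangle E <-> exists2 Q, good Q & E = cbox Q.
Proof.
split=> [[Q1 [Q2 [[a1 [l1 [l10 ->]]] [a2 [l2 [l20 ->]]] ->]]]|[[[a1 l1] [a2 l2]] [g1 g2] ->]].
  by exists ((a1, l1), (a2, l2)).
by exists (ccube (a1, l1)), (ccube (a2, l2)); split => //; [exists a1, l1|exists a2, l2].
Qed.

(** The only property of a measure that inductions along bisections use. It is restricted to a set
    A, so that it can be applied to stopping sets and their complements. *)
Definition child_additive (nu : set T -> \bar R) :=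
  forall Q A, good Q -> measurable A ->
    nu (A `&` hbox Q) = (\sum_b nu (A `&` hbox (child Q b)))%E.

Lemma hbox_split Q A : good Q ->
  A `&` hbox Q = \big[setU/set0]_(b <- index_enum bits) (A `&` hbox (child Q b)).
Proof.
move=> gQ; rewrite -bigcup_seq; apply/seteqP; split => [x [Ax /hbox_child_ex[b xb]]|x].
  by exists b => //=; rewrite mem_index_enum.
by move=> [b _ [Ax xb]]; split => //; exact: hbox_child_sub xb.
Qed.

Lemma trivIset_child Q A (s : set bits) :
  trivIset s (fun b => A `&` hbox (child Q b)).
Proof.
by move=> b b' _ _ [x [[_ xb] [_ xb']]]; exact: hbox_child_uniq xb xb'.
Qed.

Lemma child_additive_integral (f : T -> \bar R) :
  measurable_fun setT f -> (forall x, 0 <= f x)%E ->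
  child_additive (fun A => \int[mu]_(x in A) f x)%E.
Proof.
move=> mf f0 Q A gQ mA; rewrite hbox_split// ge0_integral_bigsetU//.
- by move=> b; apply: measurableI => //; exact: measurable_hbox.
- exact: index_enum_uniq.
- exact: trivIset_child.
- by apply: measurable_funS mf.
Qed.

(* The union of the maximal proper dyadic descendants of Q of generation at most
   k that satisfy P. *)
Fixpoint stop (P : cell -> Prop) (k : nat) Q : set T :=
  if k is k'.+1 then [set x | exists b, hbox (child Q b) x /\
    (P (child Q b) \/ stop P k' (child Q b) x)] else set0.

Lemma stop_sub P k Q : good Q -> stop P k Q `<=` hbox Q.
Proof.
by case: k => [|k] gQ x //= [b [xb _]]; exact: hbox_child_sub xb.
Qed.

Lemma stopS P k Q b : good Q -> stop P k.+1 Q `&` hbox (child Q b) =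
  if `[< P (child Q b) >] then hbox (child Q b) else stop P k (child Q b).
Proof.
move=> gQ; case: asboolP => Pb; apply/seteqP; split => x.
- by move=> [].
- by move=> xb; split => //; exists b; split => //; left.
- move=> [[b' [xb' h]] xb]; have bb' := hbox_child_uniq xb xb'; subst b'.
  by case: h.
- move=> sx; have xb := stop_sub (good_child b gQ) sx.
  by split => //; exists b; split => //; right.
Qed.

Lemma nonstopS P k Q b : good Q ->
  (hbox Q `\` stop P k.+1 Q) `&` hbox (child Q b) =
  if `[< P (child Q b) >] then set0
  else hbox (child Q b) `\` stop P k (child Q b).
Proof.
move=> gQ; have := stopS P k b gQ; case: ifPn => _ h; apply/seteqP; split => x //.
- move=> [[xQ xs] xb]; apply: xs.
  by have [] : (stop P k.+1 Q `&` hbox (child Q b)) x by rewrite h.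
- move=> [[xQ xs] xb]; split => // sx; apply: xs.
  by have [] : (stop P k.+1 Q `&` hbox (child Q b)) x by rewrite h.
- move=> [xb xs]; split => //; split; first exact: hbox_child_sub xb.
  by move=> sx; apply: xs; rewrite -h.
Qed.

Lemma stop_nondecr P k Q : stop P k Q `<=` stop P k.+1 Q.
Proof.
elim: k Q => [|k ih] Q x; first by case.
case=> b [xb [Pb|sb]]; exists b; split => //.
  by left.
by right; exact: ih.
Qed.

Lemma measurable_stop P k Q : good Q -> measurable (stop P k Q).
Proof.
elim: k Q => [|k ih] Q gQ; first exact: measurable0.
rewrite -(setIidl (stop_sub (P := P) (k := k.+1) gQ)) hbox_split//.
apply: bigsetU_measurable => b _; rewrite stopS//; case: ifPn => _.
  exact: measurable_hbox.
by apply: ih; exact: good_child.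
Qed.

Section stop_comparison.
Variables (nu kappa : set T -> \bar R) (P : cell -> Prop).
Hypotheses (nuA : child_additive nu) (kA : child_additive kappa).
Hypothesis nuk0 : (nu set0 <= kappa set0)%E.

(** Both sides split over the children of Q: a child satisfying P belongs entirely to the stopping
    set, and on the others the induction hypothesis applies. The comparison is required only for
    children with P whose parent fails P, since the failure at the parent is what bounds averages on
    the child. *)
Lemma stop_le k Q : good Q -> ~ P Q ->
  (forall Q' b, good Q' -> ~ P Q' -> P (child Q' b) ->
     (nu (hbox (child Q' b)) <= kappa (hbox (child Q' b)))%E) ->
  (nu (stop P k Q) <= kappa (stop P k Q))%E.
Proof.
move=> gQ PQ H; elim: k Q gQ PQ => [//|k ih] Q gQ PQ.
rewrite -(setIidl (stop_sub (P := P) (k := k.+1) gQ)).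
have ms := @measurable_stop P k.+1 Q gQ.
rewrite nuA// kA//; apply: lee_sum => b _; rewrite stopS//; case: asboolP => Pb.
  exact: H.
by apply: ih => //; exact: good_child.
Qed.

End stop_comparison.

(* On Q, the set O is a union of dyadic descendants of generation k. *)
Fixpoint isgen (k : nat) Q O : Prop :=
  if k is k'.+1 then forall b, isgen k' (child Q b) O
  else hbox Q `<=` O \/ O `&` hbox Q = set0.

Lemma isgenS k Q O : good Q -> isgen k Q O -> isgen k.+1 Q O.
Proof.
elim: k Q => [|k ih] Q gQ.
  move=> [QO|QO] b; [left|right].
    by apply: subset_trans QO; exact: hbox_child_sub.
  rewrite -subset0 -QO => x [Ox xb]; split => //; exact: hbox_child_sub xb.
by move=> h b; apply: ih; [exact: good_child|exact: h].
Qed.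

Lemma isgen_le k k' Q O : good Q -> (k <= k')%N -> isgen k Q O -> isgen k' Q O.
Proof.
move=> gQ /subnK <-; elim: (k' - k)%N => [//|i ih] h.
by apply: isgenS => //; exact: ih.
Qed.

Lemma isgenC k Q O : isgen k Q O -> isgen k Q (~` O).
Proof.
elim: k Q => [|k ih] Q /=; last by move=> h b; exact: ih.
move=> [QO|QO]; [right|left].
  by rewrite -subset0 => x [nO Qx]; apply: nO; exact: QO.
by move=> x Qx Ox; have : (O `&` hbox Q) x by []; rewrite QO.
Qed.

Lemma isgenU k Q O O' : isgen k Q O -> isgen k Q O' -> isgen k Q (O `|` O').
Proof.
elim: k Q => [|k ih] Q /=; last by move=> h h' b; exact: ih.
move=> [QO|QO] [QO'|QO']; [left|left|left|right].
- by move=> x /QO; left.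
- by move=> x /QO; left.
- by move=> x /QO'; right.
- by rewrite setIUl QO QO' setU0.
Qed.

(** Off the stopping set, O consists of whole descendants of generation k that fail P, and on these
    the comparison is assumed. *)
Lemma nonstop_le (nu kappa : set T -> \bar R) (P : cell -> Prop) k Q O :
  child_additive nu -> child_additive kappa -> (nu set0 <= kappa set0)%E ->
  good Q -> ~ P Q -> measurable O -> isgen k Q O ->
  (forall Q', good Q' -> ~ P Q' -> (nu (hbox Q') <= kappa (hbox Q'))%E) ->
  (nu (O `&` (hbox Q `\` stop P k Q)) <= kappa (O `&` (hbox Q `\` stop P k Q)))%E.
Proof.
move=> nuA kA nuk0 gQ PQ mO + H; elim: k Q gQ PQ => [|k ih] Q gQ PQ.
  rewrite /= setD0 => -[QO|->//].
  by rewrite setIidr//; exact: H.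
move=> gO; set G := _ `\` _.
have GE : O `&` G = (O `&` G) `&` hbox Q.
  by rewrite -setIA; congr (_ `&` _); rewrite /G; apply/seteqP; split => x [[]].
have mG : measurable (O `&` G).
  apply: measurableI => //; apply: measurableD; first exact: measurable_hbox.
  exact: measurable_stop.
rewrite GE nuA// kA//; apply: lee_sum => b _.
rewrite -setIA /G nonstopS//; case: asboolP => Pb; first by rewrite setI0.
by apply: ih => //; exact: good_child.
Qed.

End boxes.

(** * Approximation of Borel sets by unions of dyadic rectangles *)

Lemma lebesgue_hrect (R : realType) (k : nat) (a l : 'I_k -> R) :
  (forall i, 0 < l i) ->
  lebesgue_Rn R k [set x | forall i, a i <= (tnth x i : R) < a i + l i] =
  (\prod_i l i)%:E.
Proof.
move=> l0; rewrite (_ : [set x | _] =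
    [set x | forall i, [set` `[a i, a i + l i[] (tnth x i : R)]); last first.
  by apply/seteqP; split => x h i; have := h i; rewrite /= in_itv.
rewrite (@tuple_measure_box _ _ _ lebesgue_measure _
  (fun i => [set` `[a i, a i + l i[])); last first.
  by move=> i; exact: measurable_itv.
rewrite -prodEFin; apply: eq_bigr => i _; apply: etrans (lebesgue_measure_itv _) _.
by rewrite /= lte_fin ltrDl l0 -EFinD addrAC subrr add0r.
Qed.

Lemma measurable_hrect (R : realType) (k : nat) (a l : 'I_k -> R) :
  measurable [set x : Rn R k | forall i, a i <= (tnth x i : R) < a i + l i].
Proof.
rewrite (_ : [set x | _] =
    [set x | forall i, [set` `[a i, a i + l i[] (tnth x i : R)]); last first.
  by apply/seteqP; split => x h i; have := h i; rewrite /= in_itv.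
apply: (@measurable_box _ _ (fun i => [set` `[a i, a i + l i[])).
by move=> i; exact: measurable_itv.
Qed.

Lemma prod_shrink (R : realType) (k : nat) (i : 'I_k) (l r : R) :
  \prod_(j < k) (if j == i then l * r else l) = l ^+ k * r.
Proof.
rewrite (bigD1 i)//= eqxx.
rewrite (eq_bigr (fun=> l)); last by move=> j /negbTE ->.
rewrite prodr_const cardC1 card_ord mulrAC -exprS.
by rewrite prednK// (leq_ltn_trans _ (ltn_ord i)).
Qed.

Section approximation.
Context {R : realType} {n m : nat}.
Local Notation T := (Rn R n * Rn R m)%type.
Local Notation mu := (@leb2 R n m).
Local Notation bits := ({ffun 'I_n -> bool} * {ffun 'I_m -> bool})%type.
Local Notation cell := (@cell R n m).
Implicit Types (Q : cell) (b : bits) (x : T) (A O : set T) (s : 'I_n + 'I_m).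

Definition coord s x : R :=
  match s with inl i => tnth x.1 i | inr j => tnth x.2 j end.
Definition low Q s : R := match s with inl i => Q.1.1 i | inr j => Q.2.1 j end.
Definition side Q s : R := match s with inl _ => Q.1.2 | inr _ => Q.2.2 end.
Definition cbit b s : bool := match s with inl i => b.1 i | inr j => b.2 j end.

Lemma side_gt0 Q s : good Q -> 0 < side Q s.
Proof. by case: s => i [g1 g2]. Qed.

Lemma low_child Q b s :
  low (child Q b) s = low Q s + (cbit b s)%:R * (side Q s / 2).
Proof. by case: s. Qed.

Lemma side_child Q b s : side (child Q b) s = side Q s / 2.
Proof. by case: s. Qed.

Lemma hbox_coord Q x s :
  hbox Q x -> low Q s <= coord s x < low Q s + side Q s.
Proof. by case: s => i [h1 h2]; [exact: h1|exact: h2]. Qed.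

Lemma isgen_ray k Q s (j : int) : good Q ->
  isgen k Q [set x | coord s x < low Q s + side Q s * (j%:~R / 2 ^+ k)].
Proof.
elim: k Q j => [|k ih] Q j gQ.
  rewrite /= expr0 divr1; have s0 := side_gt0 s gQ.
  have [j0|j0] := leP j 0; [right|left].
    rewrite -subset0 => x [/= xc /hbox_coord-/(_ s)/andP[xl _]].
    have : side Q s * j%:~R <= 0 by rewrite pmulr_rle0// lerz0.
    lra.
  move=> x /hbox_coord-/(_ s)/andP[_ xl] /=; apply: (lt_le_trans xl).
  by rewrite lerD2l ler_peMr ?(ltW s0)// ler1z.
(* The grid of generation k + 1 in Q is that of generation k in the child. The corner of an upper
   half is 2^k grid steps further along s, so the index drops by 2^k. *)
move=> b; have := ih (child Q b) (j - (cbit b s)%:Z * 2 ^+ k) (good_child b gQ).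
rewrite low_child side_child rmorphB/= rmorphM/= rmorphXn/=.
have e0 : 2 ^+ k != 0 :> R by rewrite expf_neq0.
rewrite (_ : low Q s + _ + _ = low Q s + side Q s * (j%:~R / 2 ^+ k.+1))//.
by rewrite exprS; case: (cbit b s) => /=; field.
Qed.

Lemma mu_slab Q s (c r : R) : good Q -> 0 < r ->
  (mu ([set x | (c <= coord s x < c + side Q s * r)%R] `&` hbox Q) <= (vol Q * r)%:E)%E.
Proof.
move=> gQ r0; have [g1 g2] := gQ.
case: s => i.
  (* The slab lies in a box that differs from the cube in the i-th side only, whose length is
     multiplied by r. *)
  pose a j := if j == i then c else Q.1.1 j.
  pose l j := if j == i then Q.1.2 * r else Q.1.2.
  pose S := [set x : Rn R n | forall j, a j <= (tnth x j : R) < a j + l j].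
  have mS : measurable S by exact: measurable_hrect.
  have mh := measurable_hcube Q.2.
  apply: (@le_trans _ _ (mu (S `*` hcube Q.2))).
    apply: le_measure.
    - rewrite inE; apply: measurableI; last exact: measurable_hbox.
      have mc : measurable_fun setT (coord (inl i) : T -> R).
        exact: measurableT_comp (measurable_tnth i) measurable_fst.
      rewrite (_ : [set x | _] = setT `&` (coord (inl i) @^-1`
        [set` `[c, (c + side Q (inl i) * r)%R[])).
        by apply: mc => //; exact: measurable_itv.
      by rewrite setTI; apply/seteqP; split => x; rewrite /= in_itv.
    - by rewrite inE; exact: measurableX.
    - move=> x [/= xc [h1 h2]]; split => // j; rewrite /a /l.
      by case: eqVneq => [->//|_]; exact: h1.
  have e1 : lebesgue_Rn R n S = (Q.1.2 ^+ n * r)%:E.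
    rewrite lebesgue_hrect ?prod_shrink// => j; rewrite /l.
    by case: ifP => _ //; rewrite mulr_gt0.
  have e2 := lebesgue_hcube g2.
  suff -> : mu (S `*` hcube Q.2) = ((Q.1.2 ^+ n * r)%:E * (Q.2.2 ^+ m)%:E)%E.
    by rewrite -EFinM lee_fin /vol mulrAC.
  by rewrite -e1 -e2; apply: product_measure1E.
pose a j := if j == i then c else Q.2.1 j.
pose l j := if j == i then Q.2.2 * r else Q.2.2.
pose S := [set x : Rn R m | forall j, a j <= (tnth x j : R) < a j + l j].
have mS : measurable S by exact: measurable_hrect.
have mh := measurable_hcube Q.1.
apply: (@le_trans _ _ (mu (hcube Q.1 `*` S))).
  apply: le_measure.
  - rewrite inE; apply: measurableI; last exact: measurable_hbox.
    have mc : measurable_fun setT (coord (inr i) : T -> R).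
      exact: measurableT_comp (measurable_tnth i) measurable_snd.
    rewrite (_ : [set x | _] = setT `&` (coord (inr i) @^-1`
        [set` `[c, (c + side Q (inr i) * r)%R[])).
      by apply: mc => //; exact: measurable_itv.
    by rewrite setTI; apply/seteqP; split => x; rewrite /= in_itv.
  - by rewrite inE; exact: measurableX.
  - move=> x [/= xc [h1 h2]]; split => // j; rewrite /a /l.
    by case: eqVneq => [->//|_]; exact: h2.
have e1 : lebesgue_Rn R m S = (Q.2.2 ^+ m * r)%:E.
  rewrite lebesgue_hrect ?prod_shrink// => j; rewrite /l.
  by case: ifP => _ //; rewrite mulr_gt0.
have e2 := lebesgue_hcube g1.
suff -> : mu (hcube Q.1 `*` S) = ((Q.1.2 ^+ n)%:E * (Q.2.2 ^+ m * r)%:E)%E.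
  by rewrite -EFinM lee_fin /vol mulrA.
by rewrite -e1 -e2; apply: product_measure1E.
Qed.

Lemma measurable_coord s : measurable_fun setT (coord s : T -> R).
Proof.
case: s => i; first exact: measurableT_comp (measurable_tnth i) measurable_fst.
exact: measurableT_comp (measurable_tnth i) measurable_snd.
Qed.

Definition symdiff A O := (A `\` O) `|` (O `\` A).

Lemma measurable_symdiff A O :
  measurable A -> measurable O -> measurable (symdiff A O).
Proof. by move=> mA mO; apply: measurableU; exact: measurableD. Qed.

(* These sets form a sigma-algebra containing the coordinate half-spaces, hence
   contain all Borel sets. This replaces Lebesgue's differentiation theorem. *)
Definition approx Q : set (set T) := [set A | measurable A /\
  forall e, 0 < e -> exists k O, [/\ measurable O, isgen k Q O &
    (mu (symdiff A O `&` hbox Q) <= e%:E)%E]].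

Lemma approx_ray Q s (c : R) : good Q -> approx Q [set x | coord s x < c].
Proof.
move=> gQ; split.
  rewrite (_ : [set x | _] = setT `&` (coord s @^-1` [set` `]-oo, c[])).
    by apply: measurable_coord => //; exact: measurable_itv.
  by rewrite setTI; apply/seteqP; split => x; rewrite /= in_itv.
move=> e e0.
have v0 := vol_gt0 gQ; have s0 := side_gt0 s gQ.
have q1 : `|2^-1 : R| < 1 by rewrite ger0_norm; lra.
have /cvgrPdist_le/(_ e e0) [k _ /(_ k (leqnn k))] := cvg_geometric (vol Q) q1.
rewrite /geometric/= sub0r normrN exprVn => hk.
have k0 : 0 < 2 ^+ k :> R by rewrite exprn_gt0.
(* c is rounded down to the grid of generation k; the two half-spaces then differ inside a slab of
   relative thickness 2^-k, whose measure is at most e by the choice of k. *)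
pose j := Num.floor ((c - low Q s) / side Q s * 2 ^+ k).
pose c' := low Q s + side Q s * (j%:~R / 2 ^+ k).
have /andP[j1 j2] : j%:~R <= (c - low Q s) / side Q s * 2 ^+ k < (j + 1)%:~R.
  exact: floor_itv.
have c'c : c' <= c.
  have : j%:~R / 2 ^+ k <= (c - low Q s) / side Q s by rewrite ler_pdivrMr.
  by rewrite ler_pdivlMr// mulrC -lerBrDl.
have cc' : c < c' + side Q s * 2 ^- k.
  have : (c - low Q s) / side Q s < (j + 1)%:~R / 2 ^+ k by rewrite ltr_pdivlMr.
  rewrite ltr_pdivrMr// intrD mulrDl mul1r mulrDl [X in _ < X + _]mulrC [X in _ < _ + X]mulrC.
  rewrite /c'; lra.
exists k, [set x | coord s x < c']; split.
- rewrite (_ : [set x | _] = setT `&` (coord s @^-1` [set` `]-oo, c'[])).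
    by apply: measurable_coord => //; exact: measurable_itv.
  by rewrite setTI; apply/seteqP; split => x; rewrite /= in_itv.
- exact: isgen_ray.
- have r0 : 0 < 2 ^- k :> R by rewrite invr_gt0.
  apply: (@le_trans _ _ (vol Q * 2 ^- k)%:E); last first.
    by rewrite lee_fin; apply: le_trans hk; exact: ler_norm.
  apply: le_trans (@mu_slab Q s c' _ gQ r0).
  have mray (a : R) : measurable [set x : T | coord s x < a].
    rewrite (_ : [set x | _] = setT `&` (coord s @^-1` [set` `]-oo, a[])).
      by apply: measurable_coord => //; exact: measurable_itv.
    by rewrite setTI; apply/seteqP; split => x; rewrite /= in_itv.
  apply: le_measure.
  - rewrite inE; apply: measurableI; last exact: measurable_hbox.
    exact: measurable_symdiff.
  - rewrite inE; apply: measurableI; last exact: measurable_hbox.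
    rewrite (_ : [set x | _] = [set x | coord s x < c' + side Q s * 2 ^- k] `\`
        [set x | coord s x < c']).
      exact: measurableD.
    apply/seteqP; split => x /=.
      by move=> /andP[h1 h2]; split => //; apply/negP; rewrite -leNgt.
    by move=> [h1 /negP]; rewrite -leNgt => h2; rewrite h2.
  - move=> x [[[/= h1 h2]|[/= h1 h2]] xQ]; move/negP: h2; rewrite -leNgt => h2;
      split => //=.
      by rewrite h2 (lt_trans h1 cc').
    by have := lt_le_trans h1 (le_trans c'c h2); rewrite ltxx.
Qed.

Lemma approxC Q A : approx Q A -> approx Q (~` A).
Proof.
case=> mA H; split; first exact: measurableC.
move=> e /H[k [U [mU gU AU]]]; exists k, (~` U); split.
- exact: measurableC.
- exact: isgenC.
- rewrite (_ : symdiff (~` A) (~` U) = symdiff A U)//.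
  by rewrite /symdiff !setDE !setCK setUC [U `&` _]setIC [~` U `&` _]setIC.
Qed.

Lemma approxU Q A A' : good Q -> approx Q A -> approx Q A' -> approx Q (A `|` A').
Proof.
move=> gQ [mA H] [mA' H']; split; first exact: measurableU.
move=> e e0; have e2 : 0 < e / 2 by rewrite divr_gt0.
have [k [ O [mO gO AO]]] := H _ e2; have [k' [ O' [mO' gO' AO']]] := H' _ e2.
exists (maxn k k'), (O `|` O'); split; first exact: measurableU.
  by apply: isgenU; [apply: isgen_le gO => //; exact: leq_maxl|
                     apply: isgen_le gO' => //; exact: leq_maxr].
have mh := measurable_hbox Q.
have m1 : measurable (symdiff A O `&` hbox Q).
  by apply: measurableI => //; exact: measurable_symdiff.
have m2 : measurable (symdiff A' O' `&` hbox Q).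
  by apply: measurableI => //; exact: measurable_symdiff.
apply: (@le_trans _ _ (mu ((symdiff A O `&` hbox Q) `|` (symdiff A' O' `&` hbox Q)))).
  apply: le_measure; rewrite ?inE.
  - apply: measurableI => //.
    by apply: measurable_symdiff; exact: measurableU.
  - exact: measurableU.
  - move=> x [[[[xA|xA] /not_orP[h1 h2]]|[[xA|xA] /not_orP[h1 h2]]] xQ].
    + by left; split => //; left.
    + by right; split => //; left.
    + by left; split => //; right.
    + by right; split => //; right.
apply: (le_trans (measureU2 mu m1 m2)).
by rewrite [e in leRHS]splitr EFinD; exact: leeD.
Qed.

(** Q has finite measure, so by continuity from below a finite union misses at most e / 2 of the
    countable one inside Q; the finite union is approximated up to the other e / 2. *)
Lemma approx_bigcup Q (A : nat -> set T) : good Q ->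
  (forall i, approx Q (A i)) -> approx Q (\bigcup_i A i).
Proof.
move=> gQ H; have mA i : measurable (A i) by exact: (H i).1.
split; first exact: bigcup_measurable.
have HU N : approx Q (\big[setU/set0]_(i < N) A i).
  elim: N => [|N ih]; last by rewrite big_ord_recr/=; exact: approxU.
  rewrite big_ord0; split => // e e0; exists 0%N, set0; split => //.
    by right; rewrite set0I.
  by rewrite /symdiff !setD0 setU0 set0I measure0 lee_fin ltW.
move=> e e0; have e2 : 0 < e / 2 by rewrite divr_gt0.
have mh := measurable_hbox Q.
pose B N := (\big[setU/set0]_(i < N.+1) A i) `&` hbox Q.
pose BB := (\bigcup_i A i) `&` hbox Q.
have mB N : measurable (B N).
  by apply: measurableI => //; exact: (HU N.+1).1.
have mBB : measurable BB by apply: measurableI => //; exact: bigcup_measurable.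
have BE : \bigcup_N B N = BB.
  by rewrite /B /BB -setI_bigcupl bigcup_bigsetU_bigcup.
have ndB : {homo B : n m / (n <= m)%N >-> (n <= m)%O}.
  move=> i j ij; apply/subsetPset => x [h xQ]; split => //.
  move: x h {xQ}; exact: subset_bigsetU.
have muB : mu BB \is a fin_num.
  rewrite ge0_fin_numE//; apply: le_lt_trans (_ : mu (hbox Q) < +oo)%E.
    by apply: le_measure; rewrite ?inE// => x [].
  by rewrite mu_hbox// ltry.
have cB : (mu \o B) N @[N --> \oo] --> mu (\bigcup_N B N).
  exact: nondecreasing_cvg_mu mB (bigcup_measurable (fun N _ => mB N)) ndB.
rewrite BE in cB.
have [N hN] : exists N, (mu BB - (e / 2)%:E < mu (B N))%E.
  apply: contrapT => /forallNP hN.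
  have : (mu BB <= mu BB - (e / 2)%:E)%E.
    rewrite -[leLHS](cvg_lim _ cB)//; apply: lime_le; first by apply/cvg_ex; exists (mu BB).
    by apply: nearW => N; rewrite leNgt; apply/negP; exact: hN.
  by rewrite leNgt lteBlDr// lteDl// lte_fin e2.
have [k [ O [mO gO AO]]] := (HU N.+1).2 _ e2.
exists k, O; split => //.
pose U := \big[setU/set0]_(i < N.+1) A i; have mU : measurable U := (HU N.+1).1.
apply: (@le_trans _ _ (mu ((BB `\` B N) `|` (symdiff U O `&` hbox Q)))).
  apply: le_measure; rewrite ?inE.
  - apply: measurableI => //; apply: measurable_symdiff => //; exact: bigcup_measurable.
  - apply: measurableU; first exact: measurableD.
    by apply: measurableI => //; exact: measurable_symdiff.
  - move=> x [[[xA xO]|[xO xA]] xQ].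
      have [xU|xU] := pselect (U x); first by right; split => //; left.
      by left; split => // -[].
    right; split => //; right; split => // xU; apply: xA.
    by move: xU; rewrite /U -bigcup_mkord => -[i _ ?]; exists i.
apply: le_trans (measureU2 mu _ _) _; first exact: measurableD.
  by apply: measurableI => //; exact: measurable_symdiff.
rewrite [e in leRHS]splitr EFinD; apply: leeD => //.
change (mu (BB `\` B N) <= (e / 2)%:E)%E.
have -> : mu (BB `\` B N) = (mu BB - mu (B N))%E.
  have BBN : BB `&` B N = B N by rewrite setIidr// -BE; exact: bigcup_sup.
  rewrite -[in RHS]BBN; apply: measureD => //.
  by have := muB; rewrite ge0_fin_numE.
have fN : mu (B N) \is a fin_num.
  rewrite ge0_fin_numE//; apply: (@le_lt_trans _ _ (mu BB)).
    by apply: le_measure; rewrite ?inE// -BE; exact: bigcup_sup.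
  by rewrite -ge0_fin_numE.
by move: hN; rewrite lteBlDr// => /ltW h; rewrite leeBlDr// addeC.
Qed.

(** The coordinates are measurable for the sigma-algebra [approx Q], hence so is the identity map
    into T, and the preimage of a Borel set under it is the set itself. *)
Lemma approx_measurable Q A : good Q -> measurable A -> approx Q A.
Proof.
move=> gQ mA.
have sa : sigma_algebra setT (approx Q).
  split.
  - rewrite -setCT; apply: approxC; split => // e e0; exists 0%N, setT; split => //.
      by left.
    by rewrite /symdiff setDv setU0 set0I measure0 lee_fin ltW.
  - by move=> B; rewrite setTD; exact: approxC.
  - by move=> F; exact: approx_bigcup.
pose T' := g_sigma_algebraType (approx Q).
have mid : measurable_fun [set: T'] (fun x : T' => ((x : T).1, (x : T).2)).
  have mc s : measurable_fun [set: T'] (fun x : T' => coord s x).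
    apply: (measurability (RGenCInfty.G (R := R))).
      exact: RGenCInfty.measurableE.
    move=> _ [_ [c ->] <-]; rewrite setTI.
    apply: sub_sigma_algebra.
    rewrite (_ : _ @^-1` _ = ~` [set x | coord s x < c]).
      by apply: approxC; exact: approx_ray.
    apply/seteqP; split => x /=; rewrite in_itv/= andbT; first by rewrite leNgt => /negP.
    by move=> /negP; rewrite -leNgt.
  apply: measurable_fun_pair; apply/measurable_fun_tnthP => i.
    exact: (mc (inl i)).
  exact: (mc (inr i)).
have := mid measurableT A mA.
rewrite setTI (_ : _ @^-1` A = A); last by apply/seteqP; split => -[].
by rewrite /measurable/= sigma_algebra_id.
Qed.

End approximation.

(** * The Calderon-Zygmund stopping set at height 2t *)

Section calderon_zygmund.
Context {R : realType} {n m : nat}.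
Local Notation T := (Rn R n * Rn R m)%type.
Local Notation mu := (@leb2 R n m).
Local Notation cell := (@cell R n m).
Implicit Types (Q : cell) (x : T) (A : set T).
Variables (f : T -> R) (t : R) (Q : cell).
Hypotheses (mf : measurable_fun setT f) (f0 : forall x, 0 <= f x).
Hypotheses (t0 : 0 < t) (gQ : good Q).
Hypothesis fQ : (\int[mu]_(x in hbox Q) (f x)%:E <= (t * vol Q)%:E)%E.

Definition heavy (Q' : cell) : Prop :=
  ~ (\int[mu]_(x in hbox Q') (f x)%:E <= (2 * t * vol Q')%:E)%E.

Definition stopset : set T := \bigcup_k stop heavy k Q.

Let mfE : measurable_fun setT (EFin \o f).
Proof. exact/measurable_EFinP. Qed.

Let fE0 x : (0 <= (f x)%:E)%E. Proof. by rewrite lee_fin. Qed.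

Let addf := child_additive_integral mfE fE0.

Let addt : child_additive (fun A => \int[mu]_(x in A) (2 * t)%:E)%E.
Proof.
apply: child_additive_integral; first exact: measurable_cst.
by move=> x; rewrite lee_fin mulr_ge0// ltW.
Qed.

Let int2t A : measurable A -> (\int[mu]_(x in A) (2 * t)%:E = (2 * t)%:E * mu A)%E.
Proof. by move=> mA; rewrite integral_cst. Qed.

Lemma not_heavy_root : ~ heavy Q.
Proof.
apply; apply: (le_trans fQ); rewrite lee_fin -mulrA ler_peMl ?ler1n//.
by rewrite mulr_ge0// ltW// vol_gt0.
Qed.

Lemma measurable_stopset : measurable stopset.
Proof. by apply: bigcup_measurable => k _; exact: measurable_stop. Qed.

Lemma stopset_sub : stopset `<=` hbox Q.
Proof. by move=> x [k _]; exact: stop_sub. Qed.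

Lemma stop_ndseq : {homo (fun k => stop heavy k Q) : i j / (i <= j)%N >-> (i <= j)%O}.
Proof.
move=> i j /subnK <-; elim: (j - i)%N => [|k ih]; first exact: lexx.
by apply: (le_trans ih); rewrite addSn; apply/subsetPset; exact: stop_nondecr.
Qed.

(** Chebyshev's inequality: 2t |F| is at most the integral of f over F, hence at most t |Q|. It is
    proved for the stopping rectangles up to generation k, and k tends to infinity. *)
Lemma mu_stopset : (mu stopset <= (vol Q / 2)%:E)%E.
Proof.
have mk k : measurable (stop heavy k Q) by exact: measurable_stop.
have hk k : (mu (stop heavy k Q) <= (vol Q / 2)%:E)%E.
  have : (\int[mu]_(x in stop heavy k Q) (2 * t)%:E <= (t * vol Q)%:E)%E.
    apply: (@le_trans _ _ (\int[mu]_(x in stop heavy k Q) (f x)%:E)%E).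
      apply: (stop_le addt addf _ k gQ not_heavy_root).
        by rewrite !integral_set0.
      move=> Q' b gQ' _ /negP; rewrite -ltNge => /ltW.
      apply: le_trans; rewrite int2t; last exact: measurable_hbox.
      by rewrite mu_hbox ?EFinM//; exact: good_child.
    apply: le_trans fQ; apply: ge0_subset_integral => //.
    - exact: measurable_hbox.
    - exact: measurable_funTS.
    - exact: stop_sub.
  rewrite int2t// => h.
  rewrite (_ : vol Q / 2 = (2 * t)^-1 * (t * vol Q)); last first.
    by field; rewrite gt_eqF.
  by rewrite [leRHS]EFinM lee_pdivlMl ?mulr_gt0.
have cm : (mu \o (fun k => stop heavy k Q)) k @[k --> \oo] --> mu stopset.
  exact: nondecreasing_cvg_mu mk measurable_stopset stop_ndseq.
rewrite -(cvg_lim _ cm)//; apply: lime_le; first by apply/cvg_ex; exists (mu stopset).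
exact: nearW.
Qed.

Let bad (e : R) : set T := [set x | 2 * t + e <= f x] `&` (hbox Q `\` stopset).

Let measurable_bad e : measurable (bad e).
Proof.
apply: measurableI; last first.
  by apply: measurableD; [exact: measurable_hbox|exact: measurable_stopset].
rewrite (_ : [set x | _] = setT `&` f @^-1` [set` `[2 * t + e, +oo[]).
  by apply: mf => //; exact: measurable_itv.
by rewrite setTI; apply/seteqP; split => x /=; rewrite in_itv/= andbT.
Qed.

(* [bad e] is approximated by a union O of dyadic cells of some generation k;
   those not contained in the stopping set have average at most [2 t]. *)
Let bad_null e : 0 < e -> mu (bad e) = 0%E.
Proof.
move=> e0; set A := bad e; have mA : measurable A by exact: measurable_bad.
have mh := measurable_hbox Q.
have fA : mu A \is a fin_num.
  rewrite ge0_fin_numE//; apply: (@le_lt_trans _ _ (mu (hbox Q))).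
    by apply: le_measure; rewrite ?inE// => x [_ []].
  by rewrite mu_hbox// ltry.
have [_ approxA] := approx_measurable gQ mA.
(* With r bounding the measure of the symmetric difference of A and O in Q: (2t + e)(|A| - r) <= (2t
   + e) |A & G| <= integral of f over G <= 2t |G| <= 2t (|A| + r). *)
have key r : 0 < r -> e * fine (mu A) <= (4 * t + e) * r.
  move=> r0; have [k [ O [mO gO AO]]] := approxA _ r0.
  set S := symdiff A O `&` hbox Q in AO.
  have mS : measurable S by apply: measurableI => //; exact: measurable_symdiff.
  set G := O `&` (hbox Q `\` stop heavy k Q).
  have mG : measurable G.
    by apply: measurableI => //; apply: measurableD => //; exact: measurable_stop.
  have AGS : A `<=` (A `&` G) `|` S.
    move=> x Ax; have [_ [xQ xs]] := Ax; have [xO|xO] := pselect (O x).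
      left; split => //; split => //; split => // xk; apply: xs.
      by exists k.
    by right; split => //; left.
  have GAS : G `<=` A `|` S.
    move=> x [xO [xQ _]]; have [xA|xA] := pselect (A x); first by left.
    by right; split => //; right.
  have mAG : measurable (A `&` G) by exact: measurableI.
  have h1 : (mu A <= mu (A `&` G) + r%:E)%E.
    apply: le_trans (_ : mu ((A `&` G) `|` S) <= _)%E.
      by apply: le_measure; rewrite ?inE//; exact: measurableU.
    by apply: (le_trans (measureU2 mu mAG mS)); exact: leeD2l.
  have h2 : (mu G <= mu A + r%:E)%E.
    apply: le_trans (_ : mu (A `|` S) <= _)%E.
      by apply: le_measure; rewrite ?inE//; exact: measurableU.
    by apply: (le_trans (measureU2 mu mA mS)); exact: leeD2l.
  have h3 : ((2 * t + e)%:E * mu (A `&` G) <= (2 * t)%:E * mu G)%E.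
    rewrite -int2t//; apply: le_trans (_ : \int[mu]_(x in G) (f x)%:E <= _)%E.
      rewrite -integral_cst//.
      apply: (@le_trans _ _ (\int[mu]_(x in A `&` G) (f x)%:E)%E).
        apply: ge0_le_integral => //.
        - by move=> x _; rewrite lee_fin addr_ge0 ?mulr_ge0 ?ltW.
        - exact: measurable_funTS.
        - by move=> x [[/= h _] _]; rewrite lee_fin.
      apply: ge0_subset_integral => //; exact: measurable_funTS.
    apply: (nonstop_le addf addt _ gQ not_heavy_root) => //.
      by rewrite !integral_set0.
    move=> Q' gQ' /contrapT; rewrite int2t ?mu_hbox//; last exact: measurable_hbox.
  have fAG : mu (A `&` G) \is a fin_num.
    rewrite ge0_fin_numE//; apply: (@le_lt_trans _ _ (mu A)).
      by apply: le_measure; rewrite ?inE// => x [].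
    by rewrite -ge0_fin_numE.
  have fG : mu G \is a fin_num.
    rewrite ge0_fin_numE//; apply: (le_lt_trans h2).
    by rewrite -(fineK fA) -EFinD ltry.
  move: h1 h2 h3; rewrite -(fineK fA) -(fineK fAG) -(fineK fG) -!EFinD -!EFinM !lee_fin.
  set a := fine (mu A); set ag := fine (mu (A `&` G)); set g := fine (mu G).
  clearbody a ag g => h1 h2 h3.
  have p1 : (2 * t + e) * a <= (2 * t + e) * (ag + r).
    by apply: ler_wpM2l h1; apply: addr_ge0; [apply: mulr_ge0; rewrite ?ltW|exact: ltW].
  have p2 : 2 * t * g <= 2 * t * (a + r).
    by apply: ler_wpM2l h2; apply: mulr_ge0; rewrite ?ltW.
  rewrite [fine _]/=; lra.
suff : fine (mu A) <= 0.
  by move=> h; apply/eqP; rewrite -(fineK fA) eqe eq_le h fine_ge0.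
rewrite leNgt; apply/negP => a0.
have c0 : 0 < 4 * t + e by rewrite addr_gt0 ?mulr_gt0.
(* This r makes the right side of [key] half of its left side. *)
have := key (e * fine (mu A) / (4 * t + e) / 2).
rewrite !divr_gt0 ?mulr_gt0// => /(_ isT).
have -> : (4 * t + e) * (e * fine (mu A) / (4 * t + e) / 2) = e * fine (mu A) / 2.
  by field; rewrite gt_eqF.
have : 0 < e * fine (mu A) by rewrite mulr_gt0.
lra.
Qed.

Lemma ae_nonstop : {ae mu, forall x, hbox Q x -> ~ stopset x -> f x <= 2 * t}.
Proof.
pose N := \bigcup_(j : nat) bad j.+1%:R^-1.
have mb (j : nat) : measurable (bad j.+1%:R^-1) by exact: measurable_bad.
have mN : measurable N by exact: bigcup_measurable.
exists N; split => //.
- apply/eqP; rewrite eq_le measure_ge0 andbT.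
  apply: le_trans (measure_sigma_subadditive mu mb mN (@subset_refl _ N)) _.
  by rewrite eseries0// => j _ _; exact: bad_null.
- move=> x /= /not_implyP[xQ /not_implyP[xs /negP]]; rewrite -ltNge => fx.
  have d0 : 0 < f x - 2 * t by rewrite subr_gt0.
  pose j := Num.truncn (f x - 2 * t)^-1.
  exists j => //; split => //=.
  rewrite -lerBrDl -[leRHS]invrK lef_pV2 ?posrE ?invr_gt0//.
  by rewrite ltW// truncnS_gt.
Qed.

End calderon_zygmund.

(** * Entrywise integrals of matrix valued functions *)

Section matrix_integral.
Context d (T : measurableType d) (R : realType) (mu : {measure set T -> \bar R}).
Local Notation C := R[i].
Variables (D : set T) (mD : measurable D).

Definition mxint (m n : nat) (G : T -> 'M[C]_(m, n)) : 'M[C]_(m, n) :=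
  \matrix_(i, j) ((\int[mu]_(x in D) complex.Re (G x i j))
               +i* (\int[mu]_(x in D) complex.Im (G x i j))).

Definition mxintegrable (m n : nat) (G : T -> 'M[C]_(m, n)) : Prop :=
  mxmeas G /\ (\int[mu]_(x in D) (fnorm (G x))%:E < +oo)%E.

Lemma integrable_ext (f g : T -> \bar R) :
  mu.-integrable D f -> f =1 g -> mu.-integrable D g.
Proof. by move=> intf /funext <-. Qed.

Lemma Rintegral_sum (I : Type) (s : seq I) (f : I -> T -> R) :
  (forall i, mu.-integrable D (EFin \o f i)) ->
  \int[mu]_(x in D) (\sum_(i <- s) f i x) = \sum_(i <- s) \int[mu]_(x in D) f i x.
Proof.
move=> intf; elim: s => [|i s ih].
  rewrite big_nil; under eq_Rintegral do rewrite big_nil.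
  by rewrite Rintegral_cst// mul0r.
rewrite big_cons -ih; under eq_Rintegral do rewrite big_cons.
rewrite RintegralD//; apply: integrable_ext (integrable_sum mD s (fun i _ => intf i)) _ => x.
by rewrite /= sumEFin.
Qed.

Lemma mxintegrable_Re m n (G : T -> 'M[C]_(m, n)) i j : mxintegrable G ->
  mu.-integrable D (EFin \o (fun x => complex.Re (G x i j))).
Proof.
move=> [mG iG]; apply/integrableP; split.
  by apply/measurable_EFinP; apply: measurable_funTS; exact: (mG i j).1.
apply: le_lt_trans iG; apply: le_integral_lower => // x _.
rewrite abse_EFin lee_fin; apply: (le_trans (Re_le_normc _)); exact: normc_le_fnorm.
Qed.

Lemma mxintegrable_Im m n (G : T -> 'M[C]_(m, n)) i j : mxintegrable G ->
  mu.-integrable D (EFin \o (fun x => complex.Im (G x i j))).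
Proof.
move=> [mG iG]; apply/integrableP; split.
  by apply/measurable_EFinP; apply: measurable_funTS; exact: (mG i j).2.
apply: le_lt_trans iG; apply: le_integral_lower => // x _.
rewrite abse_EFin lee_fin; apply: (le_trans (Im_le_normc _)); exact: normc_le_fnorm.
Qed.

Lemma mxintegrableM m n p q (P : 'M[C]_(p, m)) (G : T -> 'M[C]_(m, n)) (S : 'M[C]_(n, q)) :
  mxintegrable G -> mxintegrable (fun x => P *m G x *m S).
Proof.
move=> [mG iG]; split; first by apply: mxmeasM; [apply: mxmeasM => //|]; exact: mxmeas_cst.
apply: (@le_lt_trans _ _ (\int[mu]_(x in D) ((fnorm P * fnorm S)%:E * (fnorm (G x))%:E))%E).
  apply: le_integral_lower => [x|x _]; first by rewrite lee_fin.
  rewrite -EFinM lee_fin mulrAC; apply: (le_trans (fnormM _ _)).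
  by rewrite ler_wpM2r//; exact: fnormM.
rewrite ge0_integralZl_EFin//.
- by rewrite lte_mul_pinfty// lee_fin mulr_ge0.
- by move=> x _; rewrite lee_fin.
- by apply/measurable_EFinP; apply: measurable_funTS; exact: measurable_fnorm.
- by rewrite mulr_ge0.
Qed.

Lemma mxint_mull m n p (P : 'M[C]_(p, m)) (G : T -> 'M[C]_(m, n)) :
  mxintegrable G -> mxint (fun x => P *m G x) = P *m mxint G.
Proof.
move=> iG; apply/matrixP => i j; rewrite !mxE.
have iR k := mxintegrable_Re k j iG; have iI k := mxintegrable_Im k j iG.
have iZ (c : R) f : mu.-integrable D (EFin \o f) ->
    mu.-integrable D (EFin \o (fun x => c * f x)).
  by move=> h; apply: integrable_ext (integrableZl mD c h) _.
apply/eqP; rewrite eq_complex /=; apply/andP; split; apply/eqP.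
  rewrite Re_sumc; under eq_Rintegral do rewrite mxE Re_sumc.
  rewrite Rintegral_sum.
    apply: eq_bigr => k _; rewrite Re_mulc mxE/=.
    under eq_Rintegral do rewrite Re_mulc.
    by rewrite RintegralB ?RintegralZl//; exact: iZ.
  move=> k; apply: integrable_ext (integrableB mD (iZ (complex.Re (P i k)) _ (iR k))
    (iZ (complex.Im (P i k)) _ (iI k))) _ => x.
  by rewrite /= Re_mulc EFinB.
rewrite Im_sumc; under eq_Rintegral do rewrite mxE Im_sumc.
rewrite Rintegral_sum.
  apply: eq_bigr => k _; rewrite Im_mulc mxE/=.
  under eq_Rintegral do rewrite Im_mulc.
  by rewrite RintegralD ?RintegralZl//; exact: iZ.
move=> k; apply: integrable_ext (integrableD mD (iZ (complex.Re (P i k)) _ (iI k))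
  (iZ (complex.Im (P i k)) _ (iR k))) _ => x.
by rewrite /= Im_mulc EFinD.
Qed.

Lemma mxint_tr m n (G : T -> 'M[C]_(m, n)) :
  mxint (fun x => (G x)^T) = (mxint G)^T.
Proof.
apply/matrixP => i j; rewrite !mxE; congr (_ +i* _).
  by apply: eq_Rintegral => x _; rewrite mxE.
by apply: eq_Rintegral => x _; rewrite mxE.
Qed.

Lemma fnorm_tr m n (A : 'M[C]_(m, n)) : fnorm A^T = fnorm A.
Proof.
rewrite /fnorm exchange_big/=; congr Num.sqrt.
by apply: eq_bigr => i _; apply: eq_bigr => j _; rewrite mxE.
Qed.

Lemma mxint_mulr m n p (G : T -> 'M[C]_(m, n)) (P : 'M[C]_(n, p)) :
  mxintegrable G -> mxint (fun x => G x *m P) = mxint G *m P.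
Proof.
move=> iG; apply: trmx_inj; rewrite -mxint_tr trmx_mul -mxint_tr -mxint_mull.
  by congr mxint; apply/funext => x; rewrite trmx_mul.
split; last by under eq_integral do rewrite fnorm_tr; exact: iG.2.
by move=> i j; have [h1 h2] := iG.1 j i; split; under eq_fun do rewrite mxE.
Qed.

Lemma mxint_mul m n p q (P : 'M[C]_(p, m)) (G : T -> 'M[C]_(m, n)) (S : 'M[C]_(n, q)) :
  mxintegrable G -> mxint (fun x => P *m G x *m S) = P *m mxint G *m S.
Proof.
move=> iG; rewrite -mxint_mull// mxint_mulr//.
have := mxintegrableM P 1%:M iG; congr mxintegrable.
by apply/funext => x; rewrite mulmx1.
Qed.

(** Pairing with the integral Z itself: |Z|^2 is the integral of the real inner product of Z and
    G(x), hence at most |Z| times the integral of |G|. *)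
Lemma fnorm_mxint m n (G : T -> 'M[C]_(m, n)) : mxintegrable G ->
  ((fnorm (mxint G))%:E <= \int[mu]_(x in D) (fnorm (G x))%:E)%E.
Proof.
move=> iG; set Z := mxint G.
have iR i j := mxintegrable_Re i j iG; have iI i j := mxintegrable_Im i j iG.
have iZ (c : R) f : mu.-integrable D (EFin \o f) ->
    mu.-integrable D (EFin \o (fun x => c * f x)).
  by move=> h; apply: integrable_ext (integrableZl mD c h) _.
pose h (k : 'I_m * 'I_n) x := complex.Re (Z k.1 k.2) * complex.Re (G x k.1 k.2) +
                    complex.Im (Z k.1 k.2) * complex.Im (G x k.1 k.2).
have ih k : mu.-integrable D (EFin \o h k).
  exact: integrable_ext (integrableD mD (iZ _ _ (iR k.1 k.2)) (iZ _ _ (iI k.1 k.2))) _.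
have ihs : mu.-integrable D (EFin \o (fun x => \sum_k h k x)).
  apply: integrable_ext (integrable_sum mD (index_enum _) (fun i _ => ih i)) _ => x.
  by rewrite /= sumEFin.
have iF : mu.-integrable D (EFin \o (fun x => fnorm (G x))).
  apply/integrableP; split.
    by apply/measurable_EFinP; apply: measurable_funTS; apply: measurable_fnorm iG.1.
  apply: le_lt_trans iG.2; apply: le_integral_lower => // x _.
  by rewrite /= ger0_norm.
have key : fnorm Z ^+ 2 <= fnorm Z * \int[mu]_(x in D) fnorm (G x).
  have -> : fnorm Z ^+ 2 = \int[mu]_(x in D) \sum_k h k x.
    rewrite Rintegral_sum// sqr_fnorm pair_bigA/=; apply: eq_bigr => k _.
    rewrite normc_sqr RintegralD; [|exact: mD|exact: iZ|exact: iZ].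
    by rewrite !RintegralZl// !expr2 {2 4}/Z !mxE.
  rewrite -RintegralZl//; apply: le_Rintegral => //.
    exact: iZ.
  move=> x _; rewrite /h.
  (* The boolean distinguishes real and imaginary parts, so that the real Cauchy-Schwarz inequality
     applies. *)
  have := sum_mul_le_sqrt
    (fun k : ('I_m * 'I_n) * bool =>
      if k.2 then complex.Re (Z k.1.1 k.1.2) else complex.Im (Z k.1.1 k.1.2))
    (fun k : ('I_m * 'I_n) * bool =>
      if k.2 then complex.Re (G x k.1.1 k.1.2) else complex.Im (G x k.1.1 k.1.2)).
  have E (F : ('I_m * 'I_n) * bool -> R) : \sum_k F k = \sum_k (F (k, true) + F (k, false)).
    rewrite (eq_bigr (fun p => F (p.1, p.2))); last by case.
    rewrite -(pair_bigA _ (fun a b => F (a, b)))/=.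
    by apply: eq_bigr => k _; rewrite big_bool.
  by rewrite !E/=; under [X in Num.sqrt X * _]eq_bigr do rewrite -normc_sqr;
    under [X in _ * Num.sqrt X]eq_bigr do rewrite -normc_sqr; rewrite -!fnorm_pair.
have h0 : (0 <= \int[mu]_(x in D) (fnorm (G x))%:E)%E.
  by apply: integral_ge0 => x _; rewrite lee_fin.
have [Z0|Z0] := eqVneq (fnorm Z) 0; first by rewrite Z0.
have fin : (\int[mu]_(x in D) (fnorm (G x))%:E)%E \is a fin_num.
  by rewrite ge0_fin_numE//; exact: iG.2.
rewrite -(fineK fin) lee_fin.
by move: key; rewrite expr2 ler_pM2l// lt0r Z0/=.
Qed.

End matrix_integral.

(** * Conjugate exponents *)

Section conjugate_exponent.
Context {R : realType}.
Variables (p : R) (p1 : 1 < p).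
Let q := conj_exp p.

Lemma conj_exp_gt0 : 0 < q.
Proof. by rewrite divr_gt0 ?subr_gt0// (lt_trans _ p1). Qed.

Lemma exp_gt0 : 0 < p. Proof. exact: lt_trans p1. Qed.

Lemma conj_expV : p^-1 + q^-1 = 1.
Proof.
have h1 : p - 1 != 0 by rewrite subr_eq0 gt_eqF.
have h2 : p != 0 by rewrite gt_eqF// exp_gt0.
by rewrite /q /conj_exp; field; rewrite h1 h2.
Qed.

Lemma conj_exp_div : p / q = p - 1.
Proof.
have h1 : p - 1 != 0 by rewrite subr_eq0 gt_eqF.
have h2 : p != 0 by rewrite gt_eqF// exp_gt0.
by rewrite /q /conj_exp; field; rewrite h1 h2.
Qed.

End conjugate_exponent.

(** * Consequences of the A_p condition for the scalar weights |W^(1/p) e|^p *)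

Section Ap_estimates.
Context dT (T : measurableType dT) (R : realType) (mu : {measure set T -> \bar R}).
Local Notation C := R[i].
Variables (d : nat) (W : T -> 'M[C]_d) (p K v : R) (D : set T).
Let q := conj_exp p.
Hypotheses (d0 : (0 < d)%N) (p1 : 1 < p) (K0 : 0 < K) (v0 : 0 < v).
Hypotheses (mD : measurable D) (muD : mu D = v%:E).
Hypotheses (mW : mxmeas W) (pW : forall x, posdefmx (W x)).
Hypothesis Ap : (\int[mu]_(x in D) poweR (v^-1%:E *
  \int[mu]_(y in D) (opnorm (mpow (W x) p^-1 *m mpow (W y) (- p^-1)) `^ q)%:E)
    (p / q) <= (K * v)%:E)%E.

Let p0 : 0 < p := exp_gt0 p1.
Let q0 : 0 < q := conj_exp_gt0 p1.
Let pq0 : 0 < p / q. Proof. exact: divr_gt0. Qed.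

Let mP s : mxmeas (fun x => mpow (W x) s). Proof. exact: mxmeas_mpow. Qed.

Definition kern x y : R := fnorm (mpow (W x) p^-1 *m mpow (W y) (- p^-1)).

Lemma kern_ge0 x y : 0 <= kern x y. Proof. exact: fnorm_ge0. Qed.

Lemma measurable_kern x : measurable_fun setT (kern x).
Proof.
by apply: measurable_fnorm; apply: mxmeasM; [exact: mxmeas_cst|exact: mP].
Qed.

Let mkq x : measurable_fun setT (fun y => kern x y `^ q).
Proof. exact: measurableT_comp (measurable_powR _) (measurable_kern x). Qed.

Let Io x : \bar R :=
  (\int[mu]_(y in D) (opnorm (mpow (W x) p^-1 *m mpow (W y) (- p^-1)) `^ q)%:E)%E.

Let Io_ge0 x : (0 <= Io x)%E.
Proof. by apply: integral_ge0 => y _; rewrite lee_fin powR_ge0. Qed.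

Lemma kern_le_Io x : (\int[mu]_(y in D) (kern x y `^ q)%:E <= (d%:R `^ q)%:E * Io x)%E.
Proof.
have dq : 0 < d%:R `^ q :> R by rewrite powR_gt0// ltr0n.
rewrite -lee_pdivrMl// -ge0_integralZ_EFin//; last by move=> y; exact: powR_ge0.
apply: le_integral_lower => [y|y _]; rewrite lee_fin.
  by rewrite mulr_ge0// ?powR_ge0// invr_ge0 ltW.
rewrite ler_pdivrMl// -powRM ?ler0n//.
have : kern x y <= d%:R * opnorm (mpow (W x) p^-1 *m mpow (W y) (- p^-1)).
  exact: fnorm_le_opnorm.
by apply: (ge0_ler_powR (ltW q0)); rewrite nnegrE ?kern_ge0// mulr_ge0.
Qed.

(** If u(x) is controlled by the power p/q of the inner integral at x, then the A_p condition
    controls the integral of u. The factor d^p comes from [kern] being a Frobenius norm, and v^p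
    from the normalizations v^(p/q) = v^(p-1) of the inner and v of the outer integral. Points x
    with an infinite inner integral are dealt with here, so that H speaks of real bounds only. *)
Lemma Ap_mean_le (u : T -> R) (s : R) :
  measurable_fun setT u -> (forall x, 0 <= u x) -> 0 <= s ->
  (forall x A, D x -> 0 <= A ->
    (\int[mu]_(y in D) (kern x y `^ q)%:E <= A%:E)%E -> u x <= A `^ (p / q) * s) ->
  (\int[mu]_(x in D) (u x)%:E <= (d%:R `^ p * K * v `^ p * s)%:E)%E.
Proof.
move=> mu_ u0 s0 H.
have dp : 0 < d%:R `^ p :> R by rewrite powR_gt0// ltr0n.
pose c0 := d%:R `^ p * v `^ (p / q); have c00 : 0 < c0 by rewrite mulr_gt0// powR_gt0.
(* The proof divides by the factor s', while s may be 0; s' tends to s at the end. *)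
have key s' : s <= s' -> 0 < s' ->
    (\int[mu]_(x in D) (u x)%:E <= (c0 * s' * (K * v))%:E)%E.
  move=> ss' s'0; have c1 : 0 < c0 * s' by rewrite mulr_gt0.
  rewrite EFinM -lee_pdivrMl// -ge0_integralZ_EFin//; last by rewrite invr_ge0 ltW.
  apply: le_trans Ap; apply: le_integral_lower => x.
    by rewrite lee_fin mulr_ge0// invr_ge0 ltW.
  move=> Dx; rewrite -/(Io x); have := Io_ge0 x; have := kern_le_Io x.
  case: (Io x) => [i|_ _|//].
    rewrite -EFinM lee_fin => hA i0.
    rewrite -EFinM poweR_EFin lee_fin ler_pdivrMl//.
    have A0 : 0 <= d%:R `^ q * i by rewrite mulr_ge0// powR_ge0.
    apply: (le_trans (H x _ Dx A0 hA)).
    have vi : 0 <= v^-1 * i by rewrite mulr_ge0// invr_ge0 ltW.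
    have -> : c0 * s' * (v^-1 * i) `^ (p / q) = (d%:R `^ p * (v * (v^-1 * i)) `^ (p / q)) * s'.
      by rewrite powRM// ?ltW//= /c0; ring.
    rewrite mulrA divff ?gt_eqF// mul1r powRM ?powR_ge0// -powRrM.
    rewrite mulrCA divff ?gt_eqF// mulr1.
    by rewrite ler_wpM2l// mulr_ge0// powR_ge0.
  by rewrite gt0_muley ?lte_fin ?invr_gt0// poweRyr ?leey//; exact: lt0r_neq0.
have cE : d%:R `^ p * K * v `^ p = c0 * (K * v).
  rewrite /c0 conj_exp_div//.
  have -> : v `^ p = v `^ (p - 1) * v.
    rewrite -[X in _ = _ * X](powRr1 (ltW v0)) -powRD ?subrK//.
    by rewrite (gt_eqF v0) implybT.
  by ring.
have c2 : 0 < c0 * (K * v) by apply: mulr_gt0 => //; exact: mulr_gt0.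
rewrite cE; apply/lee_addgt0Pr => e e0.
have e1 : 0 < e / (c0 * (K * v)) by rewrite divr_gt0.
apply: le_trans (key (s + e / (c0 * (K * v))) _ _) _.
- by rewrite lerDl ltW.
- exact: ltr_pwDr.
- rewrite -EFinD lee_fin (_ : c0 * _ * _ = c0 * (K * v) * s + e)//.
  by field; rewrite !gt_eqF.
Qed.

Definition wgt (e : 'cV[C]_d) x : R := fnorm (mpow (W x) p^-1 *m e) `^ p.

Lemma measurable_wgt0 (e : 'cV[C]_d) s :
  measurable_fun setT (fun x => fnorm (mpow (W x) s *m e)).
Proof.
by apply: measurable_fnorm; apply: mxmeasM; [exact: mP|exact: mxmeas_cst].
Qed.

Lemma measurable_wgt e : measurable_fun setT (wgt e).
Proof. exact: measurableT_comp (measurable_powR _) (measurable_wgt0 _ _). Qed.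

Lemma wgt_ge0 e x : 0 <= wgt e x. Proof. exact: powR_ge0. Qed.

Lemma mpow_split x y (e : 'cV[C]_d) :
  fnorm (mpow (W x) p^-1 *m e) <= kern x y * fnorm (mpow (W y) p^-1 *m e).
Proof.
have -> : mpow (W x) p^-1 *m e = mpow (W x) p^-1 *m mpow (W y) (- p^-1)
    *m (mpow (W y) p^-1 *m e).
  rewrite mulmxA -[_ *m mpow (W y) (- p^-1) *m _]mulmxA.
  by have := mpowN (pW y) (- p^-1); rewrite opprK => ->; rewrite mulmx1.
exact: fnormM.
Qed.

(** Averaging [mpow_split] over y in E and applying Hoelder's inequality gives |E| |W(x)^(1/p) e| <=
    A^(1/q) s^(1/p). Its p-th power has the form that [Ap_mean_le] accepts. *)
Lemma Ap_wgt_le (E : set T) e (s : R) : measurable E -> E `<=` D ->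
  (\int[mu]_(x in E) (wgt e x)%:E <= s%:E)%E -> 0 <= s ->
  ((fine (mu E) `^ p)%:E * \int[mu]_(x in D) (wgt e x)%:E <=
    (d%:R `^ p * K * v `^ p * s)%:E)%E.
Proof.
move=> mE ED hs s0; set a := fine (mu E).
have a0 : 0 <= a by rewrite fine_ge0.
have fE : mu E \is a fin_num.
  rewrite ge0_fin_numE//; apply: (@le_lt_trans _ _ (mu D)).
    by apply: le_measure; rewrite ?inE.
  by rewrite muD ltry.
rewrite -ge0_integralZ_EFin//; last 3 first.
- exact: measurable_wgt.
- exact: wgt_ge0.
- exact: powR_ge0.
apply: Ap_mean_le => //.
- by apply: measurable_funM => //; exact: measurable_wgt.
- by move=> x; rewrite mulr_ge0// ?powR_ge0// wgt_ge0.
move=> x A Dx A0 hA.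
have hA' : (\int[mu]_(y in E) (kern x y `^ q)%:E <= A%:E)%E.
  apply: le_trans hA; apply: ge0_subset_integral => //.
    by apply/measurable_EFinP; exact: measurable_funTS.
  by move=> y _; rewrite lee_fin powR_ge0.
have hoel := hoelder_le mE (measurable_kern x) (measurable_wgt0 e p^-1)
  (fun y => fnorm_ge0 _) (fun y => fnorm_ge0 _) q0 p0
  (etrans (addrC _ _) (conj_expV p1)) A0 s0 hA' hs.
have key : a * fnorm (mpow (W x) p^-1 *m e) <= A `^ q^-1 * s `^ p^-1.
  rewrite -lee_fin; apply: le_trans hoel.
  apply: (@le_trans _ _
      (\int[mu]_(y in E) (fnorm (mpow (W x) p^-1 *m e))%:E)%E).
    by rewrite integral_cst// EFinM /a fineK// muleC.
  by apply: le_integral_lower => [y|y _]; rewrite lee_fin//; exact: mpow_split.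
rewrite /wgt -powRM//.
have -> : A `^ (p / q) * s = (A `^ q^-1 * s `^ p^-1) `^ p.
  rewrite powRM ?powR_ge0// -!powRrM mulVf ?gt_eqF// powRr1//.
  by rewrite [_ * p]mulrC.
apply: ge0_ler_powR key; rewrite ?nnegrE ?mulr_ge0 ?powR_ge0//; exact: ltW.
Qed.

(** The complement of F in D has measure at least v/2, so by [Ap_wgt_le] it carries at least the
    fraction 1 / (2^p d^p K) of the weight of D. *)
Lemma Ap_wgt_small (F : set T) e : measurable F -> F `<=` D ->
  (\int[mu]_(x in D) (wgt e x)%:E < +oo)%E -> (mu F <= (v / 2)%:E)%E ->
  (\int[mu]_(x in F) (wgt e x)%:E <=
    (1 - (2 `^ p * d%:R `^ p * K)^-1)%:E * \int[mu]_(x in D) (wgt e x)%:E)%E.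
Proof.
move=> mF FD wfin hF.
have mE : measurable (D `\` F) by exact: measurableD.
have ED : D `\` F `<=` D by move=> x [].
have mw S : measurable_fun S (EFin \o wgt e).
  by apply/measurable_EFinP; apply: measurable_funTS; exact: measurable_wgt.
have sub S : measurable S -> S `<=` D ->
    (\int[mu]_(x in S) (wgt e x)%:E)%E \is a fin_num.
  move=> mS SD; rewrite ge0_fin_numE; last first.
    by apply: integral_ge0 => x _; rewrite lee_fin wgt_ge0.
  apply: le_lt_trans wfin; apply: ge0_subset_integral => //.
  by move=> x _; rewrite lee_fin wgt_ge0.
have := Ap_wgt_le mE ED (e := e) (s := fine (\int[mu]_(x in D `\` F) (wgt e x)%:E)).
rewrite fineK ?sub// => /(_ (lexx _)).
have split_ : (\int[mu]_(x in D) (wgt e x)%:E =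
   \int[mu]_(x in F) (wgt e x)%:E + \int[mu]_(x in D `\` F) (wgt e x)%:E)%E.
  rewrite -ge0_integral_setU//.
  - by rewrite setDUK.
  - by move=> x _; rewrite lee_fin wgt_ge0.
  - by apply/disj_setPS => x [Fx [_]].
have fD := sub D mD (@subset_refl _ D).
have fF := sub F mF FD; have fE := sub _ mE ED.
move: split_; rewrite -(fineK fD) -(fineK fF) -(fineK fE) -EFinD => -[].
set wD := fine (\int[mu]_(x in D) _); set wF := fine (\int[mu]_(x in F) _).
set wE := fine (\int[mu]_(x in D `\` F) _) => split_ h.
have wE0 : 0 <= wE by rewrite fine_ge0// integral_ge0// => x _; rewrite lee_fin wgt_ge0.
have wD0 : 0 <= wD by rewrite fine_ge0// integral_ge0// => x _; rewrite lee_fin wgt_ge0.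
have {h} := h wE0; rewrite -!EFinM !lee_fin => h.
have aE : v / 2 <= fine (mu (D `\` F)).
  have -> : mu (D `\` F) = (mu D - mu F)%E.
    have DF : D `&` F = F by rewrite setIidr.
    by rewrite -[in RHS]DF; apply: measureD => //; change (mu D < +oo)%E; rewrite muD ltry.
  have fmF : mu F \is a fin_num by rewrite ge0_fin_numE// (le_lt_trans hF) ?ltry.
  move: hF; rewrite muD -(fineK fmF) -EFinB !lee_fin/=; lra.
have v2 : 0 <= v / 2 by rewrite divr_ge0// ltW.
have h2 : (v / 2) `^ p <= fine (mu (D `\` F)) `^ p.
  by apply: ge0_ler_powR aE; rewrite ?nnegrE ?fine_ge0//; exact: ltW.
have {}h : (v / 2) `^ p * wD <= d%:R `^ p * K * v `^ p * wE.
  by apply: le_trans h; rewrite ler_wpM2r.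
have vp : 0 < v `^ p by exact: powR_gt0.
have tp : 0 < 2 `^ p :> R by exact: powR_gt0.
have dp : 0 < d%:R `^ p :> R by rewrite powR_gt0// ltr0n.
have {}h : (2 `^ p * d%:R `^ p * K)^-1 * wD <= wE.
  rewrite ler_pdivrMl ?mulr_gt0//.
  have c0 : 0 < v `^ p * (2 `^ p)^-1 by rewrite mulr_gt0 ?invr_gt0.
  have vE : (v / 2) `^ p = v `^ p * (2 `^ p)^-1.
    by rewrite powRM ?invr_ge0 ?(ltW v0)// -[2^-1]powR_inv1// -powRrM mulN1r powRN.
  rewrite -(ler_pM2l c0) -vE; apply: (le_trans h); rewrite vE le_eqVlt.
  by apply/orP; left; apply/eqP; field; rewrite gt_eqF.
rewrite mulrBl mul1r; lra.
Qed.

End Ap_estimates.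

(** * The dual estimate: averages of |W^(-1/p) M e|^q for a reducing operator M *)

Section Ap_dual.
Context dT (T : measurableType dT) (R : realType) (mu : {measure set T -> \bar R}).
Local Notation C := R[i].
Variables (d : nat) (W : T -> 'M[C]_d) (p K v : R) (D : set T).
Let q := conj_exp p.
Hypotheses (d0 : (0 < d)%N) (p1 : 1 < p) (K0 : 0 < K) (v0 : 0 < v).
Hypotheses (mD : measurable D) (muD : mu D = v%:E).
Hypotheses (mW : mxmeas W) (pW : forall x, posdefmx (W x)).
Hypothesis Ap : (\int[mu]_(x in D) poweR (v^-1%:E *
  \int[mu]_(y in D) (opnorm (mpow (W x) p^-1 *m mpow (W y) (- p^-1)) `^ q)%:E)
    (p / q) <= (K * v)%:E)%E.
Variable M : 'M[C]_d.
Hypothesis hM : M^t* = M.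
Hypothesis redM : forall (phi : 'cV[C]_d) s, 0 <= s ->
  (\int[mu]_(x in D) (wgt W p phi x)%:E <= (s * v)%:E)%E ->
  fnorm (M *m phi) <= Num.sqrt d%:R * s `^ p^-1.

Let p0 : 0 < p := exp_gt0 p1.
Let q0 : 0 < q := conj_exp_gt0 p1.
Let pq0 : 0 < p / q. Proof. exact: divr_gt0. Qed.
Let q1 : q - 1 = q / p.
Proof.
have h1 : p - 1 != 0 by rewrite subr_eq0 gt_eqF.
have h2 : p != 0 by rewrite gt_eqF.
by rewrite /q /conj_exp; field; rewrite h1 h2.
Qed.
Let q1_gt0 : 0 < q - 1. Proof. by rewrite q1 divr_gt0. Qed.

Local Notation kern := (kern W p).

(** If the inner integral were infinite at every x in D, the left side of [Ap] would be infinite.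
    One good point x suffices below: |W(y)^(-1/p)| is at most a constant times [kern x y], which
    makes all functions of y that occur integrable. *)
Lemma Ap_finite : exists2 x, D x & exists2 A, 0 <= A &
  (\int[mu]_(y in D) (kern x y `^ q)%:E <= A%:E)%E.
Proof.
apply: contrapT => H.
have Hoo x : D x -> (\int[mu]_(y in D)
    (opnorm (mpow (W x) p^-1 *m mpow (W y) (- p^-1)) `^ q)%:E = +oo)%E.
  move=> Dx; have := kern_le_Io mu d0 p1 mD mW pW x.
  have : (0 <= \int[mu]_(y in D)
      (opnorm (mpow (W x) p^-1 *m mpow (W y) (- p^-1)) `^ q)%:E)%E.
    by apply: integral_ge0 => y _; rewrite lee_fin powR_ge0.
  rewrite -/q; case: (\int[mu]_(y in D) (opnorm _ `^ _)%:E)%E => [i|//|//].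
  rewrite lee_fin => i0; rewrite -EFinM => hi.
  exfalso; apply: H; exists x => //; exists (d%:R `^ q * i) => //.
  by rewrite mulr_ge0// powR_ge0.
have : (((K + 1) * v)%:E <= (K * v)%:E)%E.
  apply: le_trans Ap; rewrite EFinM -muD -integral_cst//.
  apply: le_integral_lower => [x|x Dx]; first by rewrite lee_fin addr_ge0// ltW.
  rewrite Hoo// gt0_muley ?lte_fin ?invr_gt0// poweRyr ?leey//.
  exact: lt0r_neq0.
by rewrite lee_fin ler_pM2r// gerDl ler10.
Qed.

Section test_vector.
Variable e : 'cV[C]_d.
Hypothesis e1 : fnorm e <= 1.

Let f0 : 'cV[C]_d := M *m e.
Let Wn y := mpow (W y) (- p^-1).
Let h y : R := fnorm (Wn y *m f0).
(* Chosen so that the inner product of f0 with Wn y *m g y is h y `^ q. *)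
Let g y : 'cV[C]_d := (h y `^ (q - 2))%:C *: (Wn y *m f0).
Let G y : 'cV[C]_d := Wn y *m g y.

Let h0 y : 0 <= h y. Proof. exact: fnorm_ge0. Qed.

Let mWn : mxmeas Wn. Proof. exact: mxmeas_mpow. Qed.

Let mh : measurable_fun setT h.
Proof. by apply: measurable_fnorm; apply: mxmeasM => //; exact: mxmeas_cst. Qed.

Let mhp r : measurable_fun setT (fun y => h y `^ r).
Proof. exact: measurableT_comp (measurable_powR _) mh. Qed.

Let mg : mxmeas g.
Proof. by apply: mxmeasZ => //; apply: mxmeasM => //; exact: mxmeas_cst. Qed.

Let mG : mxmeas G. Proof. exact: mxmeasM. Qed.

Let fnorm_g y : fnorm (g y) = h y `^ (q - 1).
Proof.
rewrite /g fnormZ normc_real ger0_norm ?powR_ge0// -/(h y).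
rewrite -[X in _ * X]powRr1// -powRD; first by congr (_ `^ _); ring.
by rewrite (_ : q - 2 + 1 = q - 1); [rewrite gt_eqF|ring].
Qed.

Let Wn_kern x y : fnorm (Wn y) <= fnorm (Wn x) * kern x y.
Proof.
rewrite (_ : Wn y = Wn x *m (mpow (W x) p^-1 *m Wn y)); first exact: fnormM.
have := mpowN (pW x) (- p^-1); rewrite opprK mulmxA => ->.
by rewrite mul1mx.
Qed.

Let h_kern x y : h y <= fnorm (Wn x) * fnorm f0 * kern x y.
Proof.
apply: (le_trans (fnormM _ _)); rewrite mulrAC ler_wpM2r//; exact: Wn_kern.
Qed.

Let mkern x r : measurable_fun setT (fun y => kern x y `^ r).
Proof. exact: measurableT_comp (measurable_powR _) (measurable_kern _ mW pW x). Qed.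

Let int_h_fin : (\int[mu]_(y in D) (h y `^ q)%:E < +oo)%E.
Proof.
have [x Dx [A A0 hA]] := Ap_finite.
pose a := fnorm (Wn x) * fnorm f0; have a0 : 0 <= a by rewrite mulr_ge0.
apply: (@le_lt_trans _ _ (\int[mu]_(y in D) (a `^ q * kern x y `^ q)%:E)%E).
  apply: le_integral_lower => [y|y _]; rewrite lee_fin ?powR_ge0//.
  rewrite -powRM//; last exact: kern_ge0.
  apply: (ge0_ler_powR (ltW q0)) (h_kern x y); rewrite nnegrE//.
  by rewrite mulr_ge0// kern_ge0.
rewrite ge0_integralZ_EFin//; last 2 first.
- by move=> y; exact: powR_ge0.
- exact: powR_ge0.
apply: lte_mul_pinfty; [by rewrite lee_fin powR_ge0|by []|].
exact: (le_lt_trans hA (ltry _)).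
Qed.

Let iG : mxintegrable mu D G.
Proof.
split => //; have [x Dx [A A0 hA]] := Ap_finite.
pose a := fnorm (Wn x) * fnorm f0; have a0 : 0 <= a by rewrite mulr_ge0.
pose b := fnorm (Wn x) * a `^ (q - 1).
have b0 : 0 <= b by rewrite mulr_ge0// powR_ge0.
apply: (@le_lt_trans _ _ (\int[mu]_(y in D) (b * kern x y `^ q)%:E)%E).
  apply: le_integral_lower => [y|y _]; rewrite lee_fin//.
  apply: (le_trans (fnormM _ _)); rewrite fnorm_g.
  apply: (@le_trans _ _ ((fnorm (Wn x) * kern x y) * (a * kern x y) `^ (q - 1))).
    apply: ler_pM; [exact: fnorm_ge0|exact: powR_ge0|exact: Wn_kern|].
    apply: (ge0_ler_powR (ltW q1_gt0)) (h_kern x y); rewrite nnegrE//.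
    by rewrite mulr_ge0// kern_ge0.
  rewrite powRM//; last exact: kern_ge0.
  have kE : kern x y `^ q = kern x y * kern x y `^ (q - 1).
    rewrite -[X in _ = X * _]powRr1 ?kern_ge0// -powRD; first by congr (_ `^ _); ring.
    by rewrite (_ : 1 + (q - 1) = q); [rewrite gt_eqF|ring].
  by rewrite kE /b le_eqVlt; apply/orP; left; apply/eqP; ring.
rewrite ge0_integralZ_EFin//; last by move=> y; exact: powR_ge0.
apply: lte_mul_pinfty; [by rewrite lee_fin|by []|].
exact: (le_lt_trans hA (ltry _)).
Qed.

Let N := fine (\int[mu]_(y in D) (h y `^ q)%:E)%E.

Let N0 : 0 <= N.
Proof. by rewrite fine_ge0// integral_ge0// => y _; rewrite lee_fin powR_ge0. Qed.

Let NE : (\int[mu]_(y in D) (h y `^ q)%:E = N%:E)%E.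
Proof.
rewrite /N fineK// ge0_fin_numE//.
by apply: integral_ge0 => y _; rewrite lee_fin powR_ge0.
Qed.

Let phi : 'cV[C]_d := mxint mu D G.

(** Hoelder's inequality in y bounds |W(x)^(1/p) phi| by the L^q norm of [kern x] times the L^p norm
    of |g|, and |g|^p = h^q because (q - 1) p = q. *)
Let wgt_phi : (\int[mu]_(x in D) (wgt W p phi x)%:E <=
  (d%:R `^ p * K * v `^ p * N)%:E)%E.
Proof.
apply: (Ap_mean_le d0 p1 K0 v0 mD mW pW Ap) => //.
- exact: measurable_wgt.
- exact: wgt_ge0.
move=> x A Dx A0 hA.
have key : fnorm (mpow (W x) p^-1 *m phi) <= A `^ q^-1 * N `^ p^-1.
  rewrite -lee_fin -mxint_mull//.
  have iPG : mxintegrable mu D (fun y => mpow (W x) p^-1 *m G y).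
    have := mxintegrableM mD (mpow (W x) p^-1) 1%:M iG.
    by congr mxintegrable; apply/funext => y; rewrite mulmx1.
  apply: (le_trans (fnorm_mxint mD iPG)).
  have hN : (\int[mu]_(y in D) ((h y `^ (q - 1)) `^ p)%:E <= N%:E)%E.
    rewrite -NE; apply: le_integral_lower => [y|y _]; rewrite lee_fin ?powR_ge0//.
    by rewrite -powRrM q1 divfK ?gt_eqF.
  have := hoelder_le mD (measurable_kern _ mW pW x) (mhp (q - 1))
    (fun y => fnorm_ge0 _) (fun y => powR_ge0 _ _) q0 p0
    (etrans (addrC _ _) (conj_expV p1)) A0 N0 hA hN.
  apply: le_trans; apply: le_integral_lower => [y|y _]; rewrite lee_fin//.
  by rewrite mulmxA -fnorm_g; exact: fnormM.
rewrite /wgt.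
have -> : A `^ (p / q) * N = (A `^ q^-1 * N `^ p^-1) `^ p.
  rewrite powRM ?powR_ge0// -!powRrM mulVf ?gt_eqF// powRr1//.
  by rewrite [_ * p]mulrC.
apply: (ge0_ler_powR (ltW p0)) key; rewrite nnegrE//.
by rewrite mulr_ge0// powR_ge0.
Qed.

Let N_phi : N <= fnorm (M *m phi).
Proof.
have E : (f0^t* *m phi) 0 0 = N%:C.
  rewrite -mxint_mull// mxE; apply/eqP; rewrite eq_complex /=.
  have pt y : (f0^t* *m G y) 0 0 = (h y `^ q)%:C.
    rewrite /G /g.
    have -> : f0^t* *m (Wn y *m ((h y `^ (q - 2))%:C *: (Wn y *m f0))) =
        (h y `^ (q - 2))%:C *: ((Wn y *m f0)^t* *m (Wn y *m f0)).
      have Wnh : (Wn y)^t* = Wn y by exact: mpow_herm.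
      have E2 : (Wn y *m f0)^t* = f0^t* *m Wn y.
        by rewrite [in LHS]trmx_mul map_mxM/= Wnh; reflexivity.
      by rewrite E2 -!scalemxAr !mulmxA; reflexivity.
    rewrite mxE ctr_mul_self -rmorphM/= -/(h y); congr (_ %:C).
    rewrite -powR_mulrn// -powRD; first by congr (_ `^ _); ring.
    by rewrite (_ : q - 2 + 2%:R = q); [rewrite gt_eqF|ring].
  apply/andP; split; apply/eqP.
    under eq_Rintegral do rewrite pt/=.
    by rewrite /Rintegral.
  under eq_Rintegral do rewrite pt/=.
  by rewrite Rintegral_cst// mul0r.
have : normc ((f0^t* *m phi) 0 0) <= fnorm (M *m phi).
  apply: (le_trans (normc_le_fnorm _ _ _)).
  rewrite /f0 trmx_mul map_mxM/= hM -mulmxA.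
  apply: (le_trans (fnormM _ _)).
  by rewrite fnormC ler_piMl.
by rewrite E normc_real ger0_norm.
Qed.

(** The chain N <= |M phi| <= C v^(1/q) N^(1/p) is divided by N^(1/p), which is legitimate as N is
    finite by [int_h_fin] and may be taken positive. *)
Lemma Ap_dual_vec : (\int[mu]_(y in D) (fnorm (mpow (W y) (- p^-1) *m (M *m e)) `^ q)%:E
  <= ((Num.sqrt d%:R * d%:R * K `^ p^-1) `^ q * v)%:E)%E.
Proof.
rewrite -/(Wn _) NE lee_fin.
have [N00|N00] := eqVneq N 0.
  by rewrite N00 mulr_ge0 ?powR_ge0// ltW.
have Npos : 0 < N by rewrite lt0r N00.
(* s v is the bound of [wgt_phi], in the averaged form that [redM] expects. *)
pose s := d%:R `^ p * K * v `^ (p - 1) * N.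
have s0 : 0 <= s by rewrite !mulr_ge0// ?powR_ge0// ltW.
have sv : s * v = d%:R `^ p * K * v `^ p * N.
  have -> : v `^ p = v `^ (p - 1) * v.
    rewrite -[X in _ = _ * X](powRr1 (ltW v0)) -powRD ?subrK//.
    by rewrite (gt_eqF v0) implybT.
  by rewrite /s; ring.
have := redM s0; rewrite sv => /(_ _ wgt_phi) /(le_trans N_phi).
have sE : s `^ p^-1 = d%:R * K `^ p^-1 * v `^ q^-1 * N `^ p^-1.
  rewrite /s !powRM ?powR_ge0 ?mulr_ge0 ?powR_ge0// ?(ltW K0)//.
  rewrite -!powRrM divff ?gt_eqF// powRr1//.
  suff -> : (p - 1) / p = q^-1 by [].
  by rewrite -(conj_exp_div p1) mulrAC divff ?mul1r// gt_eqF.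
rewrite sE => hN.
pose c := Num.sqrt d%:R * d%:R * K `^ p^-1.
have c0 : 0 <= c by rewrite !mulr_ge0// ?sqrtr_ge0 ?powR_ge0.
have NN : N = N `^ q^-1 * N `^ p^-1.
  rewrite -powRD; first by rewrite addrC (conj_expV p1) powRr1.
  by rewrite N00 implybT.
have Np : 0 < N `^ p^-1 by exact: powR_gt0.
have {}hN : N `^ q^-1 <= c * v `^ q^-1.
  rewrite -(ler_pM2r Np) -NN; apply: (le_trans hN).
  by rewrite /c le_eqVlt; apply/orP; left; apply/eqP; ring.
have := ge0_ler_powR (ltW q0) _ _ hN; rewrite !nnegrE.
rewrite powRM ?powR_ge0// -!powRrM !mulVf ?gt_eqF// !powRr1// ?(ltW v0)//.
by apply; rewrite ?powR_ge0// mulr_ge0// powR_ge0.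
Qed.

End test_vector.

End Ap_dual.

(** * Inequalities for powers of sums *)

Section power_inequalities.
Context {R : realType}.

Lemma le_powRD (p eta : R) : 0 < p -> 0 < eta ->
  exists2 K, 1 <= K & forall a b, 0 <= a -> 0 <= b ->
    (a + b) `^ p <= K * a `^ p + (1 + eta) * b `^ p.
Proof.
move=> p0 e0.
(* Chosen so that (1 + de)^p = 1 + eta. If a <= de b, the sum is at most (1 + de) b; otherwise b < a
   / de and it is at most (1 + 1/de) a. *)
pose de := (1 + eta) `^ p^-1 - 1.
have e1 : 1 < 1 + eta by rewrite ltrDl.
have de0 : 0 < de.
  rewrite subr_gt0 -[X in X < _](_ : 1 `^ p^-1 = 1); last by rewrite powR1.
  by apply: gt0_ltr_powR; rewrite ?nnegrE ?invr_gt0// ltW// (lt_trans _ e1).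
have deE : (1 + de) `^ p = 1 + eta.
  rewrite /de addrC subrK -powRrM mulVf ?gt_eqF// powRr1//.
  by rewrite ltW// (lt_trans _ e1).
have K1 : 1 <= (1 + de^-1) `^ p.
  rewrite -[leLHS](_ : 1 `^ p = 1); last by rewrite powR1.
  apply: (ge0_ler_powR (ltW p0)); rewrite ?nnegrE//.
    by rewrite addr_ge0// invr_ge0 ltW.
  by rewrite lerDl invr_ge0 ltW.
exists ((1 + de^-1) `^ p) => // a b a0 b0.
have K0 : 0 <= (1 + de^-1) `^ p by apply: le_trans K1.
have [ab|ab] := leP a (de * b).
  apply: (@le_trans _ _ ((1 + de) `^ p * b `^ p)).
    rewrite -powRM//; last by rewrite addr_ge0// ltW.
    apply: (ge0_ler_powR (ltW p0)); rewrite ?nnegrE ?addr_ge0//.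
      by rewrite mulr_ge0// addr_ge0// ltW.
    by rewrite mulrDl mul1r addrC lerD2l.
  by rewrite deE lerDr mulr_ge0// powR_ge0.
apply: (@le_trans _ _ ((1 + de^-1) `^ p * a `^ p)).
  rewrite -powRM//; last by rewrite addr_ge0// invr_ge0 ltW.
  apply: (ge0_ler_powR (ltW p0)); rewrite ?nnegrE ?addr_ge0//.
    by rewrite mulr_ge0// addr_ge0// invr_ge0 ltW.
  by rewrite mulrDl mul1r lerD2l ler_pdivlMl// ltW.
by rewrite lerDl mulr_ge0 ?powR_ge0// addr_ge0// ltW.
Qed.

(** The sum is at most d times its largest term. *)
Lemma powR_sum_le (d : nat) (a : 'I_d -> R) (p : R) : (0 < d)%N -> 0 < p ->
  (forall j, 0 <= a j) ->
  (\sum_j a j) `^ p <= d%:R `^ p * \sum_j a j `^ p.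
Proof.
move=> d0 p0 a0; have [j0 _ jmax] := arg_maxP a (erefl true : xpredT (Ordinal d0)).
apply: (@le_trans _ _ ((d%:R * a j0) `^ p)).
  apply: (ge0_ler_powR (ltW p0)); rewrite ?nnegrE ?mulr_ge0 ?sumr_ge0//.
  rewrite mulr_natl -[d in leRHS]card_ord -sumr_const.
  by apply: ler_sum => j _; exact: jmax.
rewrite powRM// ler_wpM2l ?powR_ge0//.
by rewrite (bigD1 j0)//= lerDl sumr_ge0// => j _; exact: powR_ge0.
Qed.

End power_inequalities.

(** * The absorption step for real functions *)

Section absorption_integrals.
Context dT (T : measurableType dT) (R : realType) (mu : {measure set T -> \bar R}).
Variables (h a w tr : T -> R) (Ke c c1 : R).
Hypotheses (mh : measurable_fun setT h) (ma : measurable_fun setT a)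
  (mw : measurable_fun setT w) (mtr : measurable_fun setT tr).
Hypotheses (h0 : forall x, 0 <= h x) (a0 : forall x, 0 <= a x)
  (w0 : forall x, 0 <= w x) (tr0 : forall x, 0 <= tr x).
Hypotheses (Ke0 : 0 <= Ke) (c0 : 0 <= c) (c10 : 0 <= c1).

Lemma integral_lin (S : set T) (r s : R) (f g : T -> R) : measurable S ->
  measurable_fun setT f -> measurable_fun setT g ->
  (forall x, 0 <= f x) -> (forall x, 0 <= g x) -> 0 <= r -> 0 <= s ->
  (\int[mu]_(x in S) (r * f x + s * g x)%:E =
   r%:E * \int[mu]_(x in S) (f x)%:E + s%:E * \int[mu]_(x in S) (g x)%:E)%E.
Proof.
move=> mS mf mg f0 g0 r0 s0; rewrite ge0_integralD_EFin//; last 4 first.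
- exact: measurable_funM.
- exact: measurable_funM.
- by move=> x; rewrite mulr_ge0.
- by move=> x; rewrite mulr_ge0.
by rewrite !ge0_integralZ_EFin.
Qed.

(** Here h is the p-th power of the oscillation on the large rectangle, tr that on the stopping
    rectangle S, a that of the majorant of their difference, and c the constant about to be
    improved. *)
Lemma absorb_child (S : set T) : measurable S ->
  (forall x, h x <= Ke * a x + c1 * tr x) ->
  (\int[mu]_(x in S) (tr x)%:E <= c%:E * \int[mu]_(x in S) (w x)%:E)%E ->
  (\int[mu]_(x in S) (h x)%:E <=
   \int[mu]_(x in S) (Ke * a x + (c1 * c) * w x)%:E)%E.
Proof.
move=> mS hle trw; apply: (@le_trans _ _
    (\int[mu]_(x in S) (Ke * a x + c1 * tr x)%:E)%E).
  by apply: le_integral_lower => [x|x _]; rewrite lee_fin.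
rewrite !integral_lin ?mulr_ge0//; apply: leeD2l.
by rewrite EFinM -muleA lee_wpmul2l ?lee_fin.
Qed.

(** The integrals of a over F and its complement recombine to one over Q, while w is integrated over
    F only: this is where the factor g enters in front of c. *)
Lemma absorb_total (Q F : set T) (A g : R) :
  measurable Q -> measurable F -> F `<=` Q -> 0 <= A -> 0 <= g ->
  (\int[mu]_(x in Q) (w x)%:E)%E \is a fin_num ->
  (\int[mu]_(x in F) (h x)%:E <=
   \int[mu]_(x in F) (Ke * a x + (c1 * c) * w x)%:E)%E ->
  (\int[mu]_(x in Q `\` F) (h x)%:E <= \int[mu]_(x in Q `\` F) (Ke * a x)%:E)%E ->
  (\int[mu]_(x in F) (w x)%:E <= g%:E * \int[mu]_(x in Q) (w x)%:E)%E ->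
  (\int[mu]_(x in Q) (a x)%:E <= A%:E * \int[mu]_(x in Q) (w x)%:E)%E ->
  (\int[mu]_(x in Q) (h x)%:E <=
    (Ke * A + c1 * c * g)%:E * \int[mu]_(x in Q) (w x)%:E)%E.
Proof.
move=> mQ mF FQ A0 g0 wfin onF offF small maj.
have splitQ (f : T -> R) : measurable_fun setT f -> (forall x, 0 <= f x) ->
    (\int[mu]_(x in Q) (f x)%:E = \int[mu]_(x in F) (f x)%:E +
      \int[mu]_(x in Q `\` F) (f x)%:E)%E.
  move=> mf f0; rewrite -ge0_integral_setU//.
  - by rewrite setDUK.
  - exact: measurableD.
  - by apply/measurable_EFinP; exact: measurable_funTS.
  - by move=> x _; rewrite lee_fin.
  - by apply/disj_setPS => x [Fx [_]].
rewrite splitQ//; apply: (le_trans (leeD onF offF)).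
have mQF : measurable (Q `\` F) by exact: measurableD.
rewrite integral_lin ?mulr_ge0// ge0_integralZ_EFin// addeAC.
rewrite -muleDr ?ge0_adde_def ?inE ?integral_ge0//; last 2 first.
- by move=> x _; rewrite lee_fin.
- by move=> x _; rewrite lee_fin.
rewrite -splitQ//.
apply: (@le_trans _ _ (Ke%:E * (A%:E * \int[mu]_(x in Q) (w x)%:E) +
   (c1 * c)%:E * (g%:E * \int[mu]_(x in Q) (w x)%:E))%E).
  by apply: leeD; apply: lee_wpmul2l; rewrite ?lee_fin ?mulr_ge0.
rewrite -(fineK wfin) -!EFinM -EFinD lee_fin.
by rewrite le_eqVlt; apply/orP; left; apply/eqP; ring.
Qed.

End absorption_integrals.

(** * Iterated absorption on the stopping rectangles *)

Section absorption.
Context {R : realType} {n m d : nat}.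
Local Notation C := R[i].
Local Notation T := (Rn R n * Rn R m)%type.
Local Notation mu := (@leb2 R n m).
Local Notation cell := (@cell R n m).
Variables (p K t : R) (U V B : T -> 'M[C]_d) (redU redV : cell -> 'M[C]_d).
Hypotheses (d0 : (0 < d)%N) (p1 : 1 < p) (K1 : 1 <= K) (t0 : 0 < t).
Hypotheses (mU : mxmeas U) (pU : forall x, posdefmx (U x)).
Hypotheses (mV : mxmeas V) (pV : forall x, posdefmx (V x)).
Hypotheses (iB : forall Q, good Q -> mxintegrable mu (hbox Q) B).
Hypothesis ApU : forall Q, good Q ->
  (\int[mu]_(x in hbox Q) poweR ((vol Q)^-1%:E * \int[mu]_(y in hbox Q)
     (opnorm (mpow (U x) p^-1 *m mpow (U y) (- p^-1)) `^ conj_exp p)%:E)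
    (p / conj_exp p) <= (K * vol Q)%:E)%E.
Hypotheses (uU : forall Q, good Q -> redU Q \in unitmx)
           (uV : forall Q, good Q -> redV Q \in unitmx).
Hypothesis loU : forall Q e, good Q ->
  (\int[mu]_(x in hbox Q) (wgt U p e x)%:E <= (fnorm (redU Q *m e) `^ p * vol Q)%:E)%E.
Hypothesis hiU : forall Q e s, good Q -> 0 <= s ->
  (\int[mu]_(x in hbox Q) (wgt U p e x)%:E <= (s * vol Q)%:E)%E ->
  fnorm (redU Q *m e) <= Num.sqrt d%:R * s `^ p^-1.
Hypothesis loV : forall Q e, good Q ->
  (\int[mu]_(x in hbox Q) (wgt V p e x)%:E <= (fnorm (redV Q *m e) `^ p * vol Q)%:E)%E.

Definition bmean Q : 'M[C]_d := ((vol Q)^-1)%:C *: mxint mu (hbox Q) B.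

Definition osc Q x : R :=
  fnorm (redV Q *m (B x - bmean Q) *m invmx (redU Q)).

Hypothesis bmoB : forall Q, good Q ->
  (\int[mu]_(x in hbox Q) (osc Q x)%:E <= (t * vol Q)%:E)%E.

Let p0 : 0 < p := exp_gt0 p1.
Let K0 : 0 < K. Proof. exact: lt_le_trans K1. Qed.

Let mB : mxmeas B.
Proof. by have [] := iB (_ : good ((fun=> 0, 1), (fun=> 0, 1))). Qed.

Lemma mxmeas_subB A : mxmeas (fun x => B x - A).
Proof. by apply: mxmeasD => //; apply: mxmeas_cst. Qed.

Lemma measurable_osc Q : measurable_fun setT (osc Q).
Proof.
apply: measurable_fnorm; apply: mxmeasM; last exact: mxmeas_cst.
by apply: mxmeasM; [exact: mxmeas_cst|exact: mxmeas_subB].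
Qed.

Lemma mxint_subB Q A : good Q ->
  mxint mu (hbox Q) (fun x => B x - A) = mxint mu (hbox Q) B - (vol Q)%:C *: A.
Proof.
move=> gQ; have mQ := measurable_hbox Q; have iBQ := iB gQ.
have icst (c : R) : mu.-integrable (hbox Q) (EFin \o cst c).
  apply/integrableP; split; first by apply/measurable_EFinP; exact: measurable_cst.
  under eq_integral do rewrite /=.
  by rewrite integral_cst// mu_hbox// -EFinM ltry.
apply/matrixP => i j; rewrite !mxE; apply/eqP; rewrite eq_complex; apply/andP.
split; apply/eqP.
  rewrite [RHS]raddfB/= Re_mulc/= mul0r subr0.
  under eq_Rintegral do rewrite !mxE raddfB/=.
  rewrite (RintegralB mQ (mxintegrable_Re i j iBQ) (icst _)).
  by rewrite Rintegral_cst// mu_hbox//= mulrC.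
rewrite [RHS]raddfB/= Im_mulc/= mul0r addr0.
under eq_Rintegral do rewrite !mxE raddfB/=.
rewrite (RintegralB mQ (mxintegrable_Im i j iBQ) (icst _)).
by rewrite Rintegral_cst// mu_hbox//= mulrC.
Qed.

Lemma mxintegrable_subB Q A : good Q -> mxintegrable mu (hbox Q) (fun x => B x - A).
Proof.
move=> gQ; have mQ := measurable_hbox Q; have iBQ := iB gQ.
split; first exact: mxmeas_subB.
apply: (@le_lt_trans _ _ (\int[mu]_(x in hbox Q) (fnorm (B x) + fnorm A)%:E)%E).
  apply: le_integral_lower => [x|x _]; rewrite lee_fin//.
  by apply: (le_trans (fnormD _ _)); rewrite fnormN.
rewrite ge0_integralD_EFin//; last exact: measurable_fnorm.
rewrite lte_add_pinfty//; first exact: iBQ.2.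
by rewrite integral_cst// mu_hbox// -EFinM ltry.
Qed.

Lemma bmean_sub Q J : good J ->
  bmean J - bmean Q = ((vol J)^-1)%:C *: mxint mu (hbox J) (fun x => B x - bmean Q).
Proof.
move=> gJ; rewrite mxint_subB// scalerBr scalerA -rmorphM/= mulVf ?scale1r//.
by rewrite gt_eqF// vol_gt0.
Qed.

Section one_cell.
Variables (Q : cell) (gQ : good Q).

Let iU := invmx (redU Q).
Let D : R := 2 ^+ (n + m).
Let D1 : 1 <= D. Proof. by rewrite exprn_ege1// ler1n. Qed.

(** The integral over the child is at most that over its parent, which is not heavy; D is the ratio
    of their volumes. *)
Lemma bmean_child_le Q' b : good Q' -> ~ heavy (osc Q) t Q' ->
  fnorm (redV Q *m (bmean (child Q' b) - bmean Q) *m iU) <= 2 * t * D.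
Proof.
move=> gQ' /contrapT hQ'; set J := child Q' b; have gJ : good J by exact: good_child.
have vJ := vol_gt0 gJ; have mJ := measurable_hbox J.
rewrite bmean_sub// -scalemxAr -scalemxAl fnormZ normc_real.
rewrite ger0_norm ?invr_ge0 ?(ltW vJ)// ler_pdivrMl//.
have iBJ := mxintegrable_subB (bmean Q) gJ.
rewrite -mxint_mul// -lee_fin.
apply: (le_trans (fnorm_mxint mJ (mxintegrableM mJ _ _ iBJ))).
apply: (@le_trans _ _ (\int[mu]_(x in hbox Q') (osc Q x)%:E)%E).
  apply: ge0_subset_integral => //.
  - exact: measurable_hbox.
  - by apply/measurable_EFinP; apply: measurable_funTS; exact: measurable_osc.
  - by move=> x _; rewrite lee_fin; exact: fnorm_ge0.
  - exact: hbox_child_sub.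
apply: (le_trans hQ'); rewrite lee_fin (vol_child Q' b) -/J -/D.
by rewrite le_eqVlt; apply/orP; left; apply/eqP; ring.
Qed.

Variable e : 'cV[C]_d.


Definition oscV (A : 'M[C]_d) x : R := fnorm (mpow (V x) p^-1 *m (B x - A) *m e).

(** Majorizes both the oscillation off the stopping set and the jump from the mean over Q to the
    mean over a stopping rectangle. The first would need 2t only; the second needs the factor D. *)
Definition majo x : R :=
  fnorm (mpow (V x) p^-1 *m invmx (redV Q)) * (2 * t * D * fnorm (redU Q *m e)).

Lemma majo_ge0 x : 0 <= majo x.
Proof. by rewrite !mulr_ge0// ?ltW// (lt_le_trans _ D1). Qed.

Lemma measurable_majo : measurable_fun setT majo.
Proof.
apply: measurable_funM => //; apply: measurable_fnorm.
by apply: mxmeasM; [exact: mxmeas_mpow|exact: mxmeas_cst].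
Qed.

Lemma measurable_oscV A : measurable_fun setT (oscV A).
Proof.
apply: measurable_fnorm; apply: mxmeasM; last exact: mxmeas_cst.
by apply: mxmeasM; [exact: mxmeas_mpow|exact: mxmeas_subB].
Qed.

Lemma oscV_factor (X : 'M[C]_d) x :
  fnorm (mpow (V x) p^-1 *m X *m e) <=
  fnorm (mpow (V x) p^-1 *m invmx (redV Q)) *
    (fnorm (redV Q *m X *m iU) * fnorm (redU Q *m e)).
Proof.
have -> : mpow (V x) p^-1 *m X *m e = (mpow (V x) p^-1 *m invmx (redV Q)) *m
    ((redV Q *m X *m iU) *m (redU Q *m e)).
  rewrite -!mulmxA (mulmxA iU) mulVmx ?uU// mul1mx.
  by rewrite (mulmxA (invmx (redV Q))) mulVmx ?uV// mul1mx.
apply: (le_trans (fnormM _ _)); rewrite ler_wpM2l//; exact: fnormM.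
Qed.

Lemma oscV_nonstop x : osc Q x <= 2 * t -> oscV (bmean Q) x <= majo x.
Proof.
move=> hx; apply: (le_trans (oscV_factor _ _)); rewrite ler_wpM2l// ler_wpM2r//.
by apply: (le_trans hx); rewrite ler_peMr// mulr_ge0// ltW.
Qed.

Lemma oscV_child x A : fnorm (redV Q *m (A - bmean Q) *m iU) <= 2 * t * D ->
  oscV (bmean Q) x <= majo x + oscV A x.
Proof.
move=> hA; rewrite /oscV.
have -> : mpow (V x) p^-1 *m (B x - bmean Q) *m e =
    mpow (V x) p^-1 *m (A - bmean Q) *m e + mpow (V x) p^-1 *m (B x - A) *m e.
  have E : B x - bmean Q = (A - bmean Q) + (B x - A).
    by rewrite [RHS]addrC addrA subrK.
  by rewrite -mulmxDl -mulmxDr -E.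
apply: (le_trans (fnormD _ _)); rewrite lerD2r.
apply: (le_trans (oscV_factor _ _)); rewrite ler_wpM2l// ler_wpM2r//.
Qed.

Lemma int_wgt_fin : (\int[mu]_(x in hbox Q) (wgt U p e x)%:E)%E \is a fin_num.
Proof.
rewrite ge0_fin_numE; last by apply: integral_ge0 => x _; rewrite lee_fin wgt_ge0.
by apply: (le_lt_trans (loU e gQ)); rewrite ltry.
Qed.

(** (2 D)^p is the scalar factor of [majo], d^p d comes from passing to columns, and (sqrt d)^p from
    the upper inequality for the reducing operator of U. *)
Definition majo_cst : R := (2 * D) `^ p * (d%:R `^ p * d%:R) * Num.sqrt d%:R `^ p.

Lemma majo_cst_ge0 : 0 <= majo_cst.
Proof. by rewrite !mulr_ge0// powR_ge0. Qed.

(** The average of |V^(1/p) V_Q^(-1) e_j|^p is at most |V_Q V_Q^(-1) e_j|^p = 1 by [loV], and |U_Q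
    e|^p |Q| is at most a constant times the w-measure of Q by [hiU]. *)
Lemma int_majo : (\int[mu]_(x in hbox Q) (majo x `^ p)%:E <=
  (majo_cst * t `^ p)%:E * \int[mu]_(x in hbox Q) (wgt U p e x)%:E)%E.
Proof.
have mQ := measurable_hbox Q; have vQ := vol_gt0 gQ.
pose a : R := 2 * t * D * fnorm (redU Q *m e).
have DD : 0 <= D by apply: le_trans D1.
have a0 : 0 <= a by rewrite !mulr_ge0// ltW.
have mw f : measurable_fun setT (wgt V p f) by exact: measurable_wgt.
apply: (@le_trans _ _ (\int[mu]_(x in hbox Q) ((a `^ p * d%:R `^ p) *
    \sum_(j < d) wgt V p (invmx (redV Q) *m cvec j) x)%:E)%E).
  apply: le_integral_lower => [x|x _]; rewrite lee_fin ?powR_ge0//.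
  rewrite /majo -/a mulrC powRM// -mulrA ler_wpM2l ?powR_ge0//.
  apply: le_trans; last first.
    by apply: powR_sum_le => // j; exact: fnorm_ge0.
  apply: (ge0_ler_powR (ltW p0)); rewrite ?nnegrE ?sumr_ge0//.
  apply: (le_trans (fnorm_le_sum_col _)).
  by apply: ler_sum => j _; rewrite colM.
rewrite ge0_integralZ_EFin//; last 3 first.
- exact: measurable_sum.
- by move=> x; apply: sumr_ge0 => j _; exact: wgt_ge0.
- by rewrite mulr_ge0// powR_ge0.
have hs : (\int[mu]_(x in hbox Q) (\sum_(j < d) wgt V p (invmx (redV Q) *m cvec j) x)%:E
    <= (d%:R * vol Q)%:E)%E.
  under eq_integral do rewrite -sumEFin.
  rewrite ge0_integral_sum//; last 2 first.
  - by move=> j; apply/measurable_EFinP; exact: measurable_funTS.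
  - by move=> j x _; rewrite lee_fin wgt_ge0.
  apply: (@le_trans _ _ (\sum_(j < d) (vol Q)%:E)%E); last first.
    by rewrite sumEFin lee_fin sumr_const card_ord mulr_natl.
  apply: lee_sum => j _; apply: (le_trans (loV _ gQ)); rewrite lee_fin.
  by rewrite mulmxA mulmxV ?uV// mul1mx fnorm_cvec powR1 mul1r.
have ad0 : 0 <= a `^ p * d%:R `^ p by rewrite mulr_ge0// powR_ge0.
apply: (le_trans (lee_wpmul2l _ hs)); first by rewrite lee_fin.
have := int_wgt_fin; set w := (\int[mu]_(x in hbox Q) _)%E => fw.
have w0 : 0 <= fine w by rewrite fine_ge0// integral_ge0// => x _; rewrite lee_fin wgt_ge0.
have hred : fnorm (redU Q *m e) `^ p * vol Q <= Num.sqrt d%:R `^ p * fine w.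
  have s0 : 0 <= fine w / vol Q by rewrite divr_ge0// ltW.
  have := @hiU Q e (fine w / vol Q) gQ s0; rewrite divfK ?gt_eqF// fineK// => /(_ (lexx _)).
  move=> /(ge0_ler_powR (ltW p0)); rewrite !nnegrE mulr_ge0 ?sqrtr_ge0 ?powR_ge0//.
  move=> /(_ isT isT); rewrite powRM ?sqrtr_ge0 ?powR_ge0//.
  rewrite -powRrM mulVf ?gt_eqF// powRr1// => h.
  by rewrite -ler_pdivlMr// -mulrA.
rewrite -(fineK fw) -!EFinM lee_fin.
have aE : a `^ p = (2 * D) `^ p * t `^ p * fnorm (redU Q *m e) `^ p.
  rewrite /a (_ : 2 * t * D = 2 * D * t); last by ring.
  by rewrite powRM ?mulr_ge0// ?(ltW t0)// powRM ?mulr_ge0// ltW.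
rewrite aE /majo_cst.
apply: (@le_trans _ _ ((2 * D) `^ p * t `^ p * (d%:R `^ p * d%:R) *
  (fnorm (redU Q *m e) `^ p * vol Q))).
  by rewrite le_eqVlt; apply/orP; left; apply/eqP; ring.
apply: (@le_trans _ _ ((2 * D) `^ p * t `^ p * (d%:R `^ p * d%:R) *
  (Num.sqrt d%:R `^ p * fine w))).
  by rewrite ler_wpM2l// !mulr_ge0// ?powR_ge0.
by rewrite le_eqVlt; apply/orP; left; apply/eqP; ring.
Qed.

End one_cell.

Section truncated.
Variables (e : 'cV[C]_d) (L : R) (L0 : 0 <= L).

(* Truncating by a multiple of |U^(1/p) e| provides some finite constant to start
   from; the constant reached by iteration does not depend on L. *)
Definition trosc (A : 'M[C]_d) x : R :=
  Num.min (oscV e A x) (L * fnorm (mpow (U x) p^-1 *m e)).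

Lemma trosc_ge0 A x : 0 <= trosc A x.
Proof. by rewrite le_min fnorm_ge0 mulr_ge0. Qed.

Lemma measurable_trosc A : measurable_fun setT (trosc A).
Proof.
apply: measurable_minr; first exact: measurable_oscV.
by apply: measurable_funM => //; exact: measurable_wgt0.
Qed.

Let mtr A : measurable_fun setT (fun x => trosc A x `^ p).
Proof. exact: measurableT_comp (measurable_powR _) (measurable_trosc A). Qed.

(** Quantified over all rectangles, because improving c on Q uses it on the stopping rectangles
    inside Q. *)
Definition valid (c : R) := forall Q, good Q ->
  (\int[mu]_(x in hbox Q) (trosc (bmean Q) x `^ p)%:E <=
   c%:E * \int[mu]_(x in hbox Q) (wgt U p e x)%:E)%E.

Let mw : measurable_fun setT (wgt U p e). Proof. exact: measurable_wgt. Qed.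

Lemma valid_start : valid (L `^ p).
Proof.
move=> Q gQ; rewrite -ge0_integralZ_EFin//; last 3 first.
- exact: measurable_hbox.
- exact: wgt_ge0.
- exact: powR_ge0.
apply: le_integral_lower => [x|x _]; rewrite lee_fin ?powR_ge0//.
rewrite -powRM//; apply: (ge0_ler_powR (ltW p0)); rewrite ?nnegrE ?trosc_ge0 ?mulr_ge0//.
by rewrite /trosc ge_min lexx orbT.
Qed.

Let c0 : R := (2 `^ p * d%:R `^ p * K)^-1.

Let c0_le1 : c0 <= 1.
Proof.
have tp : 1 <= 2 `^ p :> R.
  rewrite -[leLHS](_ : 1 `^ p = 1); last by rewrite powR1.
  by apply: (ge0_ler_powR (ltW p0)); rewrite ?nnegrE// ler1n.
have dp : 1 <= d%:R `^ p :> R.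
  rewrite -[leLHS](_ : 1 `^ p = 1); last by rewrite powR1.
  by apply: (ge0_ler_powR (ltW p0)); rewrite ?nnegrE// ler1n.
by rewrite invf_le1 ?mulr_ege1// !mulr_gt0// ?(lt_le_trans ltr01).
Qed.

(* The stopping set F has at most half the measure of Q, so the A_p condition gives
   w(F) <= (1 - c0) w(Q) for w = |U^(1/p) e|^p, and (1 + c0)(1 - c0) < 1. *)
Lemma valid_step (Ke c : R) : 1 <= Ke -> 0 <= c ->
  (forall a b, 0 <= a -> 0 <= b ->
    (a + b) `^ p <= Ke * a `^ p + (1 + c0) * b `^ p) -> 0 < c0 ->
  valid c -> valid (Ke * (majo_cst * t `^ p) + (1 - c0 ^+ 2) * c).
Proof.
move=> Ke1 c00 KeP c0_gt0 vc Q gQ.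
have Ke0 : 0 <= Ke by apply: le_trans Ke1.
have mQ := measurable_hbox Q.
have mF := measurable_stopset (osc Q) t gQ; have FQ := stopset_sub (f := osc Q) (t := t) gQ.
have mo := measurable_osc Q; have o0 x : 0 <= osc Q x by exact: fnorm_ge0.
set F := stopset (osc Q) t Q in mF FQ *.
pose h x := trosc (bmean Q) x `^ p.
pose maj := majo Q e; have mm : measurable_fun setT maj by exact: measurable_majo.
have m0 x : 0 <= maj x by exact: majo_ge0.
have mmp : measurable_fun setT (fun x => maj x `^ p).
  exact: measurableT_comp (measurable_powR _) mm.
pose k x := Ke * maj x `^ p + (1 + c0) * c * wgt U p e x.
have cc0 : 0 <= (1 + c0) * c by rewrite mulr_ge0// addr_ge0// ltW.
have k0 x : 0 <= k x by rewrite addr_ge0// mulr_ge0// ?powR_ge0// wgt_ge0.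
have mk : measurable_fun setT k.
  by apply: measurable_funD; apply: measurable_funM.
have mhE : measurable_fun setT (EFin \o h) by apply/measurable_EFinP; exact: mtr.
have mkE : measurable_fun setT (EFin \o k) by exact/measurable_EFinP.
have h0E x : (0 <= (EFin \o h) x)%E by rewrite /= lee_fin powR_ge0.
have k0E x : (0 <= (EFin \o k) x)%E by rewrite /= lee_fin.
have tp A x : 0 <= trosc A x `^ p by exact: powR_ge0.
have mpp x : 0 <= maj x `^ p by exact: powR_ge0.
have ww x : 0 <= wgt U p e x by exact: wgt_ge0.
have c1 : 0 <= 1 + c0 by rewrite addr_ge0// ltW.
(* Proved on the stopping rectangles up to generation j, whose parents are not heavy; these sets
   increase to F. *)
have on_F : (\int[mu]_(x in F) (h x)%:E <= \int[mu]_(x in F) (k x)%:E)%E.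
  have ms j : measurable (stop (heavy (osc Q) t) j Q) by exact: measurable_stop.
  have hj j : (\int[mu]_(x in stop (heavy (osc Q) t) j Q) (h x)%:E <=
      \int[mu]_(x in F) (k x)%:E)%E.
    apply: (@le_trans _ _ (\int[mu]_(x in stop (heavy (osc Q) t) j Q) (k x)%:E)%E).
      apply: (stop_le (child_additive_integral mhE h0E)
        (child_additive_integral mkE k0E) _ j gQ).
      - by rewrite !integral_set0.
      - by apply: not_heavy_root => //; exact: bmoB.
      move=> Q' b gQ' nh _; set J := child Q' b; have gJ : good J by exact: good_child.
      have mJ := measurable_hbox J.
      have step x : h x <= Ke * maj x `^ p + (1 + c0) * trosc (bmean J) x `^ p.
        apply: le_trans (KeP _ _ (m0 x) (trosc_ge0 _ _)).
        apply: (ge0_ler_powR (ltW p0)); rewrite ?nnegrE ?addr_ge0 ?trosc_ge0//.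
        have h1 := @oscV_child Q gQ e x (bmean J) (bmean_child_le b gQ' nh).
        (* Where the truncation is active on J, its value L |U^(1/p) e| bounds the truncated
           oscillation on Q as well, since both use the same bound. *)
        rewrite [in leRHS]/trosc; case: (leP (oscV e (bmean J) x)) => _.
          by rewrite /trosc ge_min h1.
        by rewrite /trosc ge_min; apply/orP; right; rewrite lerDr.
      exact: (absorb_child mmp mw (mtr (bmean J)) (tp (bmean Q)) mpp ww
        (tp (bmean J)) Ke0 c00 c1 mJ step (vc J gJ)).
    apply: ge0_subset_integral => //.
    - exact: measurable_funTS.
    - by move=> x _; exact: k0E.
    - by move=> x Sx; exists j.
  have cF : (\int[mu]_(x in stop (heavy (osc Q) t) j Q) (h x)%:E)%E @[j --> \oo] -->
      (\int[mu]_(x in F) (h x)%:E)%E.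
    apply: ge0_nondecreasing_set_cvg_integral => //.
    - exact: (stop_ndseq (osc Q) t Q).
    - by move=> j; exact: measurable_funTS.
    - by move=> j x _; exact: h0E.
  rewrite -(cvg_lim _ cF)//; apply: lime_le; first by apply/cvg_ex; eexists; exact: cF.
  exact: nearW.
have mG : measurable (hbox Q `\` F) by exact: measurableD.
have off_F : (\int[mu]_(x in hbox Q `\` F) (h x)%:E <=
    \int[mu]_(x in hbox Q `\` F) (Ke * maj x `^ p)%:E)%E.
  apply: ae_le_integral_lowerD.
  - by move=> x; rewrite lee_fin powR_ge0.
  - by move=> x; rewrite lee_fin mulr_ge0// powR_ge0.
  have := ae_nonstop mo o0 t0 gQ (bmoB gQ).
  apply: filterS => x hx [Qx nFx]; split => //; rewrite lee_fin.
  apply: (@le_trans _ _ (maj x `^ p)); last by rewrite ler_peMl// powR_ge0.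
  apply: (ge0_ler_powR (ltW p0)); rewrite ?nnegrE ?trosc_ge0//.
  by rewrite /trosc ge_min; apply/orP; left; apply: oscV_nonstop => //; exact: hx.
have small : (\int[mu]_(x in F) (wgt U p e x)%:E <=
    (1 - c0)%:E * \int[mu]_(x in hbox Q) (wgt U p e x)%:E)%E.
  apply: (Ap_wgt_small d0 p1 K0 (vol_gt0 gQ) mQ (mu_hbox gQ) mU pU (ApU gQ)) => //.
    rewrite -ge0_fin_numE; first exact: int_wgt_fin.
    by apply: integral_ge0 => x _; rewrite lee_fin wgt_ge0.
  exact: mu_stopset mo o0 t0 gQ (bmoB gQ).
have -> : (1 - c0 ^+ 2) * c = (1 + c0) * c * (1 - c0) by ring.
have A0 : 0 <= majo_cst * t `^ p by rewrite mulr_ge0// ?powR_ge0// majo_cst_ge0.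
have g0 : 0 <= 1 - c0 by rewrite subr_ge0 c0_le1.
exact: (absorb_total (mtr (bmean Q)) mmp mw (tp (bmean Q)) mpp ww Ke0 c00 c1
  mQ mF FQ A0 g0 (int_wgt_fin gQ e) on_F off_F small (int_majo gQ e)).
Qed.

Lemma valid_mono c c' : c <= c' -> valid c -> valid c'.
Proof.
move=> cc' vc Q gQ; apply: (le_trans (vc Q gQ)); rewrite lee_wpmul2r ?lee_fin//.
by apply: integral_ge0 => x _; rewrite lee_fin wgt_ge0.
Qed.

(** [valid_step] sends c to a + rho c, whose fixed point is a / (1 - rho) = a / c0^2. After k steps
    the distance of the starting value from it has shrunk to rho^k L^p, the only place where L
    occurs. *)
Lemma valid_lim (Ke : R) : 1 <= Ke ->
  (forall a b, 0 <= a -> 0 <= b ->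
    (a + b) `^ p <= Ke * a `^ p + (1 + c0) * b `^ p) -> 0 < c0 ->
  valid (Ke * (majo_cst * t `^ p) / c0 ^+ 2).
Proof.
move=> Ke1 KeP c0_gt0; set a := Ke * _; set rho := 1 - c0 ^+ 2.
have a0 : 0 <= a.
  by rewrite mulr_ge0 ?(le_trans _ Ke1)// mulr_ge0 ?powR_ge0// majo_cst_ge0.
have c2 : 0 < c0 ^+ 2 by rewrite exprn_gt0.
have C00 : 0 <= a / c0 ^+ 2 by rewrite divr_ge0// ltW.
have rho0 : 0 <= rho by rewrite subr_ge0 exprn_ile1// ?c0_le1// ltW.
have rho1 : `|rho| < 1 by rewrite ger0_norm// ltrBlDr ltrDl.
have vk k : valid (a / c0 ^+ 2 + rho ^+ k * L `^ p).
  elim: k => [|k ih].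
    by rewrite expr0 mul1r; apply: valid_mono valid_start; rewrite lerDr.
  have -> : a / c0 ^+ 2 + rho ^+ k.+1 * L `^ p =
      a + rho * (a / c0 ^+ 2 + rho ^+ k * L `^ p).
    rewrite [rho ^+ k.+1]exprS mulrDr [rho * (a / _)](_ : _ = a / c0 ^+ 2 - a); last first.
      by rewrite /rho; field; rewrite gt_eqF.
    by rewrite mulrA; ring.
  apply: valid_step => //.
  by rewrite addr_ge0// mulr_ge0// ?powR_ge0// exprn_ge0.
move=> Q gQ; have wfin := int_wgt_fin gQ e.
have w0 : 0 <= fine (\int[mu]_(x in hbox Q) (wgt U p e x)%:E)%E.
  by rewrite fine_ge0// integral_ge0// => x _; rewrite lee_fin wgt_ge0.
apply/lee_addgt0Pr => r r0.
move: vk => /(_ _ Q gQ); rewrite -(fineK wfin); set w := fine _ in w0 * => vk.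
have /cvgrPdist_le/(_ r r0) [k _ /(_ k (leqnn k))] := cvg_geometric (L `^ p * w) rho1.
rewrite /geometric/= sub0r normrN => hk.
apply: (le_trans (vk k)); rewrite -EFinM -EFinM -EFinD lee_fin mulrDl lerD2l.
apply: le_trans hk; apply: le_trans (ler_norm _).
by rewrite le_eqVlt; apply/orP; left; apply/eqP; ring.
Qed.

End truncated.

Let c0 : R := (2 `^ p * d%:R `^ p * K)^-1.

(** The truncation is removed by monotone convergence, as the constant of [valid_lim] is free of L.
    For e = 0 the oscillation vanishes. *)
Lemma oscV_le (Ke : R) (e : 'cV[C]_d) Q : 1 <= Ke ->
  (forall a b, 0 <= a -> 0 <= b ->
    (a + b) `^ p <= Ke * a `^ p + (1 + c0) * b `^ p) -> 0 < c0 -> good Q ->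
  (\int[mu]_(x in hbox Q) (oscV e (bmean Q) x `^ p)%:E <=
   (Ke * (majo_cst * t `^ p) / c0 ^+ 2)%:E *
   \int[mu]_(x in hbox Q) (wgt U p e x)%:E)%E.
Proof.
move=> Ke1 KeP c0_gt0 gQ; have mQ := measurable_hbox Q.
have [e0|e0] := eqVneq e 0.
  have o0 x : oscV e (bmean Q) x = 0.
    by rewrite /oscV e0; apply: etrans (fnorm0 _ _); congr fnorm; exact: mulmx0.
  apply: (@le_trans _ _ 0%E).
    rewrite -(integral0 mu (hbox Q)); apply: le_integral_lower => [x|x _].
      by rewrite lee_fin powR_ge0.
    by rewrite o0 powR0// gt_eqF.
  apply: mule_ge0.
    rewrite lee_fin divr_ge0 ?exprn_ge0// ?(ltW c0_gt0)//.
    by rewrite mulr_ge0 ?(le_trans _ Ke1)// mulr_ge0 ?powR_ge0// majo_cst_ge0.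
  by apply: integral_ge0 => x _; rewrite lee_fin wgt_ge0.
have Ue x : 0 < fnorm (mpow (U x) p^-1 *m e).
  apply: fnorm_gt0; apply/eqP => h.
  have : invmx (mpow (U x) p^-1) *m (mpow (U x) p^-1 *m e) = 0 by rewrite h mulmx0.
  rewrite mulmxA mulVmx ?mpow_unit// mul1mx => ee.
  by rewrite ee eqxx in e0.
pose h (k : nat) x := (trosc e k%:R (bmean Q) x `^ p)%:E.
have hmono x : {homo h^~ x : i j / (i <= j)%N >-> (i <= j)%E}.
  move=> i j ij; rewrite /h lee_fin.
  apply: (ge0_ler_powR (ltW p0)); rewrite ?nnegrE ?trosc_ge0//.
  rewrite /trosc le_min !ge_min lexx/=; apply/orP; right.
  by rewrite ler_wpM2r// ler_nat.
(* At a given x the truncation is inactive for all large k, because |U(x)^(1/p) e| > 0. *)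
have hlim x : limn (h^~ x) = (oscV e (bmean Q) x `^ p)%:E.
  apply: cvg_lim => //; apply: cvg_near_cst.
  near=> k; rewrite /h /trosc; congr (_ `^ _)%:E; apply/eqP; rewrite eq_minl.
  rewrite -ler_pdivrMr//; near: k; exact: nbhs_infty_ger.
have hE : (\int[mu]_(x in hbox Q) (oscV e (bmean Q) x `^ p)%:E =
    \int[mu]_(x in hbox Q) limn (h^~ x))%E.
  by apply: eq_integral => x _; rewrite hlim.
apply: (le_trans (y := \int[mu]_(x in hbox Q) limn (h^~ x))%E).
  by rewrite le_eqVlt; apply/orP; left; apply/eqP; exact: hE.
have cm : (\int[mu]_(x in hbox Q) h k x)%E @[k --> \oo] -->
    (\int[mu]_(x in hbox Q) limn (h^~ x))%E.
  apply: cvg_monotone_convergence => //.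
  - move=> k; apply/measurable_EFinP; apply: measurable_funTS.
    by apply: measurableT_comp (measurable_powR _) _; exact: measurable_trosc.
  - by move=> k x _; rewrite lee_fin powR_ge0.
rewrite -(cvg_lim _ cm)//; apply: lime_le; first by apply/cvg_ex; eexists; exact: cm.
by apply: nearW => k; apply: valid_lim.
Unshelve. all: by end_near. Qed.

(** Column j is the case e = U_Q^(-1) e_j of [oscV_le], for which the average of w is at most |U_Q
    U_Q^(-1) e_j|^p = 1. *)
Lemma bmo_le (Ke : R) Q : 1 <= Ke ->
  (forall a b, 0 <= a -> 0 <= b ->
    (a + b) `^ p <= Ke * a `^ p + (1 + c0) * b `^ p) -> 0 < c0 -> good Q ->
  (\int[mu]_(x in hbox Q)
     (fnorm (mpow (V x) p^-1 *m (B x - bmean Q) *m invmx (redU Q)) `^ p)%:E <=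
   (d%:R `^ p * (d%:R * (Ke * (majo_cst * t `^ p) / c0 ^+ 2)) * vol Q)%:E)%E.
Proof.
move=> Ke1 KeP c0_gt0 gQ; have mQ := measurable_hbox Q.
set C0 := Ke * _ / _.
have C00 : 0 <= C0.
  rewrite divr_ge0 ?exprn_ge0// ?(ltW c0_gt0)//.
  by rewrite mulr_ge0 ?(le_trans _ Ke1)// mulr_ge0 ?powR_ge0// majo_cst_ge0.
pose ej (j : 'I_d) : 'cV[C]_d := invmx (redU Q) *m cvec j.
have mo j : measurable_fun setT (fun x => oscV (ej j) (bmean Q) x `^ p).
  by apply: measurableT_comp (measurable_powR _) _; exact: measurable_oscV.
apply: (@le_trans _ _ (\int[mu]_(x in hbox Q) (d%:R `^ p *
    \sum_(j < d) oscV (ej j) (bmean Q) x `^ p)%:E)%E).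
  apply: le_integral_lower => [x|x _]; rewrite lee_fin ?powR_ge0//.
  apply: le_trans; last by apply: powR_sum_le => // j; exact: fnorm_ge0.
  apply: (ge0_ler_powR (ltW p0)); rewrite ?nnegrE ?sumr_ge0//.
    by move=> j _; exact: fnorm_ge0.
  apply: (le_trans (fnorm_le_sum_col _)).
  by apply: ler_sum => j _; rewrite colM.
have ms : measurable_fun setT (fun x => \sum_(j < d) oscV (ej j) (bmean Q) x `^ p).
  by apply: measurable_sum => j; exact: mo.
have s0 x : 0 <= \sum_(j < d) oscV (ej j) (bmean Q) x `^ p.
  by apply: sumr_ge0 => j _; exact: powR_ge0.
rewrite (ge0_integralZ_EFin mu mQ ms s0 (powR_ge0 _ _)).
rewrite -[X in (_ <= X%:E)%E]mulrA [leRHS]EFinM lee_wpmul2l ?lee_fin ?powR_ge0//.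
under eq_integral do rewrite -sumEFin.
rewrite ge0_integral_sum//; last 2 first.
- by move=> j; apply/measurable_EFinP; exact: measurable_funTS.
- by move=> j x _; rewrite lee_fin powR_ge0.
apply: (@le_trans _ _ (\sum_(j < d) (C0 * vol Q)%:E)%E); last first.
  rewrite sumEFin lee_fin sumr_const card_ord -mulr_natl.
  by rewrite le_eqVlt; apply/orP; left; apply/eqP; ring.
apply: lee_sum => j _; apply: (le_trans (oscV_le _ Ke1 KeP c0_gt0 gQ)).
rewrite [leRHS]EFinM; apply: lee_wpmul2l; first by rewrite lee_fin.
apply: (le_trans (loU _ gQ)).
by rewrite mulmxA mulmxV ?uU// mul1mx fnorm_cvec powR1 mul1r.
Qed.

End absorption.

(** * From p-th power averages with W^(1/p) to averages with the reducing operator *)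

Section Ap_hoelder.
Context dT (T : measurableType dT) (R : realType) (mu : {measure set T -> \bar R}).
Local Notation C := R[i].
Variables (d : nat) (W : T -> 'M[C]_d) (p K v : R) (D : set T).
Let q := conj_exp p.
Hypotheses (d0 : (0 < d)%N) (p1 : 1 < p) (K0 : 0 < K) (v0 : 0 < v).
Hypotheses (mD : measurable D) (muD : mu D = v%:E).
Hypotheses (mW : mxmeas W) (pW : forall x, posdefmx (W x)).
Hypothesis Ap : (\int[mu]_(x in D) poweR (v^-1%:E *
  \int[mu]_(y in D) (opnorm (mpow (W x) p^-1 *m mpow (W y) (- p^-1)) `^ q)%:E)
    (p / q) <= (K * v)%:E)%E.
Variable M : 'M[C]_d.
Hypothesis hM : M^t* = M.
Hypothesis redM : forall (phi : 'cV[C]_d) s, 0 <= s ->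
  (\int[mu]_(x in D) (wgt W p phi x)%:E <= (s * v)%:E)%E ->
  fnorm (M *m phi) <= Num.sqrt d%:R * s `^ p^-1.

Let p0 : 0 < p := exp_gt0 p1.
Let q0 : 0 < q := conj_exp_gt0 p1.

(** The constant of [Ap_dual_vec], times d^q d for the passage to columns. *)
Definition dual_cst : R :=
  d%:R `^ q * (d%:R * (Num.sqrt d%:R * d%:R * K `^ p^-1) `^ q).

Lemma dual_cst_ge0 : 0 <= dual_cst.
Proof. by rewrite !mulr_ge0// powR_ge0. Qed.

Let Wn y := mpow (W y) (- p^-1).

Let mdual : measurable_fun setT (fun y => fnorm (M *m Wn y)).
Proof.
apply: measurable_fnorm; apply: mxmeasM; first exact: mxmeas_cst.
exact: mxmeas_mpow.
Qed.

Lemma Ap_dual_mx :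
  (\int[mu]_(y in D) (fnorm (M *m Wn y) `^ q)%:E <= (dual_cst * v)%:E)%E.
Proof.
pose f (j : 'I_d) y := fnorm (Wn y *m (M *m cvec j)) `^ q.
have mf j : measurable_fun setT (f j).
  apply: measurableT_comp (measurable_powR _) _; exact: measurable_wgt0.
have f0 j y : 0 <= f j y by exact: powR_ge0.
have ms : measurable_fun setT (fun y => \sum_(j < d) f j y).
  by apply: measurable_sum => j; exact: mf.
have s0 y : 0 <= \sum_(j < d) f j y by apply: sumr_ge0.
apply: (@le_trans _ _ (\int[mu]_(y in D) (d%:R `^ q * \sum_(j < d) f j y)%:E)%E).
  apply: le_integral_lower => [y|y _]; rewrite lee_fin ?powR_ge0//.
  apply: le_trans; last by apply: powR_sum_le => // j; exact: fnorm_ge0.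
  apply: (ge0_ler_powR (ltW q0)); rewrite ?nnegrE ?sumr_ge0//.
  (* Taking adjoints keeps the Frobenius norm and turns the columns into the vectors of
     [Ap_dual_vec]. *)
  have E : (M *m Wn y)^t* = Wn y *m M.
    rewrite trmx_mul map_mxM/= hM; congr (_ *m _); exact: mpow_herm.
  rewrite -fnormC E; apply: (le_trans (fnorm_le_sum_col _)).
  by apply: ler_sum => j _; rewrite colM.
rewrite (ge0_integralZ_EFin mu mD ms s0 (powR_ge0 _ _)).
rewrite /dual_cst -[X in (_ <= X%:E)%E]mulrA [leRHS]EFinM.
apply: lee_wpmul2l; first by rewrite lee_fin powR_ge0.
under eq_integral do rewrite -sumEFin.
rewrite ge0_integral_sum//; last 2 first.
- by move=> j; apply/measurable_EFinP; exact: measurable_funTS.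
- by move=> j x _; rewrite lee_fin.
apply: (@le_trans _ _ (\sum_(j < d)
    ((Num.sqrt d%:R * d%:R * K `^ p^-1) `^ q * v)%:E)%E); last first.
  rewrite sumEFin lee_fin sumr_const card_ord -mulr_natl.
  by rewrite le_eqVlt; apply/orP; left; apply/eqP; ring.
apply: lee_sum => j _.
by apply: (Ap_dual_vec d0 p1 K0 v0 mD muD mW pW Ap hM redM); rewrite fnorm_cvec.
Qed.

(** M X factors as M W^(-1/p) times W^(1/p) X. The powers v^(1/q) and v^(1/p) from the two factors
    multiply to v. *)
Lemma Ap_hoelder (X : T -> 'M[C]_d) (s : R) : mxmeas X -> 0 <= s ->
  (\int[mu]_(x in D) (fnorm (mpow (W x) p^-1 *m X x) `^ p)%:E <= (s * v)%:E)%E ->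
  (\int[mu]_(x in D) (fnorm (M *m X x))%:E <=
    (dual_cst `^ q^-1 * s `^ p^-1 * v)%:E)%E.
Proof.
move=> mX s0 hs.
have mWX : measurable_fun setT (fun x => fnorm (mpow (W x) p^-1 *m X x)).
  by apply: measurable_fnorm; apply: mxmeasM => //; exact: mxmeas_mpow.
have A0 : 0 <= dual_cst * v by rewrite mulr_ge0 ?dual_cst_ge0// ltW.
have B0 : 0 <= s * v by rewrite mulr_ge0// ltW.
have := hoelder_le mD mdual mWX (fun x => fnorm_ge0 _) (fun x => fnorm_ge0 _)
  q0 p0 (etrans (addrC _ _) (conj_expV p1)) A0 B0 Ap_dual_mx hs.
have -> : (dual_cst * v) `^ q^-1 * (s * v) `^ p^-1 =
    dual_cst `^ q^-1 * s `^ p^-1 * v.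
  rewrite [(dual_cst * v) `^ _]powRM ?dual_cst_ge0 ?(ltW v0)//.
  rewrite [(s * v) `^ _]powRM ?(ltW v0)// mulrACA -powRD; last first.
    by rewrite (gt_eqF v0) implybT.
  by rewrite [q^-1 + _]addrC (conj_expV p1) powRr1// ltW.
apply: le_trans; apply: le_integral_lower => [x|x _]; rewrite lee_fin//.
have -> : M *m X x = (M *m Wn x) *m (mpow (W x) p^-1 *m X x).
  rewrite mulmxA -[_ *m Wn x *m _]mulmxA.
  by have := mpowN (pW x) (- p^-1); rewrite opprK => ->; rewrite mulmx1.
exact: fnormM.
Qed.

End Ap_hoelder.

(** * Borel versions, and transfer from closed to half-open rectangles *)

Section borel_versions.
Context {R : realType} {n m d : nat}.
Local Notation C := R[i].
Local Notation T := (Rn R n * Rn R m)%type.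
Local Notation mu := (@leb2 R n m).
Local Notation cell := (@cell R n m).
Implicit Types (Q : cell).

Lemma ae_forall (I : finType) (P : I -> T -> Prop) :
  (forall i, {ae mu, forall x, P i x}) -> {ae mu, forall x, forall i, P i x}.
Proof.
move=> aeP; have H (s : seq I) : {ae mu, forall x, forall i, i \in s -> P i x}.
  elim: s => [|i s ih]; first exact: aeW.
  apply: filterS2 (aeP i) ih => x Pi Ps j; rewrite inE => /predU1P[->//|]; exact: Ps.
by apply: filterS (H (index_enum I)) => x h i; apply: h; rewrite mem_index_enum.
Qed.

Lemma borel_mx (B : T -> 'M[C]_d) :
  (forall i j, lebesgue_measurable (fun x => complex.Re (B x i j)) /\
               lebesgue_measurable (fun x => complex.Im (B x i j))) ->
  exists2 G : T -> 'M[C]_d, mxmeas G & {ae mu, forall x, B x = G x}.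
Proof.
move=> mB.
have HR (k : 'I_d * 'I_d) : {g : T -> R | measurable_fun setT g /\
    {ae mu, forall x, complex.Re (B x k.1 k.2) = g x}}.
  by apply: cid; have [[g mg ae] _] := mB k.1 k.2; exists g.
have HI (k : 'I_d * 'I_d) : {g : T -> R | measurable_fun setT g /\
    {ae mu, forall x, complex.Im (B x k.1 k.2) = g x}}.
  by apply: cid; have [_ [g mg ae]] := mB k.1 k.2; exists g.
exists (fun x => \matrix_(i, j) (sval (HR (i, j)) x +i* sval (HI (i, j)) x)).
  move=> i j; split; under eq_fun do rewrite mxE/=.
    exact: (svalP (HR (i, j))).1.
  exact: (svalP (HI (i, j))).1.
have aeR := ae_forall (fun k => (svalP (HR k)).2).
have aeI := ae_forall (fun k => (svalP (HI k)).2).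
apply: filterS2 aeR aeI => x hR hI; apply/matrixP => i j; rewrite mxE.
by rewrite -(hR (i, j)) -(hI (i, j)) /=; case: (B x i j).
Qed.

Lemma borel_weight (W : T -> 'M[C]_d) : weight W ->
  exists W' : T -> 'M[C]_d, [/\ mxmeas W', (forall x, posdefmx (W' x)) &
    {ae mu, forall x, W x = W' x}].
Proof.
move=> [[mW _] pW]; have [G mG aeG] := borel_mx mW.
have [N [mN N0 hN]] : {ae mu, forall x, W x = G x /\ posdefmx (W x)}.
  by apply: filterS2 aeG pW => x.
have hN' x : ~ N x -> W x = G x /\ posdefmx (W x).
  by move=> Nx; apply: contrapT => h; apply: Nx; exact: hN.
(* On a Borel null set that contains all exceptional points the value is the identity matrix, so
   that W' is positive definite everywhere. *)
pose W' x := (\1_(~` N) x)%:C *: G x + (\1_N x)%:C *: 1%:M.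
have W'N x : N x -> W' x = 1%:M.
  move=> Nx; have e1 : (x \in N) = true by exact: mem_set.
  have e2 : (x \in ~` N) = false by apply: memNset; exact.
  by rewrite /W' !indicE e1 e2 scale0r add0r scale1r.
have W'C x : ~ N x -> W' x = G x.
  move=> Nx; have e1 : (x \in N) = false by exact: memNset.
  have e2 : (x \in ~` N) = true by exact: mem_set.
  by rewrite /W' !indicE e1 e2 scale0r addr0 scale1r.
exists W'; split.
- apply: mxmeasD; apply: mxmeasZ.
  + by apply: measurable_indic; exact: measurableC.
  + exact: mG.
  + exact: measurable_indic.
  + exact: mxmeas_cst.
- move=> x; have [Nx|Nx] := pselect (N x); first by rewrite W'N//; exact: posdef1.
  by rewrite W'C//; have [<-] := hN' x Nx.
- exists N; split => // x /= h; apply: contrapT => Nx; apply: h.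
  by rewrite W'C//; have [] := hN' x Nx.
Qed.

Lemma mean_hbox (f f' : T -> \bar R) Q : good Q ->
  (forall x, 0 <= f x)%E -> (forall x, 0 <= f' x)%E ->
  {ae mu, forall x, f x = f' x} ->
  mean (cbox Q) f = ((vol Q)^-1%:E * \int[mu]_(x in hbox Q) f' x)%E.
Proof.
move=> gQ f0 f'0 ff'; rewrite /mean.
have -> : fine ((@lebesgue_Rn R n \x @lebesgue_Rn R m)%E (cbox Q)) = vol Q.
  have := mu_cbox gQ; rewrite /leb2/= => h.
  by apply: (congr1 fine h).
congr (_ * _)%E; apply: (@ae_eq_integral_lower _ _ _ mu) => //.
by apply: filterS2 (ae_cbox_hbox gQ) ff' => x.
Qed.

Lemma mx_mean_bmean (B B' : T -> 'M[C]_d) Q : good Q ->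
  {ae mu, forall x, B x = B' x} -> mx_mean (cbox Q) B = bmean B' Q.
Proof.
move=> gQ BB'; apply/matrixP => i j; rewrite !mxE.
have -> : fine ((@lebesgue_Rn R n \x @lebesgue_Rn R m)%E (cbox Q)) = vol Q.
  have := mu_cbox gQ; rewrite /leb2/= => h.
  by apply: (congr1 fine h).
have eR : \int[mu]_(x in cbox Q) complex.Re (B x i j) =
    \int[mu]_(x in hbox Q) complex.Re (B' x i j).
  apply: ae_eq_Rintegral_lower.
  by apply: filterS2 (ae_cbox_hbox gQ) BB' => x h ->.
have eI : \int[mu]_(x in cbox Q) complex.Im (B x i j) =
    \int[mu]_(x in hbox Q) complex.Im (B' x i j).
  apply: ae_eq_Rintegral_lower.
  by apply: filterS2 (ae_cbox_hbox gQ) BB' => x h ->.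
apply/eqP; rewrite eq_complex /= !mul0r subr0 addr0.
by apply/andP; split; apply/eqP; [rewrite -eR|rewrite -eI].
Qed.

(** A closed rectangle is a product of segments. This makes local integrability, which is stated on
    compact sets, available on rectangles. *)
Lemma compact_cbox Q : compact (@to_row R n m @` cbox Q).
Proof.
have -> : @to_row R n m @` cbox Q = [set v : 'rV[R]_(n + m) | forall k : 'I_(n + m),
    (match fintype.split k with
     | inl i => [set` `[Q.1.1 i, (Q.1.1 i + Q.1.2)%R]]
     | inr j => [set` `[Q.2.1 j, (Q.2.1 j + Q.2.2)%R]] end : set R) (v ord0 k)].
  apply/seteqP; split => [_ [x [h1 h2] <-] k|v hv].
    rewrite /to_row mxE; case: (fintype.split k) => i; rewrite mxE /= in_itv/=.
      exact: h1.
    exact: h2.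
  exists ([tuple v ord0 (lshift m i) | i < n], [tuple v ord0 (rshift n j) | j < m]).
    split => i /=; rewrite tnth_mktuple.
      by have := hv (lshift m i); rewrite (unsplitK (inl i)) /= in_itv.
    by have := hv (rshift n i); rewrite (unsplitK (inr i)) /= in_itv.
  apply/rowP => k; rewrite /to_row mxE -{2}[k]splitK.
  by case: (fintype.split k) => i; rewrite mxE tnth_mktuple.
apply: (@rV_compact R (n + m) (fun k => match fintype.split k with
     | inl i => [set` `[Q.1.1 i, (Q.1.1 i + Q.1.2)%R]]
     | inr j => [set` `[Q.2.1 j, (Q.2.1 j + Q.2.2)%R]] end)) => k.
by case: (fintype.split k) => i; exact: segment_compact.
Qed.

Lemma fnorm_integral_le (D : set T) (G : T -> 'M[C]_d) : measurable D ->
  (0 < d)%N -> mxmeas G ->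
  (\int[mu]_(x in D) (fnorm (G x))%:E <=
   d%:R%:E * \int[mu]_(x in D) (opnorm (G x))%:E)%E.
Proof.
move=> mD d0 mG; have dd : 0 < d%:R :> R by rewrite ltr0n.
have mf := measurable_fnorm mG.
rewrite -lee_pdivrMl// -(ge0_integralZ_EFin mu mD mf (fun x => fnorm_ge0 _)); last first.
  by rewrite invr_ge0 ltW.
apply: le_integral_lower => [x|x _]; rewrite lee_fin.
  by rewrite mulr_ge0// invr_ge0 ltW.
by rewrite ler_pdivrMl//; exact: fnorm_le_opnorm.
Qed.

Lemma fnorm_powR_integral_le (D : set T) (G : T -> 'M[C]_d) (p : R) : measurable D ->
  (0 < d)%N -> 0 < p -> mxmeas G ->
  (\int[mu]_(x in D) (fnorm (G x) `^ p)%:E <=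
   (d%:R `^ p)%:E * \int[mu]_(x in D) (opnorm (G x) `^ p)%:E)%E.
Proof.
move=> mD d0 p0 mG; have dd : 0 < d%:R `^ p :> R by rewrite powR_gt0// ltr0n.
have mf : measurable_fun setT (fun x => fnorm (G x) `^ p).
  exact: measurableT_comp (measurable_powR _) (measurable_fnorm mG).
rewrite -lee_pdivrMl// -(ge0_integralZ_EFin mu mD mf (fun x => powR_ge0 _ _)); last first.
  by rewrite invr_ge0 ltW.
apply: le_integral_lower => [x|x _]; rewrite lee_fin.
  by rewrite mulr_ge0 ?powR_ge0// invr_ge0 ltW.
rewrite ler_pdivrMl// -powRM//.
by apply: (ge0_ler_powR (ltW p0)) (fnorm_le_opnorm _); rewrite nnegrE// mulr_ge0.
Qed.

Lemma mxintegrable_borel (B B' : T -> 'M[C]_d) Q : (0 < d)%N ->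
  mx_locally_integrable B -> mxmeas B' -> {ae mu, forall x, B x = B' x} ->
  mxintegrable mu (hbox Q) B'.
Proof.
move=> d0 [_ iB] mB' BB'; split => //; have mQ := measurable_hbox Q.
apply: (le_lt_trans (fnorm_integral_le mQ d0 mB')).
apply: lte_mul_pinfty; [by rewrite lee_fin|by []|].
apply: le_lt_trans (iB _ (@compact_cbox Q)).
apply: (@ae_le_integral_lowerD _ _ _ mu) => [x|x|]; try by rewrite lee_fin.
by apply: filterS BB' => x -> /hbox_cbox.
Qed.

Lemma mxpowR_eq (A A' : 'M[C]_d) s : A = A' -> mxpowR A s = mpow A' s.
Proof. by move=> ->; exact: mxpowR_mpow. Qed.

Lemma Ap_char_hbox (W W' : T -> 'M[C]_d) (p K : R) Q :
  {ae mu, forall x, W x = W' x} -> (Ap_char p W <= K%:E)%E -> good Q ->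
  (\int[mu]_(x in hbox Q) poweR ((vol Q)^-1%:E * \int[mu]_(y in hbox Q)
     (opnorm (mpow (W' x) p^-1 *m mpow (W' y) (- p^-1)) `^ conj_exp p)%:E)
    (p / conj_exp p) <= (K * vol Q)%:E)%E.
Proof.
move=> WW' hK gQ; have vQ := vol_gt0 gQ.
have hm : (mean (cbox Q) (fun x => poweR (mean (cbox Q) (fun y =>
    (opnorm (mxpowR (W x) p^-1 *m mxpowR (W y) (- p^-1)) `^ conj_exp p)%:E))
      (p / conj_exp p)) <= K%:E)%E.
  apply: le_trans hK; apply: ereal_sup_ubound; exists (cbox Q) => //.
  by apply/rectangleP; exists Q.
move: hm; rewrite (@mean_hbox _ (fun x => poweR ((vol Q)^-1%:E * \int[mu]_(y in hbox Q)
     (opnorm (mpow (W' x) p^-1 *m mpow (W' y) (- p^-1)) `^ conj_exp p)%:E)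
    (p / conj_exp p)) Q gQ)%E; first last.
- apply: filterS (WW') => x hx; apply: (congr1 (fun a => poweR a (p / conj_exp p))).
  apply: mean_hbox => // [y|y|].
  + by rewrite lee_fin powR_ge0.
  + by rewrite lee_fin powR_ge0.
  + apply: filterS WW' => y hy.
    apply: (congr1 (fun A => (opnorm A `^ conj_exp p)%:E)).
    exact: (congr2 mulmx (mxpowR_eq _ hx) (mxpowR_eq _ hy)).
- by move=> x; exact: poweR_ge0.
- by move=> x; exact: poweR_ge0.
- by rewrite lee_pdivrMl// -EFinM (mulrC (vol Q) K).
Qed.

Lemma mean_wgt (W W' : T -> 'M[C]_d) (p : R) Q e : good Q ->
  {ae mu, forall x, W x = W' x} ->
  mean (cbox Q) (fun x => (vnorm (mxpowR (W x) p^-1 *m e) `^ p)%:E) =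
  ((vol Q)^-1%:E * \int[mu]_(x in hbox Q) (wgt W' p e x)%:E)%E.
Proof.
move=> gQ WW'; apply: mean_hbox => //.
- by move=> x; rewrite lee_fin powR_ge0.
- by move=> x; rewrite lee_fin wgt_ge0.
- apply: filterS WW' => x hx; rewrite vnorm_fnorm.
  apply: (congr1 (fun A : 'M[C]_d => (fnorm (A *m e) `^ p)%:E)).
  exact: mxpowR_eq.
Qed.

(** With [reducing_hi], it restates the two inequalities for a reducing operator in terms of
    integrals of a Borel version of W over half-open rectangles. *)
Lemma reducing_lo (W W' : T -> 'M[C]_d) (p : R) Q M e : good Q -> 0 < p ->
  {ae mu, forall x, W x = W' x} -> reducing_operator p W (cbox Q) M ->
  (\int[mu]_(x in hbox Q) (wgt W' p e x)%:E <= (fnorm (M *m e) `^ p * vol Q)%:E)%E.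
Proof.
move=> gQ p0 WW' [_ /(_ e) /= /andP[+ _] _]; have vQ := vol_gt0 gQ.
rewrite (mean_wgt p e gQ WW') vnorm_fnorm; set I := (\int[_]_(_ in _) _)%E.
have I0 : (0 <= I)%E by apply: integral_ge0 => x _; rewrite lee_fin wgt_ge0.
rewrite (mulrC _ (vol Q)) EFinM -lee_pdivrMl//.
have vI0 : (0 <= (vol Q)^-1%:E * I)%E by rewrite mule_ge0// lee_fin invr_ge0 ltW.
move=> h; rewrite -[leLHS]poweRe1// -(mulVf (lt0r_neq0 p0)) poweRrM -poweR_EFin.
apply: gt0_ler_poweR => //; first exact: ltW.
- by rewrite in_itv/= leey andbT poweR_ge0.
- by rewrite in_itv/= leey andbT lee_fin.
Qed.

Lemma reducing_hi (W W' : T -> 'M[C]_d) (p : R) Q M e s : good Q -> 0 < p ->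
  {ae mu, forall x, W x = W' x} -> reducing_operator p W (cbox Q) M -> 0 <= s ->
  (\int[mu]_(x in hbox Q) (wgt W' p e x)%:E <= (s * vol Q)%:E)%E ->
  fnorm (M *m e) <= Num.sqrt d%:R * s `^ p^-1.
Proof.
move=> gQ p0 WW' [_ /(_ e) /= /andP[_ +] _] s0; have vQ := vol_gt0 gQ.
rewrite (mean_wgt p e gQ WW') vnorm_fnorm; set I := (\int[_]_(_ in _) _)%E.
have I0 : (0 <= I)%E by apply: integral_ge0 => x _; rewrite lee_fin wgt_ge0.
move=> h hI; have {}hI : ((vol Q)^-1%:E * I <= s%:E)%E.
  by rewrite lee_pdivrMl// -EFinM (mulrC (vol Q) s).
have vI0 : (0 <= (vol Q)^-1%:E * I)%E by rewrite mule_ge0// lee_fin invr_ge0 ltW.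
rewrite -lee_fin; apply: (le_trans h); rewrite EFinM.
apply: lee_wpmul2l; first by rewrite lee_fin sqrtr_ge0.
rewrite -poweR_EFin; apply: gt0_ler_poweR => //.
- by rewrite invr_ge0 ltW.
- by rewrite in_itv/= leey andbT.
- by rewrite in_itv/= leey andbT lee_fin.
Qed.

End borel_versions.

(** * The two inequalities between the norms *)

Section bmo_comparison.
Context {R : realType} {n m d : nat}.
Local Notation C := R[i].
Local Notation T := (Rn R n * Rn R m)%type.
Local Notation mu := (@leb2 R n m).
Variables (p K : R) (U V B : T -> 'M[C]_d) (redU redV : set T -> 'M[C]_d).
Hypotheses (d0 : (0 < d)%N) (p1 : 1 < p) (K1 : 1 <= K).
Hypotheses (wU : weight U) (wV : weight V) (lB : mx_locally_integrable B).
Hypothesis rU : forall E, rectangle E -> reducing_operator p U E (redU E).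
Hypothesis rV : forall E, rectangle E -> reducing_operator p V E (redV E).

Let p0 : 0 < p := exp_gt0 p1.
Let K0 : 0 < K. Proof. exact: lt_le_trans K1. Qed.

Definition bmo_osc (E : set T) (x : T) :=
  mxpowR (V x) p^-1 *m (B x - mx_mean E B) *m invmx (redU E).

Definition tilde_osc (E : set T) (x : T) :=
  redV E *m (B x - mx_mean E B) *m invmx (redU E).

Lemma mean_bmo_osc (V' B' : T -> 'M[C]_d) Q : good Q ->
  {ae mu, forall x, V x = V' x} -> {ae mu, forall x, B x = B' x} ->
  mean (cbox Q) (fun x => (opnorm (bmo_osc (cbox Q) x) `^ p)%:E) =
  ((vol Q)^-1%:E * \int[mu]_(x in hbox Q)
    (opnorm (mpow (V' x) p^-1 *m (B' x - bmean B' Q) *m invmx (redU (cbox Q))) `^ p)%:E)%E.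
Proof.
move=> gQ VV' BB'; apply: mean_hbox => //.
- by move=> x; rewrite lee_fin powR_ge0.
- by move=> x; rewrite lee_fin powR_ge0.
- apply: filterS2 VV' (BB') => x hV hB; rewrite /bmo_osc.
  by rewrite (mxpowR_eq _ hV) hB (mx_mean_bmean gQ BB').
Qed.

Lemma mean_tilde_osc (B' : T -> 'M[C]_d) Q : good Q ->
  {ae mu, forall x, B x = B' x} ->
  mean (cbox Q) (fun x => (opnorm (tilde_osc (cbox Q) x))%:E) =
  ((vol Q)^-1%:E * \int[mu]_(x in hbox Q)
    (opnorm (redV (cbox Q) *m (B' x - bmean B' Q) *m invmx (redU (cbox Q))))%:E)%E.
Proof.
move=> gQ BB'; apply: mean_hbox => //.
- by move=> x; rewrite lee_fin opnorm_ge0.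
- by move=> x; rewrite lee_fin opnorm_ge0.
- apply: filterS (BB') => x hB; rewrite /tilde_osc.
  by rewrite hB (mx_mean_bmean gQ BB').
Qed.

Let red_unit (W : T -> 'M[C]_d) red Q :
  (forall E, rectangle E -> reducing_operator p W E (red E)) -> good Q ->
  red (cbox Q) \in unitmx.
Proof.
move=> rW gQ; have [|pM _ _] := rW (cbox Q); last exact: posdef_unit.
by apply/rectangleP; exists Q.
Qed.

Let rect_cbox Q : good Q -> rectangle (cbox Q : set T).
Proof. by move=> gQ; apply/rectangleP; exists Q. Qed.

Section bmo_le_tilde.
Hypothesis ApU : (Ap_char p U <= K%:E)%E.
Variable Ke : R.
Let c0 : R := (2 `^ p * d%:R `^ p * K)^-1.
Hypotheses (Ke1 : 1 <= Ke) (KeP : forall a b : R, 0 <= a -> 0 <= b ->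
  (a + b) `^ p <= Ke * a `^ p + (1 + c0) * b `^ p).

Definition bmo_cst : R :=
  (d%:R `^ p * (d%:R * (Ke * @majo_cst R n m d p / c0 ^+ 2))) `^ p^-1.

Lemma bmo_le_tilde r : 0 <= r ->
  (forall E, rectangle E -> (mean E (fun x => (opnorm (tilde_osc E x))%:E) <= r%:E)%E) ->
  forall E, rectangle E ->
  (poweR (mean E (fun x => (opnorm (bmo_osc E x) `^ p)%:E)) p^-1 <=
   (bmo_cst * d%:R * r)%:E)%E.
Proof.
move=> r0 hr E /rectangleP[Q gQ ->]; have vQ := vol_gt0 gQ.
have [U' [mU pU UU']] := borel_weight wU.
have [V' [mV pV VV']] := borel_weight wV.
have [B' mB BB'] := borel_mx lB.1.
have dd : 0 < d%:R :> R by rewrite ltr0n.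
have c00 : 0 < c0 by rewrite invr_gt0 !mulr_gt0// powR_gt0.
have A0 : 0 <= bmo_cst by exact: powR_ge0.
apply/lee_addgt0Pr => e e0.
have A1 : 0 < bmo_cst + 1 by rewrite ltr_wpDl.
(* The stopping argument needs t > 0, while r may be 0; the excess contributes at most e to the
   final bound. The factor d passes from the operator to the Frobenius norm. *)
pose t := d%:R * r + e / (bmo_cst + 1).
have t0 : 0 < t by apply: ltr_wpDl; [rewrite mulr_ge0|exact: divr_gt0].
have osc_le Q' : good Q' ->
    (\int[mu]_(x in hbox Q') (osc B' (redU \o cbox) (redV \o cbox) Q' x)%:E <=
     (t * vol Q')%:E)%E.
  move=> gQ'; have vQ' := vol_gt0 gQ'.
  have mG : mxmeas (fun x : T => redV (cbox Q') *m (B' x - bmean B' Q') *m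
      invmx (redU (cbox Q'))).
    apply: mxmeasM; last exact: mxmeas_cst.
    apply: mxmeasM; first exact: mxmeas_cst.
    by apply: mxmeasD => //; apply: mxmeas_cst.
  have := fnorm_integral_le (measurable_hbox Q') d0 mG.
  move/le_trans; apply.
  have := hr _ (rect_cbox gQ'); rewrite (mean_tilde_osc gQ' BB') lee_pdivrMl// => h.
  apply: (@le_trans _ _ (d%:R%:E * ((vol Q')%:E * r%:E))%E).
    by apply: lee_wpmul2l h; rewrite lee_fin.
  rewrite -!EFinM lee_fin mulrCA mulrC.
  apply: ler_wpM2r; first exact: ltW.
  by rewrite lerDl ltW// divr_gt0.
have iB Q' : good Q' -> mxintegrable mu (hbox Q') B'.
  by move=> _; exact: (mxintegrable_borel Q' d0 lB mB BB').
have := @bmo_le _ _ _ _ p K t U' V' B' (redU \o cbox) (redV \o cbox) d0 p1 K1 t0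
  mU pU mV pV iB (fun Q' gQ' => Ap_char_hbox UU' ApU gQ')
  (fun Q' gQ' => red_unit rU gQ') (fun Q' gQ' => red_unit rV gQ')
  (fun Q' e gQ' => reducing_lo e gQ' p0 UU' (rU (rect_cbox gQ')))
  (fun Q' e s gQ' => reducing_hi gQ' p0 UU' (rU (rect_cbox gQ')))
  (fun Q' e gQ' => reducing_lo e gQ' p0 VV' (rV (rect_cbox gQ')))
  osc_le Ke Q Ke1 KeP c00 gQ.
rewrite (mean_bmo_osc gQ VV' BB'); set I1 := (\int[_]_(_ in _) _)%E.
set I2 := (\int[_]_(_ in _) _)%E => hI.
have I21 : (I2 <= I1)%E.
  apply: le_integral_lower => [x|x _]; rewrite lee_fin ?powR_ge0//.
  by apply: (ge0_ler_powR (ltW p0)) (opnorm_le_fnorm _); rewrite nnegrE ?opnorm_ge0 ?fnorm_ge0.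
have {I21}hI := le_trans I21 hI.
set A := d%:R `^ p * (d%:R * (Ke * @majo_cst R n m d p / c0 ^+ 2)).
have A_ge0 : 0 <= A.
  rewrite mulr_ge0 ?powR_ge0// mulr_ge0//.
  by rewrite divr_ge0 ?exprn_ge0 ?(ltW c00)// mulr_ge0 ?majo_cst_ge0// (le_trans _ Ke1).
have I20 : (0 <= (vol Q)^-1%:E * I2)%E.
  apply: mule_ge0; first by rewrite lee_fin invr_ge0 ltW.
  by apply: integral_ge0 => x _; rewrite lee_fin powR_ge0.
have hm : ((vol Q)^-1%:E * I2 <= (A * t `^ p)%:E)%E.
  rewrite lee_pdivrMl// -EFinM; apply: le_trans hI _; rewrite lee_fin.
  by rewrite le_eqVlt; apply/orP; left; apply/eqP; rewrite /A /c0; ring.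
apply: (@le_trans _ _ (bmo_cst * t)%:E).
  rewrite [X in (_ <= X)%E](_ : _ = poweR (A * t `^ p)%:E p^-1); last first.
    rewrite poweR_EFin powRM ?powR_ge0// -powRrM mulfV ?lt0r_neq0//.
    by rewrite powRr1 ?(ltW t0).
  apply: gt0_ler_poweR => //; first by rewrite invr_ge0 ltW.
  - by rewrite in_itv/= leey andbT.
  - by rewrite in_itv/= leey andbT lee_fin mulr_ge0 ?powR_ge0.
rewrite -EFinD lee_fin /t mulrDr mulrA lerD2l mulrCA -[leRHS]mulr1.
by apply: ler_wpM2l; [exact: ltW|rewrite ler_pdivrMr// mul1r lerDl].
Qed.

End bmo_le_tilde.

(** [Ap_hoelder] for V with X = (B - <B>_R) U_R^(-1); the factor d again compares the two matrix
    norms. *)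
Lemma tilde_le_bmo r : (Ap_char p V <= K%:E)%E -> 0 <= r ->
  (forall E, rectangle E ->
    (poweR (mean E (fun x => (opnorm (bmo_osc E x) `^ p)%:E)) p^-1 <= r%:E)%E) ->
  forall E, rectangle E ->
  (mean E (fun x => (opnorm (tilde_osc E x))%:E) <=
   (dual_cst d p K `^ (conj_exp p)^-1 * d%:R * r)%:E)%E.
Proof.
move=> ApV r0 hr E /rectangleP[Q gQ ->]; have vQ := vol_gt0 gQ.
have [V' [mV pV VV']] := borel_weight wV.
have [B' mB BB'] := borel_mx lB.1.
have dd : 0 < d%:R :> R by rewrite ltr0n.
pose X (x : T) := (B' x - bmean B' Q) *m invmx (redU (cbox Q)).
have mX : mxmeas X.
  apply: mxmeasM; last exact: mxmeas_cst.
  by apply: mxmeasD => //; apply: mxmeas_cst.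
pose G (x : T) := mpow (V' x) p^-1 *m (B' x - bmean B' Q) *m invmx (redU (cbox Q)).
have GX x : mpow (V' x) p^-1 *m X x = G x by exact: mulmxA.
have mG : mxmeas G.
  apply: mxmeasM; last exact: mxmeas_cst.
  apply: mxmeasM; first exact: mxmeas_mpow.
  by apply: mxmeasD => //; apply: mxmeas_cst.
have hX : (\int[mu]_(x in hbox Q) (fnorm (mpow (V' x) p^-1 *m X x) `^ p)%:E <=
    ((d%:R * r) `^ p * vol Q)%:E)%E.
  apply: (@le_trans _ _ (\int[mu]_(x in hbox Q) (fnorm (G x) `^ p)%:E)%E).
    apply: le_integral_lower => [x|x _]; rewrite lee_fin ?powR_ge0//.
    by rewrite (GX x).
  apply: (le_trans (fnorm_powR_integral_le (measurable_hbox Q) d0 p0 mG)).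
  have := hr _ (rect_cbox gQ); rewrite (mean_bmo_osc gQ VV' BB').
  set I1 := (\int[_]_(_ in _) _)%E => h.
  have I10 : (0 <= (vol Q)^-1%:E * I1)%E.
    apply: mule_ge0; first by rewrite lee_fin invr_ge0 ltW.
    by apply: integral_ge0 => x _; rewrite lee_fin powR_ge0.
  have {}h : ((vol Q)^-1%:E * I1 <= (r `^ p)%:E)%E.
    rewrite -[leLHS]poweRe1// -(mulVf (lt0r_neq0 p0)) poweRrM -poweR_EFin.
    apply: gt0_ler_poweR => //; first exact: ltW.
    - by rewrite in_itv/= leey andbT poweR_ge0.
    - by rewrite in_itv/= leey andbT lee_fin.
  rewrite lee_pdivrMl// -EFinM in h.
  apply: (@le_trans _ _ ((d%:R `^ p)%:E * (vol Q * r `^ p)%:E)%E).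
    by apply: lee_wpmul2l h; rewrite lee_fin powR_ge0.
  rewrite -EFinM lee_fin powRM//.
  by rewrite le_eqVlt; apply/orP; left; apply/eqP; ring.
have [pM _ _] := rV (rect_cbox gQ).
have := Ap_hoelder d0 p1 K0 vQ (measurable_hbox Q) (mu_hbox gQ) mV pV
  (Ap_char_hbox VV' ApV gQ) (posdef_herm pM)
  (fun e s => reducing_hi gQ p0 VV' (rV (rect_cbox gQ))) mX (powR_ge0 _ _) hX.
rewrite -powRrM mulfV ?lt0r_neq0// powRr1; last by rewrite mulr_ge0// ltW.
move=> h; rewrite (mean_tilde_osc gQ BB') lee_pdivrMl// -EFinM.
apply: le_trans (le_trans h _).
  apply: le_integral_lower => [x|x _]; rewrite lee_fin ?opnorm_ge0//.
  by rewrite -mulmxA; exact: opnorm_le_fnorm.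
rewrite lee_fin.
by rewrite le_eqVlt; apply/orP; left; apply/eqP; ring.
Qed.

End bmo_comparison.

Theorem theorem1p1 (R : realType) (n m d : nat) (p : R)
    (n_gt0 : (0 < n)%N) (m_gt0 : (0 < m)%N) (d_gt0 : (0 < d)%N) (p_gt1 : 1 < p)
    (KU KV : R) :
  exists c1 c2 : R, [/\ 0 < c1, 0 < c2 &
    forall (U V B : Rn R n * Rn R m -> 'M[R[i]]_d)
      (redU redV : set (Rn R n * Rn R m) -> 'M[R[i]]_d),
      Ap_weight p U -> Ap_char p U = KU%:E ->
      Ap_weight p V -> Ap_char p V = KV%:E ->
      (forall E, rectangle E -> reducing_operator p U E (redU E)) ->
      (forall E, rectangle E -> reducing_operator p V E (redV E)) ->
      mx_locally_integrable B ->
      (bmo_norm p V redU B <= c1%:E * bmo_tilde_norm redU redV B)%E /\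
      (bmo_tilde_norm redU redV B <= c2%:E * bmo_norm p V redU B)%E].
Proof.
(* One constant for both weights; K >= 1 ensures c0 <= 1, hence a contraction factor 1 - c0^2 in [0,
   1). *)
pose K := Num.max 1 (Num.max KU KV).
have K1 : 1 <= K by rewrite le_max lexx.
have KUK : KU <= K by rewrite /K !le_max lexx orbT.
have KVK : KV <= K by rewrite /K !le_max lexx !orbT.
have p0 := exp_gt0 p_gt1.
have c0 : 0 < (2 `^ p * d%:R `^ p * K)^-1.
  by rewrite invr_gt0 !mulr_gt0 ?powR_gt0 ?ltr0n// (lt_le_trans _ K1).
(* The loss 1 + c0 is matched to the gain 1 - c0 of the stopping set. *)
have [Ke Ke1 KeP] := le_powRD p0 c0.
pose a1 := @bmo_cst R n m d p K Ke * d%:R.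
pose a2 := dual_cst d p K `^ (conj_exp p)^-1 * d%:R.
have a10 : 0 <= a1 by rewrite mulr_ge0 ?powR_ge0.
have a20 : 0 <= a2 by rewrite mulr_ge0 ?powR_ge0.
have scale (a s : R) : 0 <= a -> 0 <= s -> ((a * s)%:E <= (a + 1)%:E * s%:E)%E.
  by move=> a0 s0; rewrite -EFinM lee_fin ler_wpM2r// lerDl.
(* The added 1 makes the constants positive, which also settles an infinite right side: 0 times
   infinity would be 0. *)
exists (a1 + 1), (a2 + 1); split; [by rewrite ltr_wpDl|by rewrite ltr_wpDl|].
move=> U V B redU redV [wU _] AU [wV _] AV rU rV lB.
have AU' : (Ap_char p U <= K%:E)%E by rewrite AU lee_fin.
have AV' : (Ap_char p V <= K%:E)%E by rewrite AV lee_fin.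
have bmo_ub E : rectangle E ->
    (poweR (mean E (fun x => (opnorm (bmo_osc p V B redU E x) `^ p)%:E)) p^-1 <=
     bmo_norm p V redU B)%E by move=> rE; apply: ereal_sup_ubound; exists E.
have tilde_ub E : rectangle E ->
    (mean E (fun x => (opnorm (tilde_osc B redU redV E x))%:E) <=
     bmo_tilde_norm redU redV B)%E by move=> rE; apply: ereal_sup_ubound; exists E.
split; apply: ge_ereal_sup => _ [E rE <-].
- have t0 : (0 <= bmo_tilde_norm redU redV B)%E.
    apply: le_trans (tilde_ub _ rE); apply: mule_ge0.
      by rewrite lee_fin invr_ge0 fine_ge0.
    by apply: integral_ge0 => x _; rewrite lee_fin opnorm_ge0.
  case: (bmo_tilde_norm redU redV B) t0 tilde_ub => [r r0 tilde_ub|_ _|//].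
  + rewrite lee_fin in r0; apply: (@le_trans _ _ (a1 * r)%:E); last exact: (scale a1 r a10 r0).
    exact: (bmo_le_tilde d_gt0 p_gt1 K1 wU wV lB rU rV AU' Ke1 KeP r0 tilde_ub rE).
  + by rewrite gt0_muley ?leey// lte_fin ltr_wpDl.
- have t0 : (0 <= bmo_norm p V redU B)%E.
    by apply: le_trans (bmo_ub _ rE); exact: poweR_ge0.
  case: (bmo_norm p V redU B) t0 bmo_ub => [r r0 bmo_ub|_ _|//].
  + rewrite lee_fin in r0; apply: (@le_trans _ _ (a2 * r)%:E); last exact: (scale a2 r a20 r0).
    exact: (tilde_le_bmo d_gt0 p_gt1 K1 wV lB rV AV' r0 bmo_ub rE).
  + by rewrite gt0_muley ?leey// lte_fin ltr_wpDl.
Qed.
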